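(* Let $(M^n,g,V)$ be a compact static manifold with boundary with non-positive cosmological constant. Suppose that $M$ is a topological cylinder and that $\Sigma:=V^{-1}(0)$ is contained in the interior $\mathrm{Int}\,M$ of $M$. Then $\Sigma$ is connected.
   Context: All manifolds are orientable and connected. A static manifold with boundary is a triple $(M^n,g,V)$, where $(M^n,g)$ is an $n$-dimensional Riemannian manifold with boundary $\partial M$ and $V\colon M\to\mathbb R$ is a smooth function, not identically zero, satisfying $$\mathrm{Hess}_gV-(\Delta_gV)g-V\,\mathrm{Ric}_g=0\ \text{ in }M,\qquad \frac{\partial V}{\partial\nu}g-VB_g=0\ \text{ on }\partial M .$$ Here $\Delta_g=\mathrm{trace}_g\mathrm{Hess}_g$, $\nu$ is the outward unit normal to $\partial M$ and $B_g$ is the second fundamental form of $\partial M$ with respect to $\nu$ (sign convention: $B_g=g$ for the boundary of the Euclidean unit ball). It is known that the scalar curvature $R_g$ is constant; the cosmological constant $\Lambda$ is defined by $R_g=(n-1)\Lambda$. A topological cylinder is a manifold homeomorphic to $N\times[0,1]$ with $N$ a closed connected manifold. The empty set is regarded as connected. *)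

(* Defs.v *)
From mathcomp Require Import all_boot all_order all_algebra.
From mathcomp Require Import all_classical all_reals all_analysis.
Import Order.TTheory GRing.Theory Num.Theory.
Import numFieldNormedType.Exports.

Set Implicit Arguments.
Unset Strict Implicit.
Unset Printing Implicit Defensive.

Local Open Scope classical_set_scope.
Local Open Scope ring_scope.

Definition homeo_between (X Y : topologicalType) (A : set X) (B : set Y)
    (f : X -> Y) (h : Y -> X) : Prop :=
  [/\ forall x, A x -> B (f x) /\ h (f x) = x,
      forall y, B y -> A (h y) /\ f (h y) = y,
      {within A, continuous f} &
      {within B, continuous h}].

Definition is_chart (X Y : topologicalType) (H : set Y) (U : set X)
    (f : X -> Y) (h : Y -> X) : Prop :=
  open U /\ exists2 W : set Y, open W & homeo_between U (H `&` W) f h.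

(* Boundary not allowed; the dimension may be any natural number. *)
Definition closed_connected_manifold (R : realType) (N : topologicalType) :
    Prop :=
  [/\ hausdorff_space N, @second_countable N, compact [set: N],
      connected [set: N] &
      exists d : nat, forall p : N,
        exists (U : set N) (f : N -> 'rV[R]_d) (h : 'rV[R]_d -> N),
          U p /\ is_chart setT U f h].

Definition topological_cylinder (R : realType) (M : topologicalType) : Prop :=
  exists N : topologicalType, closed_connected_manifold R N /\
  exists (f : M -> N * R) (h : N * R -> M),
    homeo_between [set: M] [set y : N * R | 0 <= y.2 <= 1] f h.

(* Local calculus on the closed half-space of R^(n+1). *)

Definition halfspace (R : realType) (n : nat) : set 'rV[R]_n.+1 :=
  [set x | 0 <= x ord0 ord0].

Fixpoint Ck (R : realType) (n k : nat) (U : set 'rV[R]_n)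
    (f : 'rV[R]_n -> R) : Prop :=
  (forall x, U x -> {for x, continuous f}) /\
  if k is k'.+1 then
    forall i : 'I_n, (forall x, U x -> derivable f x 'e_i) /\
                     Ck k' U (fun x => 'D_('e_i) f x)
  else True.

(* Smoothness on a set A which need not be open: local extendability to smooth
   functions on open subsets of R^n. *)
Definition smooth_on (R : realType) (n : nat) (A : set 'rV[R]_n)
    (f : 'rV[R]_n -> R) : Prop :=
  forall x, A x -> exists (U : set 'rV[R]_n) (F : 'rV[R]_n -> R),
    [/\ open U, U x, forall k, Ck k U F &
        forall y, (A `&` U) y -> F y = f y].

(* The i-th partial derivative relative to the half-space: two-sided, except
   for i = 0 at a boundary point, where the limit is taken over h > 0. *)
Definition pd (R : realType) (n : nat) (i : 'I_n.+1) (f : 'rV[R]_n.+1 -> R)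
    (x : 'rV[R]_n.+1) : R :=
  lim ((h^-1 * (f (x + h *: 'e_i) - f x)) @[h -->
         within [set h : R | halfspace (x + h *: 'e_i)] (0 : R)^']).

(* Row convention, as for [jacobian]: row i holds the i-th partials. *)
Definition jac (R : realType) (n : nat) (F : 'rV[R]_n.+1 -> 'rV[R]_n.+1)
    (x : 'rV[R]_n.+1) : 'M[R]_n.+1 :=
  \matrix_(i, j) pd i (fun y => F y ord0 j) x.

Section LocalGeometry.
Variables (R : realType) (n : nat).
Variable G : 'rV[R]_n.+1 -> 'M[R]_n.+1.
Implicit Types (f : 'rV[R]_n.+1 -> R) (x : 'rV[R]_n.+1) (i j k l m : 'I_n.+1).

Definition ginv x : 'M[R]_n.+1 := invmx (G x).

Definition trace_g (T : 'M[R]_n.+1) x : R :=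
  \sum_i \sum_j ginv x i j * T i j.

(* Gamma^k_{ij} *)
Definition christoffel k i j x : R :=
  2^-1 * \sum_l ginv x k l *
    (pd i (fun y => G y j l) x + pd j (fun y => G y i l) x
     - pd l (fun y => G y i j) x).

Definition hess f x : 'M[R]_n.+1 :=
  \matrix_(i, j) (pd i (pd j f) x - \sum_k christoffel k i j x * pd k f x).

Definition laplacian f x : R := trace_g (hess f x) x.

(* The l-th component of Rm(d_k, d_j) d_i, where
   Rm(X, Y) Z = D_X D_Y Z - D_Y D_X Z - D_[X,Y] Z. *)
Definition riemann l k j i x : R :=
  pd k (christoffel l j i) x - pd j (christoffel l k i) x
  + \sum_m (christoffel l k m x * christoffel m j i x
            - christoffel l j m x * christoffel m k i x).

(* Ric(Y, Z) is the trace of X |-> Rm(X, Y) Z; positive for round spheres. *)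
Definition ricci x : 'M[R]_n.+1 :=
  \matrix_(i, j) \sum_k riemann k k j i x.

Definition scal x : R := trace_g (ricci x) x.

(* Minus the normalized gradient of the coordinate x_0: a unit field, equal at
   x_0 = 0 to the outward unit normal of the half-space for the metric G. *)
Definition nu k x : R := - ginv x k ord0 / Num.sqrt (ginv x ord0 ord0).

Definition normal_deriv f x : R := \sum_k nu k x * pd k f x.

(* g(D_{d_i} nu, d_j); the second fundamental form for tangential (nonzero)
   indices i and j at points where x_0 = 0. *)
Definition second_ff x i j : R :=
  \sum_k (pd i (nu k) x + \sum_l christoffel k i l x * nu l x) * G x k j.

End LocalGeometry.

(* Smooth (n+1)-manifolds with boundary. *)

Record bmanifold (R : realType) (n : nat) (M : topologicalType) := BManifold {
  chart_index : Type;
  dom : chart_index -> set M;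
  phi : chart_index -> M -> 'rV[R]_n.+1;
  psi : chart_index -> 'rV[R]_n.+1 -> M;
  bman_hausdorff : hausdorff_space M;
  bman_second_countable : @second_countable M;
  dom_cover : forall p, exists a, dom a p;
  chartP : forall a, is_chart (@halfspace R n) (dom a) (phi a) (psi a);
  transition_smooth : forall a b (j : 'I_n.+1),
    smooth_on (phi a @` (dom a `&` dom b))
              (fun x => phi b (psi a x) ord0 j)
}.

Section Manifold.
Variables (R : realType) (n : nat) (M : topologicalType) (X : bmanifold R n M).

Definition transition_jac (a b : chart_index X) (p : M) : 'M[R]_n.+1 :=
  jac (fun x => phi b (psi a x)) (phi a p).

Definition mboundary : set M :=
  [set p | exists2 a : chart_index X, dom a p & phi a p ord0 ord0 = 0].

Definition minterior : set M := ~` mboundary.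

(* [o a p] says whether the chart a is positively oriented at p for a
   continuous choice of orientations of the tangent spaces. *)
Definition orientable : Prop :=
  exists o : chart_index X -> M -> bool,
    (forall a p, dom a p -> \forall q \near p, o a q = o a p) /\
    (forall a b p, dom a p -> dom b p ->
       (0 < \det (transition_jac a b p)) = (o a p == o b p)).

Definition smooth_fun (V : M -> R) : Prop :=
  forall a : chart_index X, smooth_on (phi a @` dom a) (V \o psi a).

(* A smooth Riemannian metric, as its family of coordinate matrices. *)
Record riemannian_metric := RiemannianMetric {
  gmx : chart_index X -> 'rV[R]_n.+1 -> 'M[R]_n.+1;
  gmx_smooth : forall a (i j : 'I_n.+1),
    smooth_on (phi a @` dom a) (fun x => gmx a x i j);
  gmx_sym : forall a p, dom a p -> (gmx a (phi a p))^T = gmx a (phi a p);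
  gmx_pos : forall a p, dom a p -> forall v : 'rV[R]_n.+1, v != 0 ->
    0 < (v *m gmx a (phi a p) *m v^T) ord0 ord0;
  gmx_compat : forall a b p, dom a p -> dom b p ->
    gmx a (phi a p) =
      transition_jac a b p *m gmx b (phi b p) *m (transition_jac a b p)^T
}.

Definition static_interior_eq (g : riemannian_metric) (V : M -> R) : Prop :=
  forall a p, dom a p ->
    let G := gmx g a in let v := V \o psi a in let x := phi a p in
    hess G v x - laplacian G v x *: G x - v x *: ricci G x = 0.

Definition static_boundary_eq (g : riemannian_metric) (V : M -> R) : Prop :=
  forall a p, dom a p -> phi a p ord0 ord0 = 0 ->
    let G := gmx g a in let v := V \o psi a in let x := phi a p in
    forall i j : 'I_n.+1, i != ord0 -> j != ord0 ->
      normal_deriv G v x * G x i j - v x * second_ff G x i j = 0.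

Definition static_manifold_with_boundary (g : riemannian_metric)
    (V : M -> R) : Prop :=
  [/\ smooth_fun V, exists p, V p <> 0,
      static_interior_eq g V & static_boundary_eq g V].

(* R_g = (dim M - 1) Lambda, with dim M = n + 1. *)
Definition cosmological_constant (g : riemannian_metric) (Lambda : R) : Prop :=
  forall a p, dom a p ->
    scal (gmx g a) (phi a p) = (n.+1%:R - 1) * Lambda.

End Manifold.

(* Main.v *)
Require Import Defs.
From mathcomp Require Import all_boot all_order all_algebra.
From mathcomp Require Import fingroup perm.
From mathcomp Require Import all_classical all_reals all_analysis.
From mathcomp Require Import ring lra zify.
Import Order.TTheory GRing.Theory Num.Theory.
Import numFieldNormedType.Exports.

Set Implicit Arguments.
Unset Strict Implicit.
Unset Printing Implicit Defensive.

Local Open Scope classical_set_scope.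
Local Open Scope ring_scope.

(** Taking the trace of the static equation gives Delta V = - Lambda V, so that
    Hess V = V (Ric - Lambda g): the second derivatives of V are controlled by V,
    and V is a solution of an elliptic equation whose zeroth order coefficient
    has the good sign, since Lambda <= 0. Two consequences, applied to V and
    to - V, concern the regions {V > 0} and {V < 0}.

    First, V and dV do not vanish together at an interior point: along segments
    (V, dV) solves a linear system of ordinary differential equations, so V
    would vanish nearby, and then everywhere as M is connected
    ([zero_not_critical]). Hence V changes sign at each point of Sigma, and
    Sigma lies in the closure of both regions. Second, by the strong maximum
    principle ([strong_maximum]) each part of {V > 0} which is open and closed
    in it reaches the boundary of M ([positive_part_meets_boundary]): otherwise
    the set where V takes its maximum on this part would be open and closed
    in M.

    The boundary of M consists of the two ends N x {0} and N x {1} of the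
    cylinder ([mboundary_cylinder]). This is the invariance of the boundary, and
    comes down to a Brouwer type theorem: a boundary point of a half-space can
    be avoided by a self-map supported near it, an interior point cannot
    ([euclidean_point_hit]), by the Poincare-Miranda theorem
    ([poincare_miranda]), which in turn follows from the mod 2 degree of a
    labelling of a grid ([degree_eq1]). As Sigma is interior, V has a constant
    sign on each end. If Sigma is not empty, both regions are nonempty and reach
    the boundary, so the ends have opposite signs, and each region is connected
    since it only sees one connected end ([positive_connected]).

    It remains to see that a set Sigma which separates the cylinder in this way
    is connected ([zero_set_connected]). If Sigma is the disjoint union of
    nonempty closed sets K1 and K2, let X be a continuous function which is
    negative on K1 and positive on K2. The vector (X, V) has no zero, and near
    one end V does not vanish; lifting from this end, the angle of (X, V) is a
    well-defined real function on the whole cylinder ([exists_angle_lift]). With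
    V > 0 at this end, it stays between 0 and pi on {V > 0}, so it equals pi on
    K1 and 0 on K2. But {V < 0} is connected and touches both K1 and K2,
    and the angle would have to take the value pi/2 on it, where V > 0. *)

(** * Kuhn's triangulation of a grid, mod 2 *)

Section AlternatingProducts.
Variable (A : comNzRingType).
Hypothesis char2 : forall x : A, x + x = 0.
Variables (a b : nat -> A).

(** The product of the differences of labels along a path from which vertex i
    has been removed: the factors a come before i, the shifted factors b after
    it, and the two differences next to i merge into their sum. *)
Definition face_product (p i : nat) : A :=
  \prod_(0 <= j < p)
    (if (j.+1 < i)%N then a j else if (i <= j)%N then b j else a j + b j).

Lemma face_product_recr p i : (i <= p)%N ->
  face_product p.+1 i = face_product p i * b p.
Proof.
move=> ip; rewrite /face_product big_nat_recr //= ip ltnNge.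
by rewrite (leq_trans ip) //= leqnSn.
Qed.

Lemma face_product_top p : face_product p p.+1 = \prod_(0 <= j < p) a j.
Proof.
rewrite /face_product; apply: eq_big_nat => j /andP[_ jp].
by rewrite ltnS jp.
Qed.

Lemma face_product_mid p :
  face_product p.+1 p.+1 = (\prod_(0 <= j < p) a j) * (a p + b p).
Proof.
rewrite /face_product big_nat_recr //= !ltnn; congr (_ * _).
by apply: eq_big_nat => j /andP[_ jp]; rewrite ltnS jp.
Qed.

(** The terms of the expanded sum cancel in pairs, except one: this and the next
    lemma are the halves of the Leibniz rule on the two sides of the factor that
    is not differentiated. *)
Lemma sum_face_product_low p :
  \sum_(0 <= i < p.+1) face_product p i = \prod_(0 <= j < p) a j.
Proof.
elim: p => [|p IH]; first by rewrite big_nat1 /face_product !big_geq.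
rewrite big_nat_recr //= face_product_mid.
rewrite (eq_big_nat _ _ (F1 := face_product p.+1)
  (F2 := fun i => face_product p i * b p)); last first.
  by move=> i /andP[_ ip]; rewrite face_product_recr.
rewrite -big_distrl /= IH [RHS]big_nat_recr //=.
by rewrite mulrDr addrCA char2 addr0.
Qed.

Lemma sum_face_product_high p :
  \sum_(1 <= i < p.+2) face_product p i = \prod_(0 <= j < p) b j.
Proof.
elim: p => [|p IH]; first by rewrite big_nat1 /face_product !big_geq.
rewrite big_nat_recr //= face_product_top big_nat_recr //= face_product_mid.
rewrite (eq_big_nat _ _ (F1 := face_product p.+1)
  (F2 := fun i => face_product p i * b p)); last first.
  by move=> i /andP[_ ip]; rewrite face_product_recr.
rewrite -big_distrl /= [in RHS]big_nat_recr //= -IH.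
rewrite [in RHS]big_nat_recr //= face_product_top [\prod_(0 <= j < p.+1) a j]big_nat_recr //=.
by rewrite mulrDl mulrDr -!addrA; congr (_ + _); rewrite addrCA char2 addr0.
Qed.

End AlternatingProducts.

Section KuhnChains.
Variables (n k : nat).
Let m := n.+1.
Let vertex := 'I_m -> nat.
Implicit Types (v : {ffun 'I_m -> 'I_k.+1}) (s : 'S_m).

(** The simplices of Kuhn's triangulation: from v, one step in each direction,
    the direction i being taken at time s i. *)
Definition chain v s (j : nat) : vertex := fun i => (v i + (s i < j))%N.

Definition omit (i : nat) (u : nat -> vertex) (j : nat) : vertex :=
  if (j < i)%N then u j else u j.+1.

Lemma F2_addxx (x : 'F_2) : x + x = 0.
Proof. by rewrite -mulr2n -mulr_natl pchar_Zp // mul0r. Qed.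

Lemma sum_involution_F2 (t : 'S_m) (f : 'S_m -> 'F_2) :
  odd_perm t -> (forall s, f (s * t)%g = f s) -> \sum_s f s = 0.
Proof.
move=> todd ft; rewrite (bigID (@odd_perm _)) /=.
rewrite [X in X + _](reindex_inj (mulIg t)) /=.
rewrite (eq_bigl (fun s => ~~ odd_perm s)); last first.
  by move=> s; rewrite odd_permM todd addbT.
by rewrite (eq_bigr f) ?F2_addxx // => s _; exact: ft.
Qed.

Lemma chain_tperm v s (i j : nat) (lt_im : (i.+1 < m)%N) : j != i.+1 ->
  chain v (s * tperm (Ordinal (ltnW lt_im)) (Ordinal lt_im)) j = chain v s j.
Proof.
move=> ji; apply: funext => x; rewrite /chain permM; congr (_ + _)%N.
by case: tpermP => [->|->|//] /=; congr nat_of_bool; apply/idP/idP; lia.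
Qed.

(** The chain that starts one step later. Its last face is the first face of the
    given chain, unless this face lies on the boundary of the grid; there the
    base point wraps around, which makes the map a bijection. *)
Definition chain_shift (vs : {ffun 'I_m -> 'I_k.+1} * 'S_m) :
    {ffun 'I_m -> 'I_k.+1} * 'S_m :=
  ([ffun i => if vs.2 i == ord0 then ordS (vs.1 i) else vs.1 i],
   (vs.2 * perm (@ord_pred_inj m))%g).

Lemma chain_shift_inj : injective chain_shift.
Proof.
move=> [v s] [v' s'] [/= /ffunP Ev /mulIg Es]; subst s'; congr (_, _).
by apply/ffunP => i; have := Ev i; rewrite !ffunE; case: ifP => // _ /ordS_inj.
Qed.

Variable Phi : (nat -> vertex) -> 'F_2.
Hypothesis Phi_ext : forall w w',
  (forall j, (j < m)%N -> w j = w' j) -> Phi w = Phi w'.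
Hypothesis Phi_low : forall w (i : 'I_m),
  (forall j, (j < m)%N -> w j i = 0%N) -> Phi w = 0.
Hypothesis Phi_high : forall w (i : 'I_m),
  (forall j, (j < m)%N -> w j i = k.+1) -> Phi w = 0.

Lemma chain_shift_face v s :
  Phi (omit 0 (chain v s)) =
  Phi (omit m (chain (chain_shift (v, s)).1 (chain_shift (v, s)).2)).
Proof.
pose a := (s^-1)%g ord0; have sa : s a = ord0 by rewrite permKV.
have [vak|vak] := eqVneq (v a) ord_max.
  rewrite (Phi_high (i := a)); last first.
    by move=> j _; rewrite /omit /chain /= vak sa /= addn1.
  rewrite (Phi_low (i := a)) // => j jm.
  rewrite /omit jm /chain /= ffunE sa eqxx vak permM permE sa /=.
  by rewrite modnn add0n modn_small //; apply/eqP; rewrite eqb0 -leqNgt.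
apply: Phi_ext => j jm; rewrite /omit jm /=; apply: funext => i.
rewrite /chain /chain_shift /= !ffunE permM permE /=.
case: (eqVneq (s i) ord0) => [si|si].
  have -> : i = a by apply: (@perm_inj _ s); rewrite si sa.
  rewrite sa /= (@modn_small n) // modn_small; last first.
    by have := ltn_ord (v a); move: vak; rewrite -val_eqE /=; lia.
  by rewrite (_ : (n < j)%N = false) ?addn0 ?addn1 //; move: jm; rewrite /m; lia.
congr (_ + nat_of_bool _)%N.
move: si; rewrite -val_eqE /= => si.
have slt : (s i < n.+1)%N := ltn_ord (s i).
have -> : ((s i + m).-1 %% m = (s i).-1)%N.
  rewrite (_ : (s i + m).-1 = ((s i).-1 + m)%N); last first.
    by rewrite -[in LHS](prednK (n := s i)) // lt0n.
  by rewrite modnDr modn_small // (leq_ltn_trans (leq_pred _) slt).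
by rewrite -[in LHS](prednK (n := s i)) // lt0n.
Qed.

(** The mod 2 Stokes formula: in the subdivision of the grid into chains, an
    inner face of codimension one is shared by two chains. *)
Lemma sum_faces_chains :
  \sum_(v : {ffun 'I_m -> 'I_k.+1}) \sum_(s : 'S_m)
    \sum_(0 <= i < m.+1) Phi (omit i (chain v s)) = 0.
Proof.
under eq_bigr => v _ do rewrite exchange_big /=.
rewrite exchange_big /= big_nat_recl // big_nat_recr //=.
rewrite [X in _ + (X + _)]big1_seq ?add0r; last first.
  move=> i /=; rewrite mem_index_iota => /andP[_ lt_in].
  have lt_im : (i.+1 < m)%N by rewrite /m.
  apply: big1 => v _.
  apply: (@sum_involution_F2 (tperm (Ordinal (ltnW lt_im)) (Ordinal lt_im))).
    by rewrite odd_tperm -val_eqE /= neq_ltn ltnSn.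
  move=> s; apply: Phi_ext => j jm; rewrite /omit.
  by case: ifP => ji; rewrite chain_tperm //; lia.
rewrite !pair_big /= [X in _ + X](reindex_inj chain_shift_inj) /=.
rewrite [X in _ + X](eq_bigr (fun p => Phi (omit 0 (chain p.1 p.2)))) ?F2_addxx //.
by move=> [v s] _; rewrite [RHS]chain_shift_face.
Qed.

End KuhnChains.

Section Degree.
Variables (n k : nat).
Local Notation m := n.+1.
Local Notation vertex := ('I_m -> nat).
Implicit Types (lam : nat -> vertex -> 'F_2) (u : nat -> vertex).

(** The sum over the grid of the cup product of the coboundaries of the labels. *)
Definition degree lam : 'F_2 :=
  \sum_(v : {ffun 'I_m -> 'I_k.+1}) \sum_(s : 'S_m)
    \prod_(0 <= j < m) (lam j (chain v s j.+1) + lam j (chain v s j)).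

(** A primitive, for the coboundary, of the term of the degree in which the label
    of index t is mu. *)
Definition face_label lam (mu : vertex -> 'F_2) (t : nat) u : 'F_2 :=
  \prod_(0 <= j < t) (lam j (u j.+1) + lam j (u j)) * mu (u t) *
  \prod_(t <= e < n) (lam e.+1 (u e.+1) + lam e.+1 (u e)).

Definition upd lam (t : nat) (mu : vertex -> 'F_2) : nat -> vertex -> 'F_2 :=
  fun j => if j == t then mu else lam j.

Lemma face_label_omit_le lam mu t u i : (i <= t)%N ->
  face_label lam mu t (omit i u) =
  face_product (fun j => lam j (u j.+1) + lam j (u j))
               (fun j => lam j (u j.+2) + lam j (u j.+1)) t i *
  (mu (u t.+1) *
   \prod_(t <= e < n) (lam e.+1 (u e.+2) + lam e.+1 (u e.+1))).
Proof.
move=> it; rewrite /face_label -mulrA; congr (_ * (_ * _)).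
- apply: eq_big_nat => j /andP[_ jt]; rewrite /omit.
  case: (ltnP j.+1 i) => h1; first by rewrite (ltnW h1).
  case: (leqP i j) => // h2.
  by rewrite addrACA [_ + lam j (u j.+2)]addrC -addrA
    [lam j (u j.+1) + _]addrC -!addrA F2_addxx addr0.
- by rewrite /omit ltnNge it.
- apply: eq_big_nat => e /andP[te _].
  by rewrite /omit !ltnNge (leq_trans it te) (leq_trans it (leqW te)).
Qed.

Lemma face_label_omit_gt lam mu t u i : (t <= n)%N -> (0 < i)%N ->
  face_label lam mu t (omit (i + t) u) =
  \prod_(0 <= j < t) (lam j (u j.+1) + lam j (u j)) * mu (u t) *
  face_product (fun j => lam (j + t).+1 (u (j + t).+1) + lam (j + t).+1 (u (j + t)%N))
               (fun j => lam (j + t).+1 (u (j + t).+2) + lam (j + t).+1 (u (j + t).+1))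
     (n - t) i.
Proof.
move=> tn i0; rewrite /face_label; congr (_ * _ * _).
- by apply: eq_big_nat => j /andP[_ jt]; rewrite /omit !ifT //; lia.
- by rewrite /omit ifT //; lia.
- rewrite -{1}[t]add0n big_addn; apply: eq_big_nat => j /andP[_ jt].
  rewrite /omit; case: (ltnP j.+1 i) => h1; first by rewrite !ifT //; lia.
  case: (leqP i j) => h2; first by rewrite !ifF //; lia.
  rewrite ifF; last by lia.
  rewrite ifT; last by lia.
  by rewrite addrACA [_ + lam _ (u (j + t).+2)]addrC -addrA
    [lam _ (u (j + t).+1) + _]addrC -!addrA F2_addxx addr0.
Qed.

(** The Leibniz rule for the coboundary: omitting a vertex up to t telescopes the
    factors on the left of mu, omitting a later one those on the right. *)
Lemma sum_face_label lam mu t u : (t < m)%N ->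
  \sum_(0 <= i < m.+1) face_label lam mu t (omit i u) =
  \prod_(0 <= j < m) (upd lam t mu j (u j.+1) + upd lam t mu j (u j)).
Proof.
rewrite ltnS => tn.
rewrite (@big_cat_nat _ _ _ t.+1) //=; last by rewrite !ltnS (leq_trans tn).
under [X in X + _]eq_big_nat => i /andP[_ it] do rewrite face_label_omit_le //.
rewrite -big_distrl /= sum_face_product_low; last exact: F2_addxx.
rewrite -[t.+1 in X in _ + X]add1n big_addn subSn ?leqW //  subSn //.
under [X in _ + X]eq_big_nat => i /andP[i0 _] do rewrite face_label_omit_gt //.
rewrite -big_distrr /= sum_face_product_high; last exact: F2_addxx.
rewrite [in RHS](@big_cat_nat _ _ _ t) //=; last exact: leqW.
rewrite [\prod_(t <= j < m) _]big_ltn // /upd eqxx -!mulrA.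
rewrite [X in _ * _ + _ * (_ * X) = _](_ : _ =
  \prod_(t <= e < n) (lam e.+1 (u e.+2) + lam e.+1 (u e.+1))); last first.
  by rewrite -[in RHS](add0n t) big_addn.
rewrite -mulrDr -mulrDl; congr (_ * (_ * _)).
  by apply: eq_big_nat => j /andP[_ jt]; rewrite ltn_eqF.
rewrite big_add1 /=; apply: eq_big_nat => j /andP[tj _].
by rewrite gtn_eqF // ltnS.
Qed.

Definition face_labels lam := forall (i : 'I_m) (w : vertex),
  (w i = 0%N -> lam i w = 0) /\ (w i = k.+1 -> lam i w = 1).

(** Stokes' formula for the primitive [face_label]: on a boundary face
    that is normal to the axis t the factor mu vanishes, and
    on one that is normal to an other axis i the label of index i is
    constant. *)
Lemma degree_upd0 lam mu (t : 'I_m) : face_labels lam ->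
  (forall w, w t = 0%N -> mu w = 0) -> (forall w, w t = k.+1 -> mu w = 0) ->
  degree (upd lam t mu) = 0.
Proof.
move=> lamP mu0 mu1; rewrite /degree.
under eq_bigr => v _ do
  (under eq_bigr => s _ do rewrite -sum_face_label ?(ltn_ord t)//).
have const c w (i : 'I_m) : (forall j, (j < m)%N -> w j i = c) -> i != t ->
    (forall z z', z i = c -> z' i = c -> lam i z = lam i z') ->
  face_label lam mu t w = 0.
  rewrite -val_eqE /= neq_ltn => wi it lamc; have := ltn_ord i.
  rewrite /face_label ltnS => im; case/orP: it => it.
    rewrite [X in X * _ * _](_ : _ = 0) ?mul0r //.
    apply/eqP; rewrite prodf_seq_eq0; apply/hasP; exists (val i) => /=.
      by rewrite mem_index_iota.
    rewrite (lamc _ (w i)) ?F2_addxx // wi //; have := ltn_ord t; lia.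
  rewrite [X in _ * X](_ : _ = 0) ?mulr0 //.
  apply/eqP; rewrite prodf_seq_eq0; apply/hasP; exists (val i).-1 => /=.
    by rewrite mem_index_iota; lia.
  rewrite prednK ?(leq_trans _ it) // (lamc _ (w i)) ?F2_addxx // wi //; lia.
apply: sum_faces_chains => [w w' ww'|w i wi|w i wi].
- rewrite /face_label ww' //; congr (_ * _ * _);
    apply: eq_big_nat => j /andP[tj jt]; have := ltn_ord t => tm.
    by rewrite !ww' //; lia.
  by rewrite !ww' //; lia.
- have [it|it] := eqVneq i t.
    by rewrite it in wi; rewrite /face_label mu0 ?wi // mulr0 mul0r.
  by apply: (const 0%N w i) => // z z' /(lamP i z).1 -> /(lamP i z').1 ->.
- have [it|it] := eqVneq i t.
    by rewrite it in wi; rewrite /face_label mu1 ?wi // mulr0 mul0r.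
  by apply: (const k.+1 w i) => // z z' /(lamP i z).2 -> /(lamP i z').2 ->.
Qed.

Definition step_label (j : nat) (w : vertex) : 'F_2 := (0 < w (inord j))%N%:R.

Lemma step_labelP : face_labels step_label.
Proof.
by move=> i w; rewrite /step_label inord_val; split => ->.
Qed.

Lemma degreeD lam (t : 'I_m) mu1 mu2 :
  degree (upd lam t (fun w => mu1 w + mu2 w)) =
  degree (upd lam t mu1) + degree (upd lam t mu2).
Proof.
rewrite /degree -big_split; apply: eq_bigr => v _; rewrite -big_split.
apply: eq_bigr => s _ /=.
rewrite !big_mkord (bigD1 t) //= [in RHS](bigD1 t) //= [X in _ = _ + X](bigD1 t) //= /upd eqxx.
pose P := \prod_(i < m | i != t)
  (lam i (chain v s i.+1) + lam i (chain v s i)).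
have E mu : \prod_(i < m | i != t)
     ((if val i == t then mu else lam i) (chain v s i.+1)
    + (if val i == t then mu else lam i) (chain v s i)) = P.
  by apply: eq_bigr => i it; rewrite val_eqE (negPf it).
by rewrite !E -mulrDl; congr (_ * _); rewrite addrACA.
Qed.

Lemma degree_step : degree step_label = 1.
Proof.
have zero (v : {ffun 'I_m -> 'I_k.+1}) (s : 'S_m) (i : 'I_m) : v i != ord0 \/ s i != i ->
  \prod_(0 <= j < m)
     (step_label j (chain v s j.+1) + step_label j (chain v s j)) = 0.
  move=> vs; apply/eqP; rewrite prodf_seq_eq0; apply/hasP.
  exists (val i) => /=; first by rewrite mem_index_iota /=.
  rewrite /step_label /chain inord_val.
  have [vi|vi] := eqVneq (v i) ord0; last first.
    have v0 : (0 < v i)%N by rewrite lt0n.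
    by rewrite !ltn_addr // F2_addxx.
  case: vs => [|si]; first by rewrite vi.
  move: si; rewrite -val_eqE /= => /negPf si.
  by rewrite vi /= !add0n ltnS [(s i <= i)%N]leq_eqVlt si /= F2_addxx.
rewrite /degree (bigD1 [ffun=> ord0]) //= (bigD1 1%g) //=.
rewrite [X in X + _ + _]big1_seq; last first.
  move=> j; rewrite mem_index_iota /= => jm.
  by rewrite /step_label /chain /= ffunE perm1 inordK // ltnSn ltnn /= addr0.
rewrite [X in _ + X + _]big1 => [|s s1]; last first.
  have [i si] : exists i, s i != i.
    apply/existsP; apply: contraR s1 => /existsPn s1; apply/eqP/permP => i.
    by rewrite perm1; apply/eqP; rewrite -[_ == _]negbK.
  by apply: (zero _ _ i); right.
rewrite [X in _ + _ + X]big1 ?addr0 // => v v0; apply: big1 => s _.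
have [i vi] : exists i, v i != ord0.
  apply/existsP; apply: contraR v0 => /existsPn v0; apply/eqP/ffunP => i.
  by rewrite ffunE; apply/eqP; rewrite -[_ == _]negbK.
by apply: (zero _ _ i); left.
Qed.

(** By linearity and [degree_upd0] the labels can be replaced one after the other
    by the step labels of their axes, for which a single chain contributes. *)
Lemma degree_eq1 lam : face_labels lam -> degree lam = 1.
Proof.
move=> lamP; rewrite -degree_step.
pose l (t : nat) (j : nat) := if (j < t)%N then step_label j else lam j.
suff H t : (t <= m)%N -> degree (l t) = degree lam.
  rewrite -(H m) //; apply: eq_bigr => v _; apply: eq_bigr => s _.
  by apply: eq_big_nat => j /andP[_ jm]; rewrite /l jm.
elim: t => [//|t IH tm]; rewrite -IH ?(ltnW tm) //.
pose o := Ordinal tm.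
have E : l t = upd (l t) o (lam t).
  by apply: funext => j; rewrite /upd /l /=; case: eqVneq => // ->; rewrite ltnn.
have E' : l t.+1 = upd (l t) o (step_label t).
  apply: funext => j; rewrite /upd /l /=; case: eqVneq => [->|jt].
    by rewrite ltnSn.
  by rewrite ltnS leq_eqVlt (negPf jt).
have ltP : face_labels (l t).
  by move=> i w; rewrite /l; case: ifP => _; [exact: step_labelP|exact: lamP].
have : degree (upd (l t) o (fun w => step_label t w + lam t w)) = 0.
  apply: degree_upd0 => // w wt.
    by rewrite ((step_labelP o w).1 wt) ((lamP o w).1 wt) addr0.
  by rewrite ((step_labelP o w).2 wt) ((lamP o w).2 wt) F2_addxx.
rewrite degreeD -E -E' => /eqP; rewrite addr_eq0 => /eqP ->.
by apply/eqP; rewrite eq_sym -subr_eq0 opprK F2_addxx.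
Qed.
End Degree.

(** Kuhn's cubical form of Sperner's lemma: since the degree is nonzero, some
    chain contributes to it, and each label changes along this chain. *)
Lemma exists_multilabelled_cube (n k : nat) (lam : 'I_n.+1 -> ('I_n.+1 -> nat) -> bool) :
  (forall i w, w i = 0%N -> lam i w = false) ->
  (forall i w, w i = k.+1 -> lam i w = true) ->
  exists v : {ffun 'I_n.+1 -> 'I_k.+1}, forall i, exists w w' : 'I_n.+1 -> nat,
    [/\ forall l, (v l <= w l <= (v l).+1)%N,
        forall l, (v l <= w' l <= (v l).+1)%N, lam i w = false & lam i w' = true].
Proof.
move=> lam0 lam1.
pose L (j : nat) (w : 'I_n.+1 -> nat) : 'F_2 := (lam (inord j) w)%:R.
have LP : face_labels k L.
  by move=> i w; rewrite /L inord_val; split => [/lam0 ->|/lam1 ->].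
have := degree_eq1 LP; rewrite /degree => deg1.
have [v /existsP[s vs]] : exists v : {ffun 'I_n.+1 -> 'I_k.+1}, [exists s : 'S_n.+1,
    \prod_(0 <= j < n.+1) (L j (chain v s j.+1) + L j (chain v s j)) != 0].
  apply/existsP; apply: contraPT deg1 => /existsPn H; rewrite big1 => [|v _].
    by move/eqP; rewrite eq_sym oner_eq0.
  by apply: big1 => s _; have /existsPn/(_ s) := H v; rewrite negbK => /eqP.
exists v => i; move: vs; rewrite prodf_seq_neq0 => /allP/(_ (val i)).
rewrite mem_index_iota /= => /(_ (ltn_ord i)); rewrite /L inord_val.
have box j l : (v l <= chain v s j l <= (v l).+1)%N.
  by rewrite /chain leq_addr -[(v l).+1]addn1 leq_add2l leq_b1.
case E : (lam i (chain v s i.+1)); case E' : (lam i (chain v s i)) => //.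
  by move=> _; exists (chain v s i), (chain v s i.+1).
by move=> _; exists (chain v s i.+1), (chain v s i).
Qed.

(** * The Poincare-Miranda theorem *)

Section PoincareMiranda.
Variables (R : realType) (n : nat).
Local Notation E := 'rV[R]_n.+1.

Lemma rV_norm_le (x : E) (r : R) : 0 <= r ->
  (`|x| <= r) = [forall i, `|x ord0 i| <= r].
Proof.
move=> r0; rewrite [`|x|]mx_normrE; apply/idP/forallP => [/bigmax_leP[_ h] i|h].
  exact: (h (ord0, i)).
by apply/bigmax_leP; split => // -[i j] _ /=; rewrite ord1.
Qed.

Lemma rV_norm_coord (x : E) i : `|x ord0 i| <= `|x|.
Proof. by have := rV_norm_le x (normr_ge0 x); rewrite lexx => /esym/forallP. Qed.

Definition cube (c : E) (r : R) : set E := [set x | `|x - c| <= r].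

Lemma cube_compact c r : compact (cube c r).
Proof.
apply: bounded_closed_compact.
  exists (`|c| + r); split; first exact: num_real.
  move=> M Mr x /= xc; apply: le_trans (ltW Mr).
  by rewrite -[x](subrK c) (le_trans (ler_normD _ _)) // addrC lerD2l.
rewrite (_ : cube c r = closed_ball_ (fun x => `|x|) c r); last first.
  by apply/seteqP; split => x; rewrite /cube /closed_ball_ /= distrC.
exact: closed_closed_ball_.
Qed.

Variables (F : E -> E) (c : E) (r : R).
Hypothesis r_gt0 : 0 < r.
Hypothesis F_cont : {within cube c r, continuous F}.
Hypothesis F_low : forall i x, cube c r x -> x ord0 i = c ord0 i - r ->
  F x ord0 i < 0.
Hypothesis F_high : forall i x, cube c r x -> x ord0 i = c ord0 i + r ->
  0 < F x ord0 i.

Let same_sign (d : R) (x : E) := exists i : 'I_n.+1,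
  (forall y, cube c r y -> `|y - x| < d -> 0 < F y ord0 i) \/
  (forall y, cube c r y -> `|y - x| < d -> F y ord0 i < 0).

(** Compactness makes the scale uniform. *)
Lemma uniform_same_sign : (forall x, cube c r x -> F x != 0) ->
  \forall d \near 0^'+, cube c r `<=` same_sign d.
Proof.
move=> F0; have := (compact_near_coveringP (cube c r)).1 (@cube_compact c r).
apply => x Bx; have [i Fi] : exists i, F x ord0 i != 0.
  apply/existsP; apply: contraR (F0 x Bx) => /existsPn H; apply/eqP/rowP => i.
  by rewrite mxE; apply/eqP; rewrite -[_ == _]negbK.
have Fc : F y ord0 i @[y --> within (cube c r) (nbhs x)] --> F x ord0 i.
  have Fx := (subspace_continuousP _ _).1 F_cont x Bx.
  exact: (cvg_comp _ _ Fx (@coord_continuous R 1 n.+1 ord0 i (F x))).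
have key (Q : R -> Prop) : (\forall z \near F x ord0 i, Q z) ->
    exists2 e, 0 < e & forall x' d y, `|x' - x| < e -> d < e ->
      cube c r y -> `|y - x'| < d -> Q (F y ord0 i).
  move=> /Fc; rewrite /= /within /= near_simpl => /nbhs_ballP [e /= e0 He].
  exists (e / 2); first by rewrite divr_gt0.
  move=> x' d y xx' de By yx'; apply: He => //.
  rewrite -ball_normE /= distrC -[y](subrK x') -addrA.
  rewrite (le_lt_trans (ler_normD _ _)) // [e]splitr ltrD //.
  exact: lt_trans de.
have prod (e : R) : 0 < e ->
    (forall x' d, `|x' - x| < e -> d < e -> same_sign d x') ->
  \forall x' \near x & d \near 0^'+, same_sign d x'.
  move=> e0 H; exists (ball x e, [set d | d < e]) => /=.
    by split; [exact: nbhsx_ballx|exact: nbhs_right_lt].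
  by move=> [x' d] /= [+ de]; rewrite -ball_normE /= distrC => xx'; exact: H.
have [Fn|Fp|F00] := ltgtP (F x ord0 i) 0; last by rewrite F00 eqxx in Fi.
- have [|e e0 He] := key (fun z => z < 0).
    by near=> z; near: z; apply: lt_nbhsl.
  by apply: (prod e e0) => x' d xx' de; exists i; right => y; exact: He.
- have [|e e0 He] := key (fun z => 0 < z); first exact: lt_nbhsr.
  by apply: (prod e e0) => x' d xx' de; exists i; left => y; exact: He.
Unshelve. all: by end_near. Qed.

(** The Poincare-Miranda theorem, from Kuhn's lemma for the signs of the
    components of F on a grid whose mesh is below the scale at which some
    component keeps a constant sign. *)
Theorem poincare_miranda : exists2 x, cube c r x & F x = 0.
Proof.
apply: contrapT => noroot.
have /uniform_same_sign Fu : forall x, cube c r x -> F x != 0.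
  by move=> x Bx; apply/eqP => Fx; apply: noroot; exists x.
have [d [d0 {}Fu]] : exists d : R, 0 < d /\ cube c r `<=` same_sign d.
  near (0 : R)^'+ => d; exists d; split; first by near: d; exact: nbhs_right_gt.
  by near: d.
pose k := Num.bound (r *+ 2 / d).
pose h := r *+ 2 / k.+1%:R.
have h0 : 0 < h by rewrite divr_gt0 // mulrn_wgt0.
have hd : h < d.
  rewrite /h ltr_pdivrMr // mulrC -ltr_pdivrMr //.
  apply: lt_trans (archi_boundP _) _; last by rewrite ltr_nat.
  by rewrite divr_ge0 ?mulrn_wge0 ?ltW.
pose pt (w : 'I_n.+1 -> nat) : E := \row_i (c ord0 i - r + h * (w i)%:R).
pose lam (i : 'I_n.+1) (w : 'I_n.+1 -> nat) :=
  if w i == 0%N then false else if w i == k.+1 then true else 0 < F (pt w) ord0 i.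
have [||v vP] := @exists_multilabelled_cube n k lam.
- by move=> i w wi; rewrite /lam wi.
- by move=> i w wi; rewrite /lam wi eqxx.
have hk : h * k.+1%:R = r *+ 2 by rewrite /h divfK.
have ptB w : (forall l, (w l <= k.+1)%N) -> cube c r (pt w).
  move=> wk; rewrite /cube /= rV_norm_le ?ltW //; apply/forallP => i.
  rewrite !mxE ler_norml; have : 0 <= h * (w i)%:R <= r *+ 2.
    rewrite -hk; apply/andP; split; first by rewrite mulr_ge0 // ltW.
    by rewrite ler_wpM2l ?ler_nat // ltW.
  lra.
have boxk l w : (v l <= w l <= (v l).+1)%N -> (w l <= k.+1)%N.
  by move=> /andP[_ /leq_trans]; apply; rewrite ltn_ord.
pose vn (l : 'I_n.+1) : nat := v l.
have vB : cube c r (pt vn).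
  by apply: ptB => l; exact: ltnW (ltn_ord (v l)).
have near_v w : (forall l, (v l <= w l <= (v l).+1)%N) -> `|pt w - pt vn| < d.
  move=> wv; apply: le_lt_trans hd; rewrite rV_norm_le ?ltW //.
  apply/forallP => i; rewrite !mxE.
  rewrite (_ : _ - _ = h * ((w i)%:R - (v i)%:R)); last by lra.
  rewrite normrM gtr0_norm // ger_pMr //; have /andP[vw wv1] := wv i.
  by rewrite -natrB // normr_nat lern1; lia.
have [i iP] := Fu _ vB; have [w [w' [wv w'v lw lw']]] := vP i.
have wk l : (w l <= k.+1)%N by apply: boxk.
have w'k l : (w' l <= k.+1)%N by apply: boxk.
have Fw : F (pt w) ord0 i <= 0.
  move: lw; rewrite /lam; case: eqVneq => [wi _|_].
    by apply/ltW/F_low; [exact: ptB|rewrite mxE wi mulr0 addr0].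
  by case: ifP => // _ /negbT; rewrite -leNgt.
have Fw' : 0 < F (pt w') ord0 i.
  move: lw'; rewrite /lam; case: eqVneq => // _; case: eqVneq => // wi _.
  by apply: F_high; [exact: ptB|rewrite mxE wi hk; lra].
case: iP => iP.
  by have := iP _ (ptB _ wk) (near_v _ wv); rewrite ltNge Fw.
by have := iP _ (ptB _ w'k) (near_v _ w'v); rewrite ltNge ltW.
Unshelve. all: by end_near. Qed.
End PoincareMiranda.

(** * Invariance of the boundary *)

Lemma homeo_between_sub (X Y : topologicalType) (A A' : set X) (B B' : set Y)
    (f : X -> Y) (h : Y -> X) :
  homeo_between A B f h -> A' `<=` A -> (forall x, A x -> A' x <-> B' (f x)) ->
  B' `<=` B -> homeo_between A' B' f h.
Proof.
move=> [fP hP fc hc] A'A AB B'B; split.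
- by move=> x A'x; split; [exact/(AB _ (A'A _ A'x))|exact: (fP x (A'A _ A'x)).2].
- move=> y B'y; have [hy fhy] := hP y (B'B _ B'y); split=> //.
  by apply/(AB _ hy); rewrite fhy.
- exact: continuous_subspaceW fc.
- exact: continuous_subspaceW hc.
Qed.

Lemma homeo_between_continuous (X Y : topologicalType) (A : set X) (B : set Y)
    (f : X -> Y) (h : Y -> X) x :
  homeo_between A B f h -> open A -> A x -> {for x, continuous f}.
Proof.
move=> [_ _ + _] oA Ax; rewrite continuous_open_subspace //; apply.
by rewrite inE.
Qed.

Lemma continuous_near_eq (X Y : topologicalType) (f g : X -> Y) (x : X) :
  (\forall y \near x, f y = g y) -> {for x, continuous f} -> {for x, continuous g}.
Proof.
move=> fg fc; rewrite /prop_for /continuous_at -(nbhs_singleton fg).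
exact: (cvg_trans (near_eq_cvg fg) fc).
Qed.

Lemma open_preimage_in (X Y : topologicalType) (A : set X) (B : set Y) (f : X -> Y) :
  open A -> (forall x, A x -> {for x, continuous f}) -> open B ->
  open (A `&` f @^-1` B).
Proof.
rewrite !openE => oA fc oB x [Ax Bx]; apply: filterI; first exact: oA.
by apply: fc => //; exact: oB.
Qed.

Lemma dist_continuous (R : realType) n (c : 'rV[R]_n) :
  continuous (fun x : 'rV[R]_n => `|x - c|).
Proof.
move=> y; have yc : {for y, continuous (fun x : 'rV[R]_n => x - c)}.
  by apply: continuousB; [exact: cvg_id|exact: cst_continuous].
exact: (continuous_comp yc (@norm_continuous _ _ (y - c))).
Qed.

Section InvarianceOfBoundary.
Variable (R : realType).

Lemma ball_rVE n (x : 'rV[R]_n) r y : ball x r y = (`|y - x| < r) :> Prop.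
Proof. by rewrite -ball_normE /= distrC. Qed.

Lemma open_subcube n (W : set 'rV[R]_n.+1) c : open W -> W c ->
  exists2 r, 0 < r & cube c r `<=` W.
Proof.
rewrite openE => /(_ c) /[apply] /nbhs_ballP [e /= e0 eW].
exists (e / 2); first by rewrite divr_gt0.
move=> x xc; apply: eW; rewrite ball_rVE; apply: le_lt_trans xc _.
by rewrite ltr_pdivrMr // ltr_pMr // ltr1n.
Qed.

(** A point with a Euclidean neighbourhood is hit by every self-map supported
    in a small neighbourhood: seen in a cube, such a map fixes the faces, so
    the Poincare-Miranda theorem applies to it. *)
Lemma euclidean_point_hit n (M : topologicalType) (U : set M)
    (W : set 'rV[R]_n.+1) f h p :
  open U -> open W -> homeo_between U W f h -> U p ->
  exists E : set M, [/\ open E, E p &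
    forall tau : M -> M, continuous tau -> (forall q, ~ E q -> tau q = q) ->
      (forall q, E q -> E (tau q)) -> exists q, tau q = p].
Proof.
move=> oU oW hom Up; have [fP hP _ _] := hom.
have [Wfp hfp] := fP p Up.
have fc q : U q -> {for q, continuous f} by exact: homeo_between_continuous hom oU.
have hc x : W x -> {for x, continuous h}.
  apply: (@homeo_between_continuous _ _ W U h f) => //.
  by case: hom => *; split.
have [r r0 BW] := open_subcube oW Wfp; set c := f p in BW Wfp hfp.
exists (U `&` f @^-1` ball c r); split; first exact/open_preimage_in/ball_open.
  by split=> //; exact: ballxx.
move=> tau tauc tauid tauE.
pose F (x : 'rV[R]_n.+1) : 'rV[R]_n.+1 := f (tau (h x)) - c.
have tauU x : cube c r x -> U (tau (h x)).
  move=> /BW /hP [Uhx fhx]; have [xr|xr] := pselect (ball c r x).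
    by apply: (tauE (h x) _).1; split => //=; rewrite fhx.
  by rewrite tauid // => -[_] /=; rewrite fhx.
have face x : cube c r x -> ~ ball c r x -> F x = x - c.
  move=> Bx xr; have [Uhx fhx] := hP x (BW _ Bx).
  by rewrite /F tauid ?fhx // => -[_] /=; rewrite fhx.
have far (x : 'rV[R]_n.+1) i : r <= `|x ord0 i - c ord0 i| -> ~ ball c r x.
  rewrite ball_rVE => rx /(le_lt_trans (rV_norm_coord _ i)).
  by rewrite !mxE ltNge rx.
have [|i x Bx xi|i x Bx xi|x Bx Fx] := @poincare_miranda R n F c r r0.
- apply: continuous_in_subspaceT => x; rewrite inE => Bx.
  apply: continuousB; last exact: cst_continuous.
  apply: (@continuous_comp _ _ _ (tau \o h) f); last exact/fc/tauU.
  by apply: continuous_comp; [exact/hc/BW|exact: tauc].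
- have xr : ~ ball c r x by apply: (far _ i); rewrite xi addrAC subrr sub0r normrN gtr0_norm.
  by rewrite face // !mxE xi addrAC subrr sub0r oppr_lt0.
- have xr : ~ ball c r x by apply: (far _ i); rewrite xi addrAC subrr add0r gtr0_norm.
  by rewrite face // !mxE xi addrAC subrr add0r.
exists (h x); have [_ <-] := fP _ (tauU x Bx).
by move/eqP: Fx; rewrite subr_eq0 => /eqP ->.
Qed.

(** A boundary point of a half-space chart can be avoided: push the half-space
    inwards near the point. *)
Lemma halfspace_point_avoided n (M : topologicalType) (U : set M)
    (W : set 'rV[R]_n.+1) f h p (E : set M) :
  hausdorff_space M -> open U -> open W ->
  homeo_between U (@halfspace R n `&` W) f h -> U p -> f p ord0 ord0 = 0 ->
  open E -> E p ->
  exists tau : M -> M, [/\ continuous tau, forall q, ~ E q -> tau q = q,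
    forall q, E q -> E (tau q) & forall q, tau q <> p].
Proof.
move=> hM oU oW hom Up fp0 oE Ep; have [fP hP _ hcont] := hom.
have [[Hc Wc] hfp] := fP p Up; set c := f p in fp0 Hc Wc hfp.
have fc q : U q -> {for q, continuous f} by exact: homeo_between_continuous hom oU.
have hc x : (@halfspace R n `&` W) x ->
    h @ within (@halfspace R n `&` W) (nbhs x) --> h x.
  exact: (subspace_continuousP _ _).1.
have [r r0 rP] : exists2 r, 0 < r &
    forall x, `|x - c| < r -> halfspace x -> W x /\ E (h x).
  have /nbhs_ballP[r1 /= r10 r1P] : nbhs c W by move: oW; rewrite openE; exact.
  have : nbhs (h c) E by rewrite hfp; move: oE; rewrite openE; exact.
  move=> /(hc c (conj Hc Wc)); rewrite /= /within /= near_simpl.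
  move=> /nbhs_ballP[r2 /= r20 r2P].
  exists (Num.min r1 r2); first by rewrite lt_min r10.
  move=> x; rewrite lt_min => /andP[x1 x2] Hx.
  have Wx : W x by apply: r1P; rewrite ball_rVE.
  by split=> //; apply: r2P => //; rewrite ball_rVE.
pose e0 : 'rV[R]_n.+1 := delta_mx ord0 ord0.
(* The height of the push at y: half the radius at the centre, and 0 outside of
   the half-size cube. *)
pose b (y : 'rV[R]_n.+1) : R := Num.max 0 (r / 2 - `|y - c|).
pose G (y : 'rV[R]_n.+1) : 'rV[R]_n.+1 := y + b y *: e0.
have b_ge0 y : 0 <= b y by rewrite /b le_max lexx.
have G0 y : G y ord0 ord0 = y ord0 ord0 + b y.
  by rewrite !mxE eqxx mulr1.
have HG y : halfspace y -> halfspace (G y).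
  by rewrite /halfspace /= G0 => y0; exact: addr_ge0.
have norm_e0 : `|e0| <= 1.
  rewrite rV_norm_le //; apply/forallP => i; rewrite mxE.
  by case: (_ && _); rewrite ?normr1 ?normr0.
have Gr y : `|y - c| < r -> `|G y - c| < r.
  move=> yr; rewrite /G addrAC (le_lt_trans (ler_normD _ _)) //.
  apply: (@le_lt_trans _ _ (`|y - c| + b y)).
    by rewrite lerD2l normrZ ger0_norm // ler_piMr.
  rewrite /b; case: (leP 0 (r / 2 - `|y - c|)) => hb; last by rewrite addr0.
  by rewrite addrC subrK ltr_pdivrMr // ltr_pMr // ltr1n.
have Gid y : r / 2 <= `|y - c| -> G y = y.
  by move=> yr; rewrite /G /b max_l ?scale0r ?addr0 // subr_le0.
have bc : continuous b.
  move=> y; pose g (z : 'rV[R]_n.+1) : R^o := r / 2 - `|z - c|.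
  suff gc : {for y, continuous g}.
    exact: (@continuous_max R _ (fun=> 0 : R^o) g y (@cst_continuous _ _ _ y) gc).
  by apply: continuousB; [exact: cst_continuous|exact: dist_continuous].
have Gc : continuous G.
  move=> y; have := @continuousZr_tmp _ _ _ b e0 y (bc y).
  by apply: continuousD; exact: cvg_id.
pose O q := U q /\ `|f q - c| < r.
pose tau q := if pselect (O q) then h (G (f q)) else q.
have Hf q : U q -> halfspace (f q) by move=> /fP[[]].
have GW q : O q -> (@halfspace R n `&` W) (G (f q)) /\ E (h (G (f q))).
  move=> [Uq qr]; have HGq : halfspace (G (f q)) by apply/HG/Hf.
  by have [WG EG] := rP _ (Gr _ qr) HGq.
have cr y : `|y - c| <= r / 2 -> `|y - c| < r.
  by move=> /le_lt_trans; apply; rewrite ltr_pdivrMr // ltr_pMr // ltr1n.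
pose C := h @` (@halfspace R n `&` cube c (r / 2)).
have HWr x : halfspace x -> `|x - c| < r -> (@halfspace R n `&` W) x.
  by move=> Hx xr; have [] := rP x xr Hx.
have clH : closed (@halfspace R n).
  apply: (@closed_comp _ _ (fun x : 'rV[R]_n.+1 => x ord0 ord0) [set y | 0 <= y]).
    by move=> x _; exact: coord_continuous.
  exact: closed_ge.
have clC : closed C.
  apply: compact_closed => //; apply: continuous_compact; last first.
    rewrite setIC; apply: compact_closedI => //; exact: cube_compact.
  by apply: continuous_subspaceW hcont => x [Hx /cr]; exact: HWr.
have tau_id q : ~ C q -> tau q = q.
  rewrite /tau => Cq; case: pselect => // -[Uq qr].
  rewrite Gid ?(fP q Uq).2 // leNgt; apply/negP => qr2; apply: Cq.
  exists (f q); last exact: (fP q Uq).2.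
  by split; [exact: Hf|exact: ltW].
have CO q : C q -> O q.
  move=> [x [Hx xr] <-]; have [Ux fhx] := hP x (HWr x Hx (cr _ xr)).
  by split=> //; rewrite fhx; exact: cr.
have CE q : C q -> E q.
  by move=> [x [Hx /cr xr] <-]; have [] := rP x xr Hx.
have oO : open O.
  have -> : O = U `&` f @^-1` ball c r.
    by apply/seteqP; split => q [Uq qr]; split => //;
      move: qr; rewrite /= ball_rVE.
  exact/open_preimage_in/ball_open.
exists tau; split.
- move=> q; have [Cq|Cq] := pselect (C q); last first.
    apply: (@continuous_near_eq _ _ id); last exact: cvg_id.
    have : nbhs q (~` C) by apply: open_nbhs_nbhs; split=> //; exact: closed_openC.
    by apply: filterS => z /tau_id ->.
  have Oq := CO q Cq.
  have nO : nbhs q O by apply: open_nbhs_nbhs.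
  apply: (@continuous_near_eq _ _ (fun q => h (G (f q)))).
    by apply: filterS nO => z; rewrite /tau; case: pselect.
  move=> A /(hc _ (GW q Oq).1); rewrite /= /within /= near_simpl => nA.
  have /= := continuous_comp (fc q Oq.1) (Gc (f q)) nA.
  rewrite /= near_simpl => nA'.
  by apply: filterS2 nO nA' => z Oz; apply; exact: (GW z Oz).1.
- by move=> q Eq; apply: tau_id => /CE.
- by move=> q Eq; rewrite /tau; case: pselect => [Oq|//]; exact: (GW q Oq).2.
- move=> q; rewrite /tau; case: pselect => [Oq /= hGp|nOq /= qp]; last first.
    by apply: nOq; rewrite qp; split=> //; rewrite /c subrr normr0.
  have [WG _] := GW q Oq; have Gcq : G (f q) = c by rewrite -(hP _ WG).2 hGp.
  have := congr1 (fun x : 'rV[R]_n.+1 => x ord0 ord0) Gcq.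
  rewrite /= G0 fp0 => /eqP; rewrite paddr_eq0 //; last exact: (Hf q Oq.1).
  move=> /andP[_ /eqP b0]; move: Gcq b0; rewrite /G => + b0.
  rewrite b0 scale0r addr0 => fq; move: b0; rewrite /b fq subrr normr0 subr0.
  by rewrite max_r => [/eqP|]; rewrite ?(gt_eqF, ltW) ?divr_gt0.
Qed.

(** A boundary point of one chart can be avoided by self-maps supported near it,
    an interior point of another chart cannot. The dimensions of the two charts
    need not be compared. *)
Theorem boundary_invariance n d (M : topologicalType) (U U' : set M)
    (f : M -> 'rV[R]_n.+1) h (f' : M -> 'rV[R]_d.+1) h' p :
  hausdorff_space M ->
  is_chart (@halfspace R n) U f h -> is_chart (@halfspace R d) U' f' h' ->
  U p -> U' p -> f p ord0 ord0 = 0 -> f' p ord0 ord0 = 0.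
Proof.
move=> hM [oU [W oW hom]] [oU' [W' oW' hom']] Up U'p fp0.
apply/eqP/negPn/negP => f'p0.
have [f'P _ _ _] := hom'.
pose P := [set x : 'rV[R]_d.+1 | 0 < x ord0 ord0].
have oP : open P.
  apply: (@open_comp _ _ (fun x : 'rV[R]_d.+1 => x ord0 ord0) [set y | 0 < y]).
    by move=> x _; exact: coord_continuous.
  exact: open_gt.
have oU'' : open (U' `&` f' @^-1` P).
  by apply: open_preimage_in => // q; exact: (homeo_between_continuous hom').
have hom'' : homeo_between (U' `&` f' @^-1` P) (P `&` W') f' h'.
  apply: homeo_between_sub hom' _ _ _; first by move=> x [].
    by move=> x U'x; have [[_ W'x] _] := f'P x U'x; split => -[].
  by move=> x [Px W'x]; split=> //; exact: ltW.
have U''p : (U' `&` f' @^-1` P) p.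
  by split=> //; rewrite /P /= lt_def f'p0 /=; case: (f'P p U'p) => -[].
have [E [oE Ep hit]] := euclidean_point_hit oU'' (openI oP oW') hom'' U''p.
have [tau [tauc tauid tauE avoid]] :=
  halfspace_point_avoided hM oU oW hom Up fp0 oE Ep.
by have [q /avoid] := hit tau tauc tauid tauE.
Qed.

End InvarianceOfBoundary.

(** * The boundary of a topological cylinder *)

Lemma continuous_pair (T U W : topologicalType) (f : T -> U) (g : T -> W) x :
  {for x, continuous f} -> {for x, continuous g} ->
  {for x, continuous (fun t => (f t, g t))}.
Proof. exact: cvg_pair. Qed.
Lemma fst_continuous (U W : topologicalType) : continuous (@fst U W).
Proof. by move=> x; exact: cvg_fst. Qed.
Lemma snd_continuous (U W : topologicalType) : continuous (@snd U W).
Proof. by move=> x; exact: cvg_snd. Qed.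

Lemma rV_continuous (R : realType) (T : topologicalType) n (g : T -> 'rV[R]_n) x :
  (forall i, {for x, continuous (fun t => g t ord0 i)}) -> {for x, continuous g}.
Proof.
move=> gc; apply/cvgrPdist_le => e e0.
have : \forall t \near x, forall i : 'I_n, `|g x ord0 i - g t ord0 i| <= e.
  apply: filter_forall => i; have /cvgrPdist_le := gc i; exact.
case: n g gc => [|n] g gc; first by move=> _; apply: nearW => t; rewrite thinmx0 normr0 ltW.
apply: filterS => t gt; rewrite rV_norm_le ?ltW //; apply/forallP => i.
by rewrite !mxE.
Qed.

Lemma row_mx_ord0 (R : pzRingType) d (t : R) (x : 'rV[R]_d) :
  (row_mx t%:M x : 'rV[R]_d.+1) ord0 ord0 = t.
Proof.
have E := row_mxEl (t%:M : 'M[R]_1) x ord0 ord0.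
have E0 : lshift d (ord0 : 'I_1) = (ord0 : 'I_d.+1) by apply: val_inj.
by rewrite [RHS]mxE eqxx mulr1n E0 in E; rewrite -[RHS]E.
Qed.

Lemma row_mx_rshift (R : pzRingType) d (t : R) (x : 'rV[R]_d) j :
  (row_mx t%:M x : 'rV[R]_d.+1) ord0 (rshift 1 j) = x ord0 j.
Proof. exact: row_mxEr. Qed.

Section Cylinder.
Variables (R : realType) (M N : topologicalType).
Variables (f : M -> N * R) (h : N * R -> M).
Hypothesis fh : homeo_between [set: M] [set y : N * R | 0 <= y.2 <= 1] f h.

Lemma cylinder_fh y : 0 <= y.2 <= 1 -> f (h y) = y.
Proof. by case: fh => _ hP _ _ /hP[]. Qed.

Lemma cylinder_hf p : h (f p) = p.
Proof. by case: fh => fP _ _ _; case: (fP p I). Qed.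

Lemma cylinder_f2 p : 0 <= (f p).2 <= 1.
Proof. by case: fh => fP _ _ _; case: (fP p I). Qed.

Lemma cylinder_f_continuous : continuous f.
Proof. by move=> p; apply: (homeo_between_continuous fh) => //; exact: openT. Qed.

Definition clamp (t : R) : R := Num.max 0 (Num.min 1 t).

Lemma clamp_itv t : 0 <= clamp t <= 1.
Proof. by rewrite /clamp le_max lexx /= ge_max ler01 ge_min lexx. Qed.

Lemma clamp_id t : 0 <= t <= 1 -> clamp t = t.
Proof. by move=> /andP[t0 t1]; rewrite /clamp min_r // max_r. Qed.

Lemma clamp_continuous : continuous clamp.
Proof.
move=> t; pose m (s : R) : R^o := Num.min 1 s.
have mc : {for t, continuous m}.
  exact: (@continuous_min R _ (fun=> 1 : R^o) (fun s => s : R^o) t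
            (@cst_continuous _ _ _ t) cvg_id).
exact: (@continuous_max R _ (fun=> 0 : R^o) m t (@cst_continuous _ _ _ t) mc).
Qed.

(** The homeomorphism, made total by clamping the height. *)
Definition hclamp (y : N * R) : M := h (y.1, clamp y.2).

Lemma cylinder_h_cvg (T : Type) (F : set_system T) (FF : Filter F)
    (g : T -> N * R) (y : N * R) :
  (forall s, 0 <= (g s).2 <= 1) -> 0 <= y.2 <= 1 -> g @ F --> y ->
  h (g s) @[s --> F] --> h y.
Proof.
move=> g01 y01 gy A hA; have [_ _ _ hc] := fh.
have := (subspace_continuousP _ _).1 hc y y01 _ hA.
move=> hA'; have {}hA' : F (g @^-1` _) := gy _ hA'.
by apply: (@filterS _ F) hA' => s /=; apply; exact: g01.
Qed.

Lemma hclamp_continuous : continuous hclamp.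
Proof.
move=> y; apply: (@cylinder_h_cvg _ (nbhs y) _
  (fun z : N * R => (z.1, clamp z.2)) (y.1, clamp y.2)).
- by move=> s; exact: clamp_itv.
- exact: clamp_itv.
- apply: continuous_pair; first exact: fst_continuous.
  exact: (continuous_comp (@snd_continuous _ _ y) (@clamp_continuous y.2)).
Qed.

(** Both ends are treated at once: [e] tells from which one the height is
    measured. *)
Definition depth (e : bool) (t : R) : R := if e then 1 - t else t.

Lemma depthK e : involutive (depth e).
Proof. by case: e => // t; rewrite /depth subKr. Qed.

Lemma depth_itv e t : 0 <= t <= 1 -> 0 <= depth e t <= 1.
Proof. by case: e => //; rewrite /depth => /andP[? ?]; apply/andP; split; lra. Qed.

Lemma depth_continuous e : continuous (depth e).
Proof.
case: e => t; rewrite /depth; last exact: cvg_id.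
by apply: continuousB; [exact: cst_continuous|exact: cvg_id].
Qed.

(** The first coordinate of this half-space chart is the depth, so the points of
    the boundary hyperplane are those of the end with depth 0. *)
Lemma cylinder_chart d (UN : set N) (fN : N -> 'rV[R]_d) hN e :
  is_chart setT UN fN hN ->
  let phi p : 'rV[R]_d.+1 :=
    row_mx (depth e (f p).2)%:M (fN (f p).1) : 'rV[R]_(1 + d) in
  let psi (y : 'rV[R]_d.+1) :=
    h (hN (rsubmx (y : 'rV[R]_(1 + d))), depth e (y ord0 ord0)) in
  is_chart (@halfspace R d) [set p | UN (f p).1 /\ depth e (f p).2 < 1] phi psi.
Proof.
move=> [oU [W oW]]; rewrite setTI => hom phi psi; have [fP hP _ _] := hom.
have phi0 p : phi p ord0 ord0 = depth e (f p).2 by exact: row_mx_ord0.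
have phir p : rsubmx (phi p : 'rV[R]_(1 + d)) = fN (f p).1 by rewrite row_mxKr.
have fNc x : UN x -> {for x, continuous fN} by exact: homeo_between_continuous hom oU.
have hNc x : W x -> {for x, continuous hN}.
  by apply: (@homeo_between_continuous _ _ W UN hN fN) => //; case: hom.
have f1c p : {for p, continuous (fun q => (f q).1)}.
  exact: (continuous_comp (@cylinder_f_continuous p) (@fst_continuous _ _ (f p))).
have f2c p : {for p, continuous (fun q => depth e (f q).2)}.
  have fc2 := continuous_comp (@cylinder_f_continuous p) (@snd_continuous _ _ (f p)).
  exact: (continuous_comp fc2 (@depth_continuous e (f p).2)).
have rc (y : 'rV[R]_d.+1) :
    {for y, continuous (fun y : 'rV[R]_d.+1 => rsubmx (y : 'rV[R]_(1 + d)))}.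
  apply: rV_continuous => i.
  rewrite (_ : (fun _ => _) = fun y : 'rV[R]_d.+1 => y ord0 (rshift 1 i)).
    exact: coord_continuous.
  by apply: funext => z; rewrite mxE.
have yc (y : 'rV[R]_d.+1) :
    {for y, continuous (fun y : 'rV[R]_d.+1 => y ord0 ord0)}.
  exact: coord_continuous.
pose WM := [set y : 'rV[R]_d.+1 |
  W (rsubmx (y : 'rV[R]_(1 + d))) /\ y ord0 ord0 < 1].
have oWM : open WM.
  rewrite (_ : WM = (fun y : 'rV[R]_d.+1 => rsubmx (y : 'rV[R]_(1 + d))) @^-1` W `&`
                 (fun y : 'rV[R]_d.+1 => y ord0 ord0) @^-1` [set t | t < 1]) //.
  apply: openI; apply: open_comp => //; first by move=> y _; exact: rc.
  by move=> y _; exact: yc.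
split.
  rewrite (_ : [set _ | _] = (fun p => (f p).1) @^-1` UN `&`
             (fun p => depth e (f p).2) @^-1` [set t | t < 1]) //.
  apply: openI; apply: open_comp => //; first by move=> p _; exact: f1c.
  by move=> p _; exact: f2c.
exists WM => //.
have psi_in y : (@halfspace R d `&` WM) y ->
    0 <= depth e (y ord0 ord0) <= 1.
  by move=> [Hy [_ /ltW y1]]; apply: depth_itv; rewrite Hy.
split.
- move=> p [Up p1]; split.
    split; first by rewrite /halfspace /= phi0; have /andP[] := depth_itv e (cylinder_f2 p).
    by rewrite /WM /= phir phi0; split=> //; case: (fP _ Up).
  rewrite /psi phir phi0 depthK (fP _ Up).2 -surjective_pairing.
  exact: cylinder_hf.
- move=> y Wy; have y01 := psi_in y Wy.
  have fpsi : f (psi y) = (hN (rsubmx (y : 'rV[R]_(1 + d))), depth e (y ord0 ord0)).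
    by rewrite cylinder_fh.
  have [Hy [WNy y1]] := Wy; have [UNy fhN] := hP _ WNy.
  split; first by rewrite /= fpsi depthK.
  rewrite /phi fpsi /= depthK fhN; apply: etrans (hsubmxK (y : 'rV[R]_(1 + d))).
  congr (row_mx _ _); apply/rowP => i; rewrite !mxE (ord1 i) mulr1n.
  have E0 : lshift d (ord0 : 'I_1) = (ord0 : 'I_d.+1) by apply: val_inj.
  by rewrite E0.
- apply: continuous_in_subspaceT => p; rewrite inE => -[Up _].
  apply: rV_continuous => i.
  have [->|[j ->]] : i = ord0 \/ exists j, i = rshift 1 j.
    by case: (split_ordP (i : 'I_(1 + d))) => j ->; [left; rewrite ord1; exact: val_inj|right; exists j].
    by rewrite (_ : (fun _ => _) = (fun q => depth e (f q).2)) //; apply: funext.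
  rewrite (_ : (fun _ => _) = (fun q => fN (f q).1 ord0 j)); last first.
    by apply: funext => q; exact: row_mx_rshift.
  apply: (@continuous_comp _ _ _ (fun q => fN (f q).1) (fun x : 'rV[R]_d => x ord0 j)).
    by apply: (@continuous_comp _ _ _ (fun q => (f q).1) fN); [exact: f1c|exact: fNc].
  exact: coord_continuous.
- apply/subspace_continuousP => y Wy A.
  have [_ _ _ hc] := fh.
  have yc2 : {for y, continuous (fun z : 'rV[R]_d.+1 => depth e (z ord0 ord0))}.
    exact: (continuous_comp (yc y) (@depth_continuous e _)).
  have yc1 : {for y, continuous
      (fun z : 'rV[R]_d.+1 => hN (rsubmx (z : 'rV[R]_(1 + d))))}.
    exact: (continuous_comp (rc y) (hNc _ Wy.2.1)).
  have := (subspace_continuousP _ _).1 hc (_, _) (psi_in y Wy) A.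
  move=> /[apply] hA; have {}hA : nbhs y (_ @^-1` _) := continuous_pair yc1 yc2 hA.
  by apply: (@filterS _ (nbhs y)) hA => z /= zA Wz; apply: zA; exact: psi_in.
Qed.

Lemma cylinder_end_chart : closed_connected_manifold R N -> forall p, exists d
   (U : set M) (phi : M -> 'rV[R]_d.+1) psi, [/\ U p, is_chart (@halfspace R d) U phi psi
   & phi p ord0 ord0 = 0 <-> (f p).2 = 0 \/ (f p).2 = 1].
Proof.
move=> [_ _ _ _ [d chartN]] p.
have [UN [fN [hN [Up chN]]]] := chartN (f p).1.
pose e := (f p).2 == 1.
have /= ch := cylinder_chart e chN.
exists d; do 3 eexists; split; [|exact: ch|].
  split=> //; have /andP[p0 p1] := cylinder_f2 p.
  by rewrite /e /depth; case: eqVneq => [->|p1']; [lra|rewrite lt_neqAle p1'].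
rewrite row_mx_ord0.
rewrite /e /depth; case: eqVneq => [->|/eqP p1].
  by split => _; [right|rewrite subrr].
by split => [->|[]//]; left.
Qed.

End Cylinder.

(** Invariance of the boundary, used in both directions between the charts of the
    manifold and those that come from the cylinder. *)
Lemma mboundary_cylinder (R : realType) n (M : topologicalType)
    (X : bmanifold R n M) (N : topologicalType) (f : M -> N * R) h :
  closed_connected_manifold R N ->
  homeo_between [set: M] [set y : N * R | 0 <= y.2 <= 1] f h ->
  forall p, mboundary X p <-> (f p).2 = 0 \/ (f p).2 = 1.
Proof.
move=> NP fh p; have hM := bman_hausdorff X.
have [d [U [phi' [psi' [Up ch end_p]]]]] := cylinder_end_chart fh NP p.
split => [[a ap phi0]|/end_p phi0].
  exact/end_p/(boundary_invariance hM (chartP a) ch ap Up).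
have [a ap] := dom_cover X p; exists a => //.
exact: (boundary_invariance hM ch (chartP a) Up ap phi0).
Qed.

(** * Lifting the angle of a planar vector field on a cylinder *)

Lemma unit_lt1 (R : realDomainType) (c s : R) :
  c ^+ 2 + s ^+ 2 = 1 -> s != 0 -> -1 < c < 1.
Proof.
move=> cs s0; have s2 : 0 < s ^+ 2 by rewrite exprn_even_gt0.
by rewrite -ltr_norml -(expr_lt1 (n := 2)) // real_normK ?num_real // -cs ltrDl.
Qed.

Lemma dot_gt0_close (R : realDomainType) (c s c' s' : R) :
  c ^+ 2 + s ^+ 2 = 1 -> c' ^+ 2 + s' ^+ 2 = 1 ->
  `|c - c'| < 1 -> `|s - s'| < 1 -> 0 < c * c' + s * s'.
Proof.
move=> cs cs' cc ss.
have {}cc : (c - c') ^+ 2 < 1 by rewrite -real_normK ?num_real // expr_lt1.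
have {}ss : (s - s') ^+ 2 < 1 by rewrite -real_normK ?num_real // expr_lt1.
nra.
Qed.

Section AngleLift.
Variables (R : realType) (M N : topologicalType).
Variables (f : M -> N * R) (h : N * R -> M).
Hypothesis fh : homeo_between [set: M] [set y : N * R | 0 <= y.2 <= 1] f h.
Hypothesis M_compact : compact [set: M].

(* A continuous map (C, S) to the unit circle that only depends on the clamped
   height. *)
Variables (C S : N * R -> R).
Hypothesis C_continuous : continuous C.
Hypothesis S_continuous : continuous S.
Hypothesis CS1 : forall y, C y ^+ 2 + S y ^+ 2 = 1.
Hypothesis C_clamp : forall x t, C (x, clamp t) = C (x, t).
Hypothesis S_clamp : forall x t, S (x, clamp t) = S (x, t).
Hypothesis S_start : forall x, 0 < S (x, 0).

Let dot (x : N) (t t' : R) := C (x, t) * C (x, t') + S (x, t) * S (x, t').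

Lemma clamp_lipschitz (s t : R) : `|clamp s - clamp t| <= `|s - t|.
Proof.
rewrite /clamp ler_norml; have := ler_norm (s - t); have := ler_norm (t - s).
rewrite [`|t - s|]distrC /Num.max /Num.min.
by do !case: ifP; move=> *; apply/andP; split; lra.
Qed.

(** Along the segments of a fine enough uniform subdivision of the height, the
    direction (C, S) turns by less than a right angle. *)
Lemma uniform_dot_gt0 :
  exists2 d : R, 0 < d & forall x t t', `|t' - t| <= d -> 0 < dot x t t'.
Proof.
pose P (d : R) p := forall t', `|t' - (f p).2| <= d -> 0 < dot (f p).1 (f p).2 t'.
have dP : \forall d \near 0^'+, [set: M] `<=` P d.
  apply: ((compact_near_coveringP _).1 M_compact) => p _.
  case fp : (f p) => [x0 t0].
  pose y0 : N * R := (x0, t0).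
  have e0 : 0 < 2^-1 :> R by rewrite invr_gt0.
  have nearC : \forall y \near y0, `|C y0 - C y| < 2^-1.
    by have /cvgrPdist_lt := @C_continuous y0; apply.
  have nearS : \forall y \near y0, `|S y0 - S y| < 2^-1.
    by have /cvgrPdist_lt := @S_continuous y0; apply.
  have [[A B] /= [nA /nbhs_ballP[e /= e_gt0 eB]] AB] : nbhs y0
      [set y | `|C y0 - C y| < 2^-1 /\ `|S y0 - S y| < 2^-1].
    exact: filterI.
  have e2 : 0 < e / 2 by rewrite divr_gt0.
  have nfp : nbhs p (f @^-1` (A `*` ball t0 (e / 2))).
    apply: (cylinder_f_continuous fh); rewrite fp; exists (A, ball t0 (e / 2)) => //=.
    by split=> //; exact: nbhsx_ballx.
  exists (f @^-1` (A `*` ball t0 (e / 2)), [set d | d < e / 2]) => /=.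
    by split=> //; exact: nbhs_right_lt.
  move=> [q d] /= [[Aq Bq] de] t' t'q.
  have [qC qS] : `|C y0 - C (f q)| < 2^-1 /\ `|S y0 - S (f q)| < 2^-1.
    apply: AB; split=> //; apply: eB; apply: le_ball Bq.
    by rewrite ler_pdivrMr // ler_peMr ?ler1n // ltW.
  have [tC tS] : `|C y0 - C ((f q).1, t')| < 2^-1 /\ `|S y0 - S ((f q).1, t')| < 2^-1.
    apply: AB; split=> //; apply: eB; rewrite /ball /= [e]splitr.
    apply: le_lt_trans (ler_distD (f q).2 _ _) _; apply: ltrD; first by have := Bq; rewrite -ball_normE.
    by rewrite distrC; apply: le_lt_trans t'q de.
  rewrite /dot -surjective_pairing; apply: dot_gt0_close => //.
    rewrite -(subrK (C y0) (C (f q))) -addrA [ltRHS]splitr.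
    apply: le_lt_trans (ler_normD _ _) _; apply: ltrD; last by rewrite mul1r.
    by rewrite distrC mul1r.
  rewrite -(subrK (S y0) (S (f q))) -addrA [ltRHS]splitr.
  apply: le_lt_trans (ler_normD _ _) _; apply: ltrD; last by rewrite mul1r.
  by rewrite distrC mul1r.
near (0 : R)^'+ => d; exists d; first by near: d; exact: nbhs_right_gt.
have cover : [set: M] `<=` P d by near: d.
move=> x t t' tt'; have := cover (h (x, clamp t)) I (clamp t').
rewrite /P (cylinder_fh fh) /=; last exact: clamp_itv.
by rewrite /dot !C_clamp !S_clamp; apply; apply: le_trans tt'; exact: clamp_lipschitz.
Unshelve. all: by end_near. Qed.

(** One more layer of height d adds the angle between the directions at the
    heights clipped to k d and to (k + 1) d; its sine is the cross product [cr] and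
    its cosine the positive dot product [dt]. *)
Lemma exists_partial_lift (d : R) :
  (forall x t t', `|t' - t| <= d -> 0 < dot x t t') -> 0 < d -> forall k : nat,
  exists a : N * R -> R, [/\ continuous a,
    forall x t, cos (a (x, t)) = C (x, Num.min t (k%:R * d)),
    forall x t, sin (a (x, t)) = S (x, Num.min t (k%:R * d)) &
    forall x, 0 < a (x, 0) < pi].
Proof.
move=> dP d0; elim => [|k [a [ac aC aS a0]]].
  have Citv x : -1 < C (x, 0) < 1 by apply: unit_lt1 (CS1 _) (lt0r_neq0 (S_start x)).
  have CitvW x : -1 <= C (x, 0) <= 1 by have /andP[/ltW-> /ltW] := Citv x.
  have min0 t : clamp (Num.min t (0%:R * d)) = clamp 0.
    rewrite mul0r /clamp /Num.max /Num.min; do !case: ifP; lra.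
  exists (fun y => acos (C (y.1, 0))); split.
  - move=> y; apply: (@continuous_comp _ _ _ (fun y : N * R => C (y.1, 0)) acos).
      apply: (@continuous_comp _ _ _ (fun y : N * R => (y.1, 0 : R)) C); last exact: C_continuous.
      by apply: continuous_pair; [exact: fst_continuous|exact: cst_continuous].
    exact/continuous_acos/Citv.
  - by move=> x t /=; rewrite acosK ?in_itv //= -[in RHS]C_clamp min0 C_clamp.
  - move=> x t /=; rewrite sin_acos // -[in RHS]S_clamp min0 S_clamp.
    by rewrite -(CS1 (x, 0)) [_ + S _ ^+ 2]addrC addrK sqrtr_sqr gtr0_norm.
  - by move=> x /=; have /andP[? ?] := Citv x; rewrite acos_gt0 ?acos_ltpi //; apply/andP; split=> //; exact: ltW.
pose lo (y : N * R) := (y.1, Num.min y.2 (k%:R * d)).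
pose hi (y : N * R) := (y.1, Num.min y.2 (k.+1%:R * d)).
pose cr y := C (lo y) * S (hi y) - S (lo y) * C (hi y).
pose dt y := C (lo y) * C (hi y) + S (lo y) * S (hi y).
have dt_gt0 y : 0 < dt y.
  apply: dP; rewrite ler_norml -natr1 mulrDl mul1r /Num.min.
  by do !case: ifP; move=> *; apply/andP; split; lra.
have crdt y : cr y ^+ 2 + dt y ^+ 2 = 1.
  rewrite -[RHS]mulr1 -{1}(CS1 (lo y)) -(CS1 (hi y)) /cr /dt; ring.
have cr_itv y : -1 < cr y < 1 by apply: unit_lt1 (crdt y) (lt0r_neq0 (dt_gt0 y)).
have cr_itvW y : -1 <= cr y <= 1 by have /andP[/ltW-> /ltW] := cr_itv y.
have cos_cr y : cos (asin (cr y)) = dt y.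
  by rewrite cos_asin // -(crdt y) [_ + dt y ^+ 2]addrC addrK sqrtr_sqr gtr0_norm.
have sin_cr y : sin (asin (cr y)) = cr y by rewrite asinK // in_itv /= cr_itvW.
have min_continuous (c : R) (y : N * R) :
    {for y, continuous (fun y : N * R => (y.1, Num.min y.2 c))}.
  apply: continuous_pair; first exact: fst_continuous.
  exact: (@continuous_min R _ (fun y : N * R => y.2 : R^o) (fun=> c : R^o) y
    (@snd_continuous _ _ y) (@cst_continuous _ _ _ y)).
have cr_continuous y : {for y, continuous cr}.
  apply: continuousB; apply: continuousM.
  - exact: (continuous_comp (min_continuous _ y) (@C_continuous _)).
  - exact: (continuous_comp (min_continuous _ y) (@S_continuous _)).
  - exact: (continuous_comp (min_continuous _ y) (@S_continuous _)).
  - exact: (continuous_comp (min_continuous _ y) (@C_continuous _)).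
exists (fun y => a y + asin (cr y)); split.
- move=> y; apply: continuousD; first exact: ac.
  exact: (continuous_comp (cr_continuous y) (continuous_asin (cr_itv y))).
- move=> x t; rewrite cosD cos_cr sin_cr aC aS /cr /dt /lo /hi /=.
  by rewrite -[RHS]mulr1 -[X in _ = _ * X](CS1 (x, Num.min t (k%:R * d))); ring.
- move=> x t; rewrite sinD cos_cr sin_cr aC aS /cr /dt /lo /hi /=.
  by rewrite -[RHS]mulr1 -[X in _ = _ * X](CS1 (x, Num.min t (k%:R * d))); ring.
- move=> x /=; rewrite (_ : cr (x, 0) = 0); last first.
    have min0 (j : nat) : Num.min 0 (j%:R * d) = 0 by rewrite min_l // mulr_ge0 // ltW.
    by rewrite /cr /lo /hi /= !min0 mulrC subrr.
  rewrite -[X in asin X](@sin0 R) sinK ?addr0 //.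
  by rewrite in_itv /= oppr_le0 andbb divr_ge0 // pi_ge0.
Qed.

(** The homotopy lifting property for maps to the circle; the lift is explicit on
    the end of height 0, where S > 0, and extended layer by layer. *)
Lemma exists_angle_lift : exists a : N * R -> R, [/\ continuous a,
  forall y, y.2 <= 1 -> cos (a y) = C y, forall y, y.2 <= 1 -> sin (a y) = S y &
  forall x, 0 < a (x, 0) < pi].
Proof.
have [d d0 dP] := uniform_dot_gt0.
pose k := Num.bound (1 / d).
have kd : 1 <= k%:R * d.
  by rewrite -ler_pdivrMr //; apply/ltW/archi_boundP; rewrite divr_ge0 // ltW.
have [a [ac aC aS a0]] := exists_partial_lift dP d0 k.
exists a; split=> // -[x t] /= t1; first by rewrite aC min_l ?(le_trans t1).
by rewrite aS min_l ?(le_trans t1).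
Qed.
End AngleLift.

(** * Connectedness of a zero set that separates a cylinder *)

Section ZeroSet.
Variables (R : realType) (M N : topologicalType).
Variables (f : M -> N * R) (h : N * R -> M).
Hypothesis fh : homeo_between [set: M] [set y : N * R | 0 <= y.2 <= 1] f h.
Hypothesis M_compact : compact [set: M].
Hypothesis M_hausdorff : hausdorff_space M.
Variable V : M -> R.
Hypothesis V_continuous : continuous V.
Hypothesis pos_connected : connected [set p | 0 < V p].
Hypothesis neg_connected : connected [set p | V p < 0].
Hypothesis pos_closure : forall p, V p = 0 -> closure [set q | 0 < V q] p.
Hypothesis neg_closure : forall p, V p = 0 -> closure [set q | V q < 0] p.
Hypothesis V_start : forall x, 0 < V (h (x, 0)).

(** The vector (X, V) never vanishes, so that its direction is a map to the circle
    to which the lifting property applies. *)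
Lemma exists_angle (X : M -> R) : continuous X ->
  (forall p, V p = 0 -> X p != 0) ->
  exists a : M -> R, [/\ continuous a,
    forall p, exists2 r, 0 < r & X p = r * cos (a p) /\ V p = r * sin (a p) &
    forall x, 0 < a (h (x, 0)) < pi].
Proof.
move=> Xc XV.
pose rho p := Num.sqrt (X p ^+ 2 + V p ^+ 2).
have sum0 p : 0 < X p ^+ 2 + V p ^+ 2.
  have [/XV X0|V0] := eqVneq (V p) 0.
    by rewrite ltr_pwDl ?sqr_ge0 // exprn_even_gt0.
  by rewrite ltr_wpDl ?sqr_ge0 // exprn_even_gt0.
have rho0 p : 0 < rho p by rewrite sqrtr_gt0.
have rho2 p : rho p ^+ 2 = X p ^+ 2 + V p ^+ 2 by rewrite sqr_sqrtr // ltW.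
have sqrc (g : M -> R) : continuous g -> continuous (fun p => g p ^+ 2).
  by move=> gc p; exact: (continuous_comp (gc p) (@exprn_continuous R 2 (g p))).
have rhoc : continuous rho.
  move=> p; apply: (@continuous_comp _ _ _ (fun p => X p ^+ 2 + V p ^+ 2) Num.sqrt).
    by apply: continuousD; exact: sqrc.
  exact: sqrt_continuous.
have quotc (g : M -> R) : continuous g ->
    continuous (fun y => g (hclamp h y) / rho (hclamp h y)).
  move=> gc y; have hc := @hclamp_continuous _ _ _ _ _ fh y.
  apply: (@continuousM _ _ (g \o hclamp h) (fun y => (rho (hclamp h y))^-1)).
    exact: (continuous_comp hc (gc _)).
  apply: (@continuousV _ _ (rho \o hclamp h)); first by rewrite /= gt_eqF.
  exact: (continuous_comp hc (rhoc _)).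
have hclampK (x : N) t : hclamp h (x, clamp t) = hclamp h (x, t).
  by rewrite /hclamp /= [clamp (clamp t)]clamp_id // clamp_itv.
have [||||a [ac aC aS a0]] :=
  exists_angle_lift fh M_compact (quotc _ Xc) (quotc _ V_continuous).
- by move=> y; rewrite !expr_div_n -mulrDl -rho2 divff // expf_neq0 // gt_eqF.
- by move=> x t; rewrite hclampK.
- by move=> x t; rewrite hclampK.
- by move=> x; rewrite divr_gt0 // /hclamp clamp_id ?V_start // lexx ler01.
have hf p : hclamp h (f p) = p.
  rewrite /hclamp clamp_id ?(cylinder_f2 fh) // -surjective_pairing.
  exact: (cylinder_hf fh).
exists (a \o f); split.
- by move=> p; exact: (continuous_comp (@cylinder_f_continuous _ _ _ _ _ fh p) (ac (f p))).
- move=> p; exists (rho p) => //; have /andP[_ f1] := cylinder_f2 fh p.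
  by rewrite /= aC // aS // hf ![_ * (_ / _)]mulrC !divfK ?gt_eqF.
- by move=> x; rewrite /= (cylinder_fh fh) // lexx ler01.
Qed.

(** The angle cannot cross 0 or pi, where the sine vanishes, on a connected set
    where the sine is positive. *)
Lemma angle_pos (a : M -> R) (x0 : N) : continuous a ->
  (forall p, (0 < V p) = (0 < sin (a p))) ->
  0 < a (h (x0, 0)) < pi ->
  forall p, 0 < V p -> 0 < a p < pi.
Proof.
move=> ac aV /andP[a0 api] p Vp.
have itv : is_interval (a @` [set p | 0 < V p]).
  apply/connected_intervalP/connected_continuous_connected => //.
  exact: continuous_subspaceT.
have pt q : 0 < V q -> (a @` [set p | 0 < V p]) (a q) by move=> Vq; exists q.
have no t : sin t <= 0 -> ~ (a @` [set p | 0 < V p]) t.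
  by move=> st [q Vq aq]; move: Vq; rewrite /= aV aq ltNge st.
apply/andP; split; rewrite ltNge; apply/negP => h1.
  apply: (no 0); first by rewrite sin0.
  by apply: (itv _ _ (pt p Vp) (pt _ (V_start x0))); rewrite h1 /= ltW.
apply: (no pi); first by rewrite sinpi.
by apply: (itv _ _ (pt _ (V_start x0)) (pt p Vp)); rewrite h1 andbT ltW.
Qed.

(** The zero set of V is connected. For a partition of it into two closed sets,
    take X negative on the first and positive on the second one, so that
    (X, V) never vanishes. On a cylinder the angle of (X, V) is a continuous
    real function; on the positive side of V it stays between 0 and pi, hence
    it is pi on the first set and 0 on the second one. But the negative side,
    which is connected and touches both sets, has no point at angle pi/2. *)
Theorem zero_set_connected : connected (V @^-1` [set 0]).
Proof.
move=> B [p1 Bp1] [C1 oC1 BC1] [C2 cC2 BC2]; apply: contrapT => BV.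
have clV : closed (V @^-1` [set 0]).
  apply: closed_comp => [p _|]; [exact: V_continuous|exact: closed_eq].
have BsV : B `<=` V @^-1` [set 0] by rewrite BC1 => p [].
have [p2 Vp2 nBp2] : exists2 p2, V p2 = 0 & ~ B p2.
  apply: contrapT => no; apply: BV; apply/seteqP; split => // p Vp.
  by apply: contrapT => nBp; apply: no; exists p.
pose B' := V @^-1` [set 0] `\` B.
have clB : closed B by rewrite BC2; exact: closedI.
have clB' : closed B'.
  rewrite (_ : B' = V @^-1` [set 0] `&` ~` C1).
    by apply: closedI => //; exact: open_closedC.
  apply/seteqP; split => p [Vp nBp]; split=> //.
    by move=> C1p; apply: nBp; rewrite BC1.
  by rewrite BC1 => -[].
have [X [Xc X1 X2 _]] : exists X : M -> R, [/\ continuous X,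
    X @` B `<=` [set -1], X @` B' `<=` [set 1] & range X `<=` `[-1, 1]].
  have lt11 : -1 < 1 :> R by exact: lt_trans (ltrN10 R) ltr01.
  apply: (urysohn_ext_itv (compact_normal M_hausdorff M_compact) clB clB') lt11.
  by apply/seteqP; split => // p [Bp [_]].
have XB p : B p -> X p = -1 by move=> Bp; apply: X1; exists p.
have XB' p : V p = 0 -> ~ B p -> X p = 1 by move=> Vp Bp; apply: X2; exists p.
have [a [ac aP a0]] : exists a : M -> R, [/\ continuous a,
    forall p, exists2 r, 0 < r & X p = r * cos (a p) /\ V p = r * sin (a p) &
    forall x, 0 < a (h (x, 0)) < pi].
  apply: exists_angle => // p Vp; have [/XB ->|/(XB' p Vp) ->] := pselect (B p).
    by rewrite oppr_eq0 oner_eq0.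
  by rewrite oner_eq0.
have aV p : (0 < V p) = (0 < sin (a p)).
  by have [r r0 [_ ->]] := aP p; rewrite pmulr_rgt0.
have aVn p : (V p < 0) = (sin (a p) < 0).
  by have [r r0 [_ ->]] := aP p; rewrite pmulr_rlt0.
have pos := angle_pos ac aV (a0 (f p1).1).
have zero p : V p = 0 -> 0 <= a p <= pi /\ sin (a p) = 0.
  move=> Vp; split; last first.
    have [r r0 [_ /eqP]] := aP p; rewrite Vp eq_sym mulf_eq0 gt_eqF //=.
    by move/eqP.
  have cl : closed (a @^-1` `[0, pi]%classic).
    apply: closed_comp => [q _|]; [exact: ac|exact: interval_closed].
  have sub : [set q | 0 < V q] `<=` a @^-1` `[0, pi]%classic.
    by move=> q /pos /andP[? ?]; rewrite /= in_itv /= !ltW.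
  have := closureS sub (pos_closure Vp); rewrite -((closure_id _).1 cl).
  by rewrite /= in_itv.
have a1 : a p1 = pi.
  have Vp1 : V p1 = 0 by exact: BsV.
  have [/andP[a1 api] s1] := zero p1 Vp1.
  have c1 : cos (a p1) < 0.
    have [r r0 [+ _]] := aP p1; rewrite XB // => E.
    by rewrite -(pmulr_rlt0 _ r0) -E ltrN10.
  apply/eqP; rewrite eq_le api leNgt; apply/negP => lt_pi.
  have [a10|a10] := eqVneq (a p1) 0.
    by move: c1; rewrite a10 cos0 ltNge ler01.
  have : 0 < sin (a p1) by apply: sin_gt0_pi; rewrite lt_pi lt_def a10 a1.
  by rewrite s1 ltxx.
have a2 : a p2 = 0.
  have [/andP[a2 api] s2] := zero p2 Vp2.
  have c2 : 0 < cos (a p2).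
    have [r r0 [+ _]] := aP p2; rewrite XB' // => E.
    by rewrite -(pmulr_rgt0 _ r0) -E ltr01.
  apply/eqP; rewrite eq_le a2 andbT leNgt; apply/negP => gt0.
  have [a2pi|a2pi] := eqVneq (a p2) pi.
    by move: c2; rewrite a2pi cospi ltNge lerN10.
  have : 0 < sin (a p2) by apply: sin_gt0_pi; rewrite gt0 lt_neqAle a2pi api.
  by rewrite s2 ltxx.
have pi20 : 0 < pi / 2 :> R by rewrite divr_gt0 // pi_gt0.
have pi2pi : pi / 2 < pi :> R by rewrite ltr_pdivrMr // ltr_pMr ?pi_gt0 // ltr1n.
have near_open (A : set R) p : open A -> V p = 0 -> A (a p) ->
    exists2 q, V q < 0 & A (a q).
  rewrite openE => oA Vp /oA /ac nA.
  by have [q [Vq Aq]] := neg_closure Vp nA; exists q.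
have [q1 Vq1 aq1] : exists2 q, V q < 0 & pi / 2 < a q.
  by apply: (near_open [set x | pi / 2 < x] p1 _ (BsV _ Bp1)); [exact: open_gt|rewrite /= a1].
have [q2 Vq2 aq2] : exists2 q, V q < 0 & a q < pi / 2.
  by apply: (near_open [set x | x < pi / 2] p2 _ Vp2); [exact: open_lt|rewrite /= a2].
have itv : is_interval (a @` [set p | V p < 0]).
  apply/connected_intervalP/connected_continuous_connected => //.
  exact: continuous_subspaceT.
have : (a @` [set p | V p < 0]) (pi / 2).
  apply: (itv (a q2) (a q1)); [by exists q2|by exists q1|].
  by rewrite !ltW.
by move=> [q /= + aq]; rewrite aVn aq sin_pihalf ltNge ler01.
Qed.
End ZeroSet.

(** * Calculus of smooth functions *)

Section SmoothCalculus.
Variables (R : realType) (n : nat).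
Local Notation E := 'rV[R]_n.
Implicit Types (f g : E -> R) (U : set E) (k : nat).

Lemma Ck_continuous k U f x : Ck k U f -> U x -> {for x, continuous f}.
Proof. by case: k => [|k] [fc _]; exact: fc. Qed.

Lemma Ck_pred k U f : Ck k.+1 U f -> Ck k U f.
Proof.
elim: k f => [|k IH] f; first by move=> [fc _]; split.
by move=> [fc fd]; split=> // i; have [fi fki] := fd i; split=> //; exact: IH.
Qed.

Lemma Ck_sub k U U' f : U' `<=` U -> Ck k U f -> Ck k U' f.
Proof.
move=> U'U; elim: k f => [|k IH] f [fc fd]; split=> //.
- by move=> x /U'U; exact: fc.
- by move=> x /U'U; exact: fc.
- move=> i; have [fi fki] := fd i; split; last exact: IH.
  by move=> x /U'U; exact: fi.
Qed.

(** Continuity and derivatives only depend on germs. *)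
Lemma Ck_local k U f :
  (forall x, U x -> exists (U' : set E) g,
     [/\ open U', U' x, Ck k U' g & forall y, U' y -> g y = f y]) -> Ck k U f.
Proof.
elim: k f => [|k IH] f loc; split=> //.
- move=> x /loc [U' [g [oU' U'x gk gf]]].
  apply: (@continuous_near_eq _ _ g); last exact: Ck_continuous gk U'x.
  by apply: filterS (open_nbhs_nbhs (conj oU' U'x)) => y; exact: gf.
- move=> x /loc [U' [g [oU' U'x gk gf]]].
  apply: (@continuous_near_eq _ _ g); last exact: Ck_continuous gk U'x.
  by apply: filterS (open_nbhs_nbhs (conj oU' U'x)) => y; exact: gf.
- move=> i.
  have near_gf U' g x : open U' -> U' x -> (forall y, U' y -> g y = f y) ->
      \forall y \near x, g y = f y.
    by move=> oU' U'x gf; apply: filterS (open_nbhs_nbhs (conj oU' U'x)) => y; exact: gf.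
  split.
    move=> x /loc [U' [g [oU' U'x [_ gk] gf]]].
    by apply: (near_eq_derivable (near_gf _ _ _ oU' U'x gf)); exact: (gk i).1.
  apply: IH => x /loc [U' [g [oU' U'x [_ gk] gf]]].
  exists U', ('D_('e_i) g); split=> //; first exact: (gk i).2.
  by move=> y U'y; exact: near_eq_derive (near_gf _ _ _ oU' U'y gf).
Qed.

Lemma Ck_ext k U f g : open U -> (forall x, U x -> f x = g x) -> Ck k U f -> Ck k U g.
Proof. by move=> oU fg fk; apply: Ck_local => x Ux; exists U, f. Qed.

Lemma Ck_cst k U (c : R) : Ck k U (fun=> c).
Proof.
elim: k c => [|k IH] c; split=> //; try by move=> x _; exact: cst_continuous.
move=> i; split; first by move=> x _; exact: derivable_cst.
have -> : (fun x : E => 'D_('e_i) (fun=> c) x) = (fun=> 0).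
  by apply/funext => x; exact: derive_cst.
exact: IH.
Qed.

Lemma CkD k U f g : open U -> Ck k U f -> Ck k U g -> Ck k U (fun x => f x + g x).
Proof.
move=> oU; elim: k f g => [|k IH] f g [fc fd] [gc gd].
  by split=> // x Ux; apply: continuousD; [exact: fc|exact: gc].
split; first by move=> x Ux; apply: continuousD; [exact: fc|exact: gc].
move=> i; have [fi fki] := fd i; have [gi gki] := gd i; split.
  by move=> x Ux; apply: derivableD; [exact: fi|exact: gi].
apply: (@Ck_ext k U (fun x => 'D_('e_i) f x + 'D_('e_i) g x)) => //; last exact: IH.
by move=> x Ux; rewrite -deriveD //; [exact: fi|exact: gi].
Qed.

Lemma CkM k U f g : open U -> Ck k U f -> Ck k U g -> Ck k U (fun x => f x * g x).
Proof.
move=> oU; elim: k f g => [|k IH] f g fk gk.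
  by split=> // x Ux; exact: (continuousM (Ck_continuous fk Ux) (Ck_continuous gk Ux)).
have [fk' gk'] := (Ck_pred fk, Ck_pred gk).
split; first by move=> x Ux; exact: (continuousM (Ck_continuous fk Ux) (Ck_continuous gk Ux)).
move=> i; have [fi fki] := fk.2 i; have [gi gki] := gk.2 i; split.
  by move=> x Ux; apply: derivableM; [exact: fi|exact: gi].
apply: (@Ck_ext k U (fun x => f x * 'D_('e_i) g x + g x * 'D_('e_i) f x)) => //.
  by move=> x Ux; rewrite [RHS]deriveM //; [exact: fi|exact: gi].
by apply: CkD => //; exact: IH.
Qed.

Lemma CkV k U f : open U -> (forall x, U x -> f x != 0) -> Ck k U f ->
  Ck k U (fun x => (f x)^-1).
Proof.
move=> oU f0; elim: k f f0 => [|k IH] f f0 fk.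
  by split=> // x Ux; apply: continuousV; [exact: f0|exact: (Ck_continuous fk Ux)].
split; first by move=> x Ux; apply: continuousV; [exact: f0|exact: (Ck_continuous fk Ux)].
move=> i; have [fi fki] := fk.2 i; split.
  by move=> x Ux; apply: derivableV; [exact: f0|exact: fi].
apply: (@Ck_ext k U (fun x => -1 * (f x)^-1 * (f x)^-1 * 'D_('e_i) f x)) => //.
  move=> x Ux; rewrite [RHS]deriveV //; [|exact: f0|exact: fi].
  by rewrite mulN1r !mulNr scaleNr expr2 invfM.
apply: CkM => //; have IHf := IH f f0 (Ck_pred fk).
by apply: CkM => //; apply: CkM => //; exact: Ck_cst.
Qed.

Lemma Ck_sum k U (I : Type) (r : seq I) (P : pred I) (F : I -> E -> R) :
  open U -> (forall i, Ck k U (F i)) -> Ck k U (fun x => \sum_(i <- r | P i) F i x).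
Proof.
move=> oU Fk; elim: r => [|i r IH].
  by apply: (@Ck_ext k U (fun=> 0)) => [||] //; [move=> x _; rewrite big_nil|exact: Ck_cst].
case Pi : (P i).
  apply: (@Ck_ext k U (fun x => F i x + \sum_(i <- r | P i) F i x)) => //.
    by move=> x _; rewrite big_cons Pi.
  exact: CkD.
by apply: Ck_ext IH => // x _; rewrite big_cons Pi.
Qed.

Lemma Ck_prod k U (I : Type) (r : seq I) (F : I -> E -> R) :
  open U -> (forall i, Ck k U (F i)) -> Ck k U (fun x => \prod_(i <- r) F i x).
Proof.
move=> oU Fk; elim: r => [|i r IH].
  by apply: (@Ck_ext k U (fun=> 1)) => [||] //; [move=> x _; rewrite big_nil|exact: Ck_cst].
apply: (@Ck_ext k U (fun x => F i x * \prod_(i <- r) F i x)) => //.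
  by move=> x _; rewrite big_cons.
exact: CkM.
Qed.

Lemma Ck_det k U m (A : E -> 'M[R]_m) : open U ->
  (forall i j, Ck k U (fun x => A x i j)) -> Ck k U (fun x => \det (A x)).
Proof.
move=> oU Ak; rewrite /determinant; apply: Ck_sum => // s.
by apply: CkM => //; [exact: Ck_cst|exact: Ck_prod].
Qed.

Lemma Ck_invmx k U m (A : E -> 'M[R]_m) : open U ->
  (forall x, U x -> A x \in unitmx) ->
  (forall i j, Ck k U (fun x => A x i j)) ->
  forall i j, Ck k U (fun x => invmx (A x) i j).
Proof.
move=> oU uA Ak i j.
apply: (@Ck_ext k U (fun x => (\det (A x))^-1 *
    ((-1) ^+ (j + i) * \det (row' j (col' i (A x)))))) => //.
  by move=> x Ux; rewrite /invmx uA // !mxE.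
apply: CkM => //.
  apply: CkV => //; last exact: Ck_det.
  by move=> x /uA; rewrite unitmxE unitfE.
apply: CkM => //; first exact: Ck_cst.
apply: Ck_det => // a b.
by apply: Ck_ext (Ak (lift j a) (lift i b)) => // x _; rewrite !mxE.
Qed.

Definition smooth_in U f := forall k, Ck k U f.

Lemma smooth_in_derive U f i : smooth_in U f -> smooth_in U (fun x => 'D_('e_i) f x).
Proof. by move=> fs k; exact: ((fs k.+1).2 i).2. Qed.

Lemma smooth_in_derivable U f i x : smooth_in U f -> U x -> derivable f x 'e_i.
Proof. by move=> fs; exact: ((fs 1%N).2 i).1. Qed.

Lemma smooth_in_continuous U f x : smooth_in U f -> U x -> {for x, continuous f}.
Proof. by move=> fs; exact: (fs 0%N).1. Qed.

End SmoothCalculus.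

Section DirectionalDerivative.
Variables (R : realType) (E : normedModType R).
Implicit Types (f : E -> R) (x v u : E) (t d : R).

Lemma growth_rate_line f x v t :
  (fun h => h^-1 *: (((fun s => f (s *: v + x)) \o shift t) (h *: 1) -
                     f (t *: v + x))) =
  (fun h => h^-1 *: ((f \o shift (t *: v + x)) (h *: v) - f (t *: v + x))).
Proof.
by apply/funext => h; rewrite /= [h%:A]mulr1 scalerDl addrA.
Qed.

Lemma is_derive_line f x v t d :
  is_derive (t *: v + x) v f d -> is_derive t 1 (fun s => f (s *: v + x)) d.
Proof.
move=> [fd <-]; apply: DeriveDef.
  by rewrite /derivable growth_rate_line.
by rewrite /derive growth_rate_line.
Qed.

Lemma line_is_derive f x v d :
  is_derive (0 : R) 1 (fun s => f (s *: v + x)) d -> is_derive x v f d.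
Proof.
have E0 : 0 *: v + x = x by rewrite scale0r add0r.
move=> [fd <-]; apply: DeriveDef.
  by move: fd; rewrite /derivable growth_rate_line E0.
by rewrite /derive growth_rate_line E0.
Qed.

Lemma is_deriveZdir f x v (c : R) d :
  is_derive x v f d -> is_derive x (c *: v) f (c * d).
Proof.
move=> fd; apply: line_is_derive.
have -> : (fun s => f (s *: (c *: v) + x)) =
          (fun s => f (s *: v + x)) \o ( *%R c).
  by apply/funext => s; rewrite /= scalerA mulrC.
rewrite mulrC; apply: is_derive1_comp.
  by rewrite mulr0; apply: is_derive_line; rewrite scale0r add0r.
have := is_deriveZ c (is_derive_id (0 : R) 1).
by rewrite [c *: 1]mulr1.
Qed.

Lemma line_MVT f x v (df : E -> R) :
  (forall t, 0 <= t <= 1 -> is_derive (t *: v + x) v f (df (t *: v + x))) ->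
  exists2 t, 0 <= t <= 1 & f (v + x) - f x = df (t *: v + x).
Proof.
move=> fd; pose phi (s : R) := f (s *: v + x).
have phid (t : R) : 0 <= t <= 1 -> is_derive t 1 phi (df (t *: v + x)).
  by move=> /fd; exact: is_derive_line.
have [||t] := @MVT_segment R phi (fun t => df (t *: v + x)) 0 1 ler01.
- by move=> t; rewrite in_itv /= => /andP[t0 t1]; apply: phid; rewrite !ltW.
- apply: continuous_in_subspaceT => t; rewrite inE /= in_itv /= => /phid [pd _].
  exact/differentiable_continuous/derivable1_diffP.
rewrite in_itv /= => t01; rewrite subr0 mulr1 /phi scale1r scale0r add0r => ->.
by exists t.
Qed.

(** Directional derivatives add up when one of them is continuous: by the mean
    value theorem the increment along the second direction is its derivative
    at a nearby point. *)
Lemma is_deriveDdir f (U : set E) v u (dv du : E -> R) : open U ->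
  (forall x, U x -> is_derive x v f (dv x)) ->
  (forall x, U x -> is_derive x u f (du x)) ->
  (forall x, U x -> {for x, continuous du}) ->
  forall x, U x -> is_derive x (v + u) f (dv x + du x).
Proof.
move=> oU fv fu duc x Ux.
suff lim_vu : h^-1 *: (f (h *: (v + u) + x) - f x) @[h --> 0^'] --> dv x + du x.
  apply: DeriveDef; last exact: cvg_lim.
  by apply/cvg_ex; exists (dv x + du x).
pose q h : R := h^-1 *: (f (h *: v + x) - f x).
have qv : q h @[h --> 0^'] --> dv x.
  by have [fd <-] := fv x Ux; exact: fd.
apply/cvgrPdist_lt => e e0.
have e2 : 0 < e / 2 by rewrite divr_gt0.
have nq : \forall h \near 0^', `|dv x - q h| < e / 2 by move/cvgrPdist_lt : qv; apply.
have : \forall y \near x, U y /\ `|du x - du y| < e / 2.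
  apply: filterI; first by move: oU; rewrite openE; exact.
  by have /cvgrPdist_lt := duc x Ux; apply.
move=> /nbhs_ballP [r /= r0 rP].
pose K := `|v| + `|u| + 1.
have K0 : 0 < K by rewrite /K ltr_wpDl // addr_ge0.
have nr : \forall h \near (0 : R)^', `|h| < r / K by apply: dnbhs0_lt; rewrite divr_gt0.
have nz : \forall h \near (0 : R)^', h != 0 by exact: nbhs_dnbhs_neq.
near=> h.
have h0 : h != 0 by near: h.
have hr : `|h| < r / K by near: h.
have near_x t : 0 <= t <= 1 -> ball x r (t *: (h *: u) + (h *: v + x)).
  move=> /andP[t0 t1]; rewrite -ball_normE /= addrA opprD addrCA subrr addr0 normrN.
  apply: (@le_lt_trans _ _ (`|h| * K)); last by rewrite -ltr_pdivlMr.
  rewrite scalerA mulrC -scalerA -scalerDr normrZ ler_wpM2l //.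
  rewrite (le_trans (ler_normD _ _)) // normrZ ger0_norm // /K.
  have : t * `|u| <= `|u| by rewrite ler_piMl.
  by have := normr_ge0 u; lra.
have [t t01 ft] : exists2 t, 0 <= t <= 1 &
    f (h *: u + (h *: v + x)) - f (h *: v + x) = h * du (t *: (h *: u) + (h *: v + x)).
  apply: (@line_MVT f (h *: v + x) (h *: u) (fun y => h * du y)) => t t01.
  by apply: is_deriveZdir; apply: fu; exact: (rP _ (near_x t t01)).1.
have -> : h^-1 *: (f (h *: (v + u) + x) - f x) =
    q h + du (t *: (h *: u) + (h *: v + x)).
  have -> : h *: (v + u) + x = h *: u + (h *: v + x) by rewrite scalerDr addrAC addrC.
  rewrite -(subrK (f (h *: v + x)) (f (h *: u + _))) ft /q.
  move: (du _) (f (h *: v + x)) (f x) => D A B.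
  rewrite -[LHS]/(h^-1 * _) -[X in _ = X + _]/(h^-1 * _) -addrA mulrDr mulKf //.
  by rewrite [LHS]addrC.
rewrite opprD addrACA (le_lt_trans (ler_normD _ _)) // [e]splitr ltrD //.
  by near: h.
exact: (rP _ (near_x t t01)).2.
Unshelve. all: by end_near. Qed.

End DirectionalDerivative.

Lemma row_sum_e (R : realType) n (w : 'rV[R]_n) : w = \sum_i w ord0 i *: 'e_i.
Proof. exact: row_sum_delta. Qed.

(** The chain rule for smooth functions along a line, by adding up the
    coordinates of the direction one at a time. *)
Lemma smooth_in_is_derive (R : realType) n (U : set 'rV[R]_n) f w x :
  open U -> smooth_in U f -> U x ->
  is_derive x w f (\sum_i w ord0 i * 'D_('e_i) f x).
Proof.
move=> oU fs; rewrite [X in is_derive _ X](row_sum_e w).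
elim: (index_enum _) x => [|i s IH] x Ux.
  by rewrite !big_nil; exact: is_derive0.
rewrite !big_cons addrC [X in is_derive _ _ _ X]addrC.
apply: (@is_deriveDdir _ _ f U _ _ (fun x => \sum_(i <- s) w ord0 i * 'D_('e_i) f x)
   (fun x => w ord0 i * 'D_('e_i) f x)) => //.
  move=> y Uy; apply: is_deriveZdir; apply/derivableP.
  exact: smooth_in_derivable fs Uy.
move=> y Uy; apply: continuousM; first exact: cst_continuous.
exact: smooth_in_continuous (smooth_in_derive i fs) Uy.
Qed.

(** * Unique continuation *)

Lemma continuous_sum (R : realType) (T : topologicalType) (I : Type) (r : seq I)
    (P : pred I) (F : I -> T -> R) x :
  (forall i, {for x, continuous (F i)}) ->
  {for x, continuous (fun y => \sum_(i <- r | P i) F i y)}.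
Proof.
move=> Fc; elim: r => [|i r IH].
  have -> : (fun y => \sum_(i <- [::] | P i) F i y) = (fun=> 0).
    by apply/funext => y; rewrite big_nil.
  exact: cst_continuous.
have -> : (fun y => \sum_(i <- i :: r | P i) F i y) =
    (fun y => (if P i then F i y else 0) + \sum_(i <- r | P i) F i y).
  by apply/funext => y; rewrite big_cons; case: (P i); rewrite ?add0r.
apply: continuousD => //; case: (P i); [exact: Fc|exact: cst_continuous].
Qed.

Section Gronwall.
Variables (R : realType) (m : nat) (y : 'I_m -> R -> R) (A : 'I_m -> 'I_m -> R -> R).
Hypothesis A_continuous : forall i j (t : R), 0 <= t <= 1 -> {for t, continuous (A i j)}.
Hypothesis y_derive : forall i (t : R), 0 <= t <= 1 ->
  is_derive t 1 (y i) (\sum_j A i j t * y j t).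
Hypothesis y0 : forall i, y i 0 = 0.

(** Gronwall's argument for a linear system: the energy grows at most
    exponentially. *)
Lemma linear_system_unique i : y i 1 = 0.
Proof.
pose B (t : R) : R := \sum_i \sum_j `|A i j t|.
have Bc : {within `[(0 : R), 1], continuous B}.
  apply: continuous_in_subspaceT => t; rewrite inE /= in_itv /= => t01.
  apply: continuous_sum => j; apply: continuous_sum => k.
  by apply: continuous_comp; [exact: A_continuous|exact: norm_continuous].
have [c _ cmax] := EVT_max ler01 Bc; set K := B c in cmax.
have AK j k (t : R) : 0 <= t <= 1 -> `|A j k t| <= K.
  move=> t01; apply: le_trans (cmax t _); last by rewrite in_itv.
  rewrite /B (bigD1 j) //= (bigD1 k) //= -addrA lerDl addr_ge0 //.
    by apply: sumr_ge0.
  by apply: sumr_ge0 => ? _; apply: sumr_ge0.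
pose C : R := 2 * K * m%:R.
pose en (t : R) : R := \sum_i y i t ^+ 2.
pose den (t : R) : R := \sum_i (2 * y i t * \sum_j A i j t * y j t).
have en_derive (t : R) : 0 <= t <= 1 -> is_derive t 1 en (den t).
  move=> t01; have -> : en = \sum_i (fun t => y i t ^+ 2).
    by apply/funext => s; rewrite fct_sumE.
  apply: is_derive_sum => k; have yd := y_derive k t01.
  apply: is_derive_eq.
  by rewrite /GRing.scale /=; ring.
have denC (t : R) : 0 <= t <= 1 -> den t <= C * en t.
  move=> t01; rewrite /den.
  apply: (@le_trans _ _ (\sum_i \sum_j K * (y i t ^+ 2 + y j t ^+ 2))).
    apply: ler_sum => j _; rewrite mulr_sumr; apply: ler_sum => k _.
    rewrite mulrCA; apply: le_trans (ler_norm _) _.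
    rewrite normrM ler_pM //; first exact: AK.
    rewrite ler_norml; apply/andP; split.
      have := sqr_ge0 (y j t + y k t); lra.
    have := sqr_ge0 (y j t - y k t); lra.
  have -> : \sum_(i < m) \sum_(j < m) K * (y i t ^+ 2 + y j t ^+ 2) =
      \sum_(i < m) ((K * y i t ^+ 2) *+ m + K * en t).
    apply: eq_bigr => j _; rewrite -mulr_sumr big_split /= sumr_const card_ord.
    by rewrite mulrDr mulrnAr.
  rewrite big_split /= sumr_const card_ord sumrMnl -mulr_sumr -/(en t) /C.
  by rewrite -[_ *+ m]mulr_natl; lra.
pose W (t : R) : R := en t * expR (- C * t).
have W_derive (t : R) : 0 <= t <= 1 ->
    is_derive t 1 W ((den t - C * en t) * expR (- C * t)).
  move=> t01; have end_ := en_derive t t01.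
  have expd : is_derive t 1 (fun t => expR (- C * t)) (expR (- C * t) * - C).
    apply: (@is_derive1_comp _ expR ( *%R (- C))).
    by have := is_deriveZ (- C) (is_derive_id t 1); rewrite [_ *: 1]mulr1.
  apply: (@is_derive_eq _ _ _ W t 1 _ _ (is_deriveM end_ expd)).
  by rewrite /GRing.scale /=; ring.
have [||t] := @MVT_segment R W (fun t => (den t - C * en t) * expR (- C * t)) 0 1 ler01.
- by move=> t; rewrite in_itv /= => /andP[t0 t1]; apply: W_derive; rewrite !ltW.
- apply: continuous_in_subspaceT => t; rewrite inE /= in_itv /= => /W_derive [pd _].
  exact/differentiable_continuous/derivable1_diffP.
rewrite in_itv /= => t01.
have -> : W 0 = 0 by rewrite /W /en big1 ?mul0r // => j _; rewrite y0 expr0n.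
rewrite !subr0 mulr1 => W1.
have : W 1 <= 0.
  by rewrite W1 mulr_le0_ge0 ?expR_ge0 // subr_le0 denC.
rewrite /W pmulr_lle0 ?expR_gt0 // => en1.
have : y i 1 ^+ 2 <= 0.
  apply: le_trans en1; rewrite /en (bigD1 i) //= lerDl; apply: sumr_ge0 => j _.
  exact: sqr_ge0.
by rewrite real_exprn_even_le0 ?num_real // => /eqP.
Qed.
End Gronwall.

Section UniqueContinuation.
Variables (R : realType) (n : nat).
Local Notation E := 'rV[R]_n.
Variables (U : set E) (v : E -> R).
Variables (Gam : 'I_n -> 'I_n -> 'I_n -> E -> R) (T : 'I_n -> 'I_n -> E -> R).
Hypothesis U_open : open U.
Hypothesis v_smooth : smooth_in U v.
Hypothesis Gam_continuous : forall k i j x, U x -> {for x, continuous (Gam k i j)}.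
Hypothesis T_continuous : forall i j x, U x -> {for x, continuous (T i j)}.
Hypothesis v_eq : forall i j x, U x ->
  'D_('e_i) (fun y => 'D_('e_j) v y) x =
  \sum_k Gam k i j x * 'D_('e_k) v x + v x * T i j x.

Let line (x w : E) (t : R) := t *: w + x.

Let line_continuous x w t : {for t, continuous (line x w)}.
Proof.
apply: continuousD; last exact: cst_continuous.
exact: (@continuousZr_tmp _ _ _ (fun t : R => t) w t (@cvg_id _ _)).
Qed.

(** On a segment, v and its first derivatives solve a linear system of
    ordinary differential equations. *)
Lemma zero_along_segment x w : (forall t, 0 <= t <= 1 -> U (line x w t)) ->
  v x = 0 -> (forall i, 'D_('e_i) v x = 0) -> v (w + x) = 0.
Proof.
move=> segU vx dvx.
(* Index 0 stands for v, the other indices for its partial derivatives. *)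
pose y (a : 'I_n.+1) (t : R) : R :=
  if unlift ord0 a is Some j then 'D_('e_j) v (line x w t) else v (line x w t).
pose A (a b : 'I_n.+1) (t : R) : R :=
  match unlift ord0 a, unlift ord0 b with
  | None, None => 0
  | None, Some k => w ord0 k
  | Some j, None => \sum_i w ord0 i * T i j (line x w t)
  | Some j, Some k => \sum_i w ord0 i * Gam k i j (line x w t)
  end.
have line0 : line x w 0 = x by rewrite /line scale0r add0r.
have := @linear_system_unique R n.+1 y A _ _ _ ord0.
rewrite /y unlift_none /line scale1r; apply.
- move=> a b t t01; rewrite /A; case: (unlift _ a) => [j|]; case: (unlift _ b) => [k|].
  + apply: continuous_sum => i; apply: continuousM; first exact: cst_continuous.
    exact: (continuous_comp (@line_continuous x w t) (Gam_continuous (segU t t01))).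
  + apply: continuous_sum => i; apply: continuousM; first exact: cst_continuous.
    exact: (continuous_comp (@line_continuous x w t) (T_continuous (segU t t01))).
  + exact: cst_continuous.
  + exact: cst_continuous.
- move=> a t t01; have Ut := segU t t01.
  rewrite big_ord_recl /A /y unlift_none.
  under eq_bigr => k _ do rewrite liftK.
  case: (unliftP ord0 a) => [j _|_].
    have dz := is_derive_line
      (smooth_in_is_derive w U_open (smooth_in_derive j v_smooth) Ut).
    apply: (is_derive_eq dz).
    under [LHS]eq_bigr => i _ do rewrite v_eq // mulrDr mulr_sumr.
    rewrite big_split /= exchange_big /= addrC; congr (_ + _).
      rewrite mulr_suml; apply: eq_bigr => i _; ring.
    apply: eq_bigr => k _; rewrite mulr_suml; apply: eq_bigr => i _; ring.
  have dv := is_derive_line (smooth_in_is_derive w U_open v_smooth Ut).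
  by apply: (is_derive_eq dv); rewrite mul0r add0r.
- move=> a; rewrite scale0r add0r; case: (unlift ord0 a) => [j|]; [exact: dvx|exact: vx].
Qed.

Lemma zero_near x : U x -> v x = 0 -> (forall i, 'D_('e_i) v x = 0) ->
  \forall y \near x, v y = 0.
Proof.
move=> Ux vx dvx; have /nbhs_ballP [r /= r0 rU] : nbhs x U.
  by move: U_open; rewrite openE; exact.
apply/nbhs_ballP; exists r => //= y; rewrite -ball_normE /= distrC => yx.
rewrite -(subrK x y); apply: zero_along_segment => // t /andP[t0 t1].
apply: rU; rewrite -ball_normE /= distrC /line addrK normrZ ger0_norm //.
by apply: le_lt_trans yx; rewrite ler_piMl.
Qed.

End UniqueContinuation.

(** * The strong maximum principle *)

Section QuadraticForms.
Variable R : realFieldType.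

Definition qform n (A : 'I_n -> 'I_n -> R) (w : 'I_n -> R) : R :=
  \sum_i \sum_j w i * w j * A i j.

Definition pos_def n (A : 'I_n -> 'I_n -> R) :=
  forall w, (exists i, w i != 0) -> 0 < qform A w.

Lemma qform_recl n (A : 'I_n.+1 -> 'I_n.+1 -> R) w :
  qform A w = w ord0 ^+ 2 * A ord0 ord0 +
    w ord0 * (\sum_j w (lift ord0 j) * A ord0 (lift ord0 j)) +
    w ord0 * (\sum_j w (lift ord0 j) * A (lift ord0 j) ord0) +
    qform (fun i j => A (lift ord0 i) (lift ord0 j)) (fun i => w (lift ord0 i)).
Proof.
rewrite /qform big_ord_recl big_ord_recl -expr2 -!addrA; congr (_ + _).
have -> : \sum_(i < n) w ord0 * w (lift ord0 i) * A ord0 (lift ord0 i) =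
    w ord0 * \sum_j w (lift ord0 j) * A ord0 (lift ord0 j).
  by rewrite mulr_sumr; apply: eq_bigr => i _; rewrite mulrA.
congr (_ + _).
under eq_bigr => i _ do rewrite big_ord_recl.
rewrite big_split /=; congr (_ + _); rewrite mulr_sumr; apply: eq_bigr => i _.
by rewrite [w (lift _ _) * _]mulrC mulrA.
Qed.

(** The trace of the product of a positive definite symmetric form and of a
    negative semi-definite one, by splitting off a square from the first one
    and induction on its Schur complement. *)
Lemma trace_mul_le0 n (A B : 'I_n -> 'I_n -> R) :
  (forall i j, A i j = A j i) -> pos_def A -> (forall w, qform B w <= 0) ->
  \sum_i \sum_j A i j * B i j <= 0.
Proof.
elim: n A B => [|n IH] A B Asym Apos Bneg; first by rewrite big_ord0.
pose u i := A ord0 i; pose a := u ord0.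
have a0 : 0 < a.
  have := Apos (fun i => (i == ord0)%:R) _; rewrite /qform (bigD1 ord0) //=.
  rewrite (bigD1 ord0) //= ?eqxx !mul1r [X in _ + X + _]big1 ?[X in _ + _ + X]big1.
  - by rewrite !addr0; apply; exists ord0; rewrite eqxx oner_neq0.
  - by move=> i i0; rewrite big1 // => j _; rewrite (negPf i0) !mul0r.
  - by move=> i i0; rewrite (negPf i0) mulr0 mul0r.
pose S (i j : 'I_n) := A (lift ord0 i) (lift ord0 j) - u (lift ord0 i) * u (lift ord0 j) / a.
pose B' (i j : 'I_n) := B (lift ord0 i) (lift ord0 j).
have split_sum : \sum_i \sum_j A i j * B i j =
    a^-1 * qform B u + \sum_i \sum_j S i j * B' i j.
  have -> : a^-1 * qform B u = \sum_i \sum_j u i * u j / a * B i j.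
    rewrite /qform mulr_sumr; apply: eq_bigr => i _; rewrite mulr_sumr.
    by apply: eq_bigr => j _; rewrite [RHS]mulrAC mulrC.
  have row0 j : A ord0 j = u ord0 * u j / a.
    by rewrite -/a mulrAC divff ?mul1r // gt_eqF.
  have col0 i : A i ord0 = u i * u ord0 / a.
    by rewrite -/a mulfK ?gt_eqF // Asym.
  rewrite [LHS]big_ord_recl [X in _ = X + _]big_ord_recl -addrA; congr (_ + _).
    by apply: eq_bigr => j _; rewrite row0.
  rewrite -big_split /=; apply: eq_bigr => i _.
  rewrite [LHS]big_ord_recl [X in _ = X + _]big_ord_recl -addrA col0; congr (_ + _).
  rewrite -big_split /=; apply: eq_bigr => j _.
  by rewrite -mulrDl /S addrCA subrr addr0.
rewrite split_sum -[leRHS]addr0; apply: lerD.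
  by rewrite pmulr_rle0 ?invr_gt0 //; exact: Bneg.
apply: IH => [i j|w [k wk]|w].
- by rewrite /S Asym [u _ * _]mulrC.
- pose b := \sum_j w j * u (lift ord0 j).
  (* The first coordinate that minimizes the form A for the given other ones. *)
  pose w' i := if unlift ord0 i is Some j then w j else - (b / a).
  have w'0 : w' ord0 = - (b / a) by rewrite /w' unlift_none.
  have w'S j : w' (lift ord0 j) = w j by rewrite /w' liftK.
  have : 0 < qform A w' by apply: Apos; exists (lift ord0 k); rewrite w'S.
  rewrite qform_recl w'0.
  have -> : \sum_j w' (lift ord0 j) * A ord0 (lift ord0 j) = b.
    by apply: eq_bigr => j _; rewrite w'S.
  have -> : \sum_j w' (lift ord0 j) * A (lift ord0 j) ord0 = b.
    by apply: eq_bigr => j _; rewrite w'S Asym.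
  suff -> : qform S w = - (b / a) * b + qform (fun i j => A (lift ord0 i) (lift ord0 j)) w.
    have -> : qform (fun i j => A (lift ord0 i) (lift ord0 j)) (fun i => w' (lift ord0 i)) =
        qform (fun i j => A (lift ord0 i) (lift ord0 j)) w.
      by apply: eq_bigr => i _; apply: eq_bigr => j _; rewrite !w'S.
    have aN0 : a != 0 by rewrite gt_eqF.
    have -> : (- (b / a)) ^+ 2 * A ord0 ord0 + - (b / a) * b + - (b / a) * b =
        - (b / a) * b by rewrite -[A ord0 ord0]/a; field.
    by [].
  have -> : - (b / a) * b = \sum_i \sum_j - (w i * w j * (u (lift ord0 i) * u (lift ord0 j) / a)).
    rewrite mulNr mulrAC {1}/b !mulr_suml -sumrN; apply: eq_bigr => i _.
    rewrite /b mulr_sumr mulr_suml -sumrN; apply: eq_bigr => j _; ring.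
  rewrite /qform -big_split; apply: eq_bigr => i _; rewrite -big_split.
  by apply: eq_bigr => j _; rewrite /S mulrBr addrC.
- pose w' i := if unlift ord0 i is Some j then w j else 0.
  have w'S j : w' (lift ord0 j) = w j by rewrite /w' liftK.
  have w'0 : w' ord0 = 0 by rewrite /w' unlift_none.
  suff -> : qform B' w = qform B w' by exact: Bneg.
  rewrite qform_recl w'0 expr0n !mul0r !add0r.
  by apply: eq_bigr => i _; apply: eq_bigr => j _; rewrite !w'S.
Qed.

End QuadraticForms.

Section LocalMaximum.
Variables (R : realType) (n : nat).
Local Notation E := 'rV[R]_n.
Variables (U : set E) (u : E -> R) (x : E).
Hypothesis U_open : open U.
Hypothesis u_smooth : smooth_in U u.
Hypothesis Ux : U x.
Hypothesis x_max : \forall y \near x, u y <= u x.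

Let near_line (w : E) (P : E -> Prop) : (\forall y \near x, P y) ->
  exists2 d : R, 0 < d & forall t, `|t| < d -> P (t *: w + x).
Proof.
move=> nP; have : {for 0, continuous (fun t : R => t *: w + x)}.
  apply: continuousD; last exact: cst_continuous.
  exact: (@continuousZr_tmp _ _ _ (fun t : R => t) w 0 (@cvg_id _ _)).
rewrite /prop_for /continuous_at scale0r add0r => /(_ _ nP) /= /nbhs_ballP [d /= d0 dP].
by exists d => // t td; apply: dP; rewrite -ball_normE /= sub0r normrN.
Qed.

Lemma local_max_gradient i : 'D_('e_i) u x = 0.
Proof.
have nU : nbhs x U by move: U_open; rewrite openE; exact.
have [d d0 dP] := @near_line 'e_i _ (filterI nU x_max).
pose phi (t : R) := u (t *: 'e_i + x).
have phi0 : phi 0 = u x by rewrite /phi scale0r add0r.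
have itvd (t : R) : t \in `](- d), d[ -> `|t| < d by rewrite in_itv /= ltr_norml.
have phid (t : R) : `|t| < d -> is_derive t 1 phi ('D_('e_i) u (t *: 'e_i + x)).
  move=> /dP [Ut _]; apply: is_derive_line; apply/derivableP.
  exact: smooth_in_derivable u_smooth Ut.
have : is_derive (0 : R) 1 phi 0.
  apply: (@derive1_at_max _ phi (- d) d 0).
  - by rewrite -subr_ge0 opprK addr_ge0 // ltW.
  - by move=> t /itvd /phid [].
  - by rewrite in_itv /= oppr_lt0 d0.
  - by move=> t /itvd /dP [_]; rewrite phi0.
move=> [_ e2]; have [_ e1] : is_derive (0 : R) 1 phi ('D_('e_i) u (0 *: 'e_i + x)).
  by apply: phid; rewrite normr0.
by move: e1; rewrite scale0r add0r e2 => <-.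
Qed.

(** If the second derivative along w were positive, the first derivative would
    be positive shortly after x, and u would increase. *)
Lemma local_max_hessian (w : E) :
  qform (fun i j => 'D_('e_i) (fun y => 'D_('e_j) u y) x) (fun i => w ord0 i) <= 0.
Proof.
set q := qform _ _; rewrite leNgt; apply/negP => q0.
have nU : nbhs x U by move: U_open; rewrite openE; exact.
have [d d0 dP] := @near_line w _ (filterI nU x_max).
pose phi (t : R) : R := u (t *: w + x).
pose psi (t : R) : R := \sum_j w ord0 j * 'D_('e_j) u (t *: w + x).
have phi0 : phi 0 = u x by rewrite /phi scale0r add0r.
have phid (t : R) : `|t| < d -> is_derive t 1 phi (psi t).
  move=> /dP [Ut _]; apply: is_derive_line; exact: (smooth_in_is_derive w U_open u_smooth Ut).
have psi0 : psi 0 = 0.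
  rewrite /psi big1 // => j _; rewrite scale0r add0r.
  by rewrite local_max_gradient mulr0.
have psid : is_derive (0 : R) 1 psi q.
  have dj (j : 'I_n) : is_derive (0 : R) 1 (fun t => w ord0 j * 'D_('e_j) u (t *: w + x))
      (w ord0 j * \sum_i w ord0 i * 'D_('e_i) (fun y => 'D_('e_j) u y) x).
    have Ux0 : U (0 *: w + x) by rewrite scale0r add0r.
    have := is_derive_line
      (smooth_in_is_derive w U_open (smooth_in_derive j u_smooth) Ux0).
    rewrite scale0r add0r => dj.
    exact: (@is_deriveZ R R R (fun t => 'D_('e_j) u (t *: w + x)) (w ord0 j) 0 1 _ dj).
  have := is_derive_sum dj.
  have -> : \sum_(j < n) (fun t : R => w ord0 j * 'D_('e_j) u (t *: w + x)) = psi.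
    by apply/funext => t; rewrite fct_sumE.
  move=> dpsi; apply: (is_derive_eq dpsi).
  rewrite /q /qform exchange_big /=; apply: eq_bigr => j _; rewrite mulr_sumr.
  by apply: eq_bigr => i _; rewrite mulrA [w ord0 j * _]mulrC.
have : \forall t \near (0 : R)^', 0 < t^-1 * psi t.
  have [dpsi psiq] := psid.
  have : t^-1 *: ((psi \o shift 0) (t *: 1) - psi 0) @[t --> 0^'] --> q by rewrite -psiq.
  move=> /cvgr_gt /(_ _ q0); apply: filterS => t.
  by rewrite /= psi0 subr0 addr0 [t *: 1]mulr1.
rewrite near_withinE => /nbhs_ballP [e /= e0 eP].
pose t := Num.min d e / 2.
have de0 : 0 < Num.min d e by rewrite lt_min d0.
have t0 : 0 < t by rewrite divr_gt0.
have tde : t < Num.min d e by rewrite ltr_pdivrMr // ltr_pMr // ltr1n.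
have td : t < d by apply: lt_le_trans tde _; rewrite ge_min lexx.
have te : t < e by apply: lt_le_trans tde _; rewrite ge_min lexx orbT.
have itvd (s : R) : 0 <= s <= t -> `|s| < d.
  by move=> /andP[s0 st]; rewrite ger0_norm // (le_lt_trans st).
have [||s] := @MVT R phi psi 0 t t0.
- by move=> s; rewrite in_itv /= => /andP[s0 st]; apply: phid; apply: itvd; rewrite !ltW.
- apply: continuous_in_subspaceT => s; rewrite inE /= in_itv /= => /itvd /phid [pd _].
  exact/differentiable_continuous/derivable1_diffP.
rewrite in_itv /= subr0 => /andP[s0 st] phit.
have psis : 0 < psi s.
  have : 0 < s^-1 * psi s.
    apply: eP; last by rewrite gt_eqF.
    by rewrite -ball_normE /= sub0r normrN gtr0_norm // (lt_trans st).
  by rewrite pmulr_rgt0 // invr_gt0.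
have : phi t <= phi 0.
  by rewrite phi0; apply: (dP t _).2; rewrite gtr0_norm.
by rewrite -subr_le0 phit leNgt mulr_gt0.
Qed.

End LocalMaximum.

Section Barrier.
Variables (R : realType) (n : nat).
Local Notation E := 'rV[R]_n.+1.

Definition sqdist (x y : E) : R := \sum_i (x ord0 i - y ord0 i) ^+ 2.

Variables (y : E) (w : 'I_n.+1 -> R) (K : R).

Definition lin (x : E) : R := \sum_i w i * (x ord0 i - y ord0 i).

(** Up to higher order the superlevel set of this quadratic polynomial at
    height 0 lies in the ball through y with outward normal w. *)
Definition barrier (x : E) : R :=
  -2 * sqdist x y - 2 * lin x + 4 * K * lin x ^+ 2.

Lemma is_derive_coord (x v : E) i : is_derive x v (fun z : E => z ord0 i) (v ord0 i).
Proof.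
apply: line_is_derive.
have -> : (fun s : R => (s *: v + x) ord0 i) = (v ord0 i *: id) + (cst (x ord0 i)).
  by apply/funext => s; rewrite !mxE /= mulrC.
have := is_deriveD (is_deriveZ (v ord0 i) (is_derive_id (0 : R) 1))
  (is_derive_cst (x ord0 i) (0 : R) 1).
by rewrite addr0 [_ *: 1]mulr1.
Qed.

Lemma is_derive_lin (x v : E) : is_derive x v lin (\sum_i w i * v ord0 i).
Proof.
have -> : lin = \sum_i (w i *: ((fun z : E => z ord0 i) - cst (y ord0 i))).
  by apply/funext => z; rewrite fct_sumE.
apply: is_derive_sum => i.
have := is_deriveZ (w i) (is_deriveB (is_derive_coord x v i)
  (is_derive_cst (y ord0 i) x v)).
by rewrite subr0.
Qed.

Lemma is_derive_sqdist (x v : E) : is_derive x v (fun z => sqdist z y)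
  (\sum_i 2 * (x ord0 i - y ord0 i) * v ord0 i).
Proof.
have -> : (fun z => sqdist z y) =
    \sum_i ((fun z : E => z ord0 i) - cst (y ord0 i)) ^+ 2.
  by apply/funext => z; rewrite fct_sumE.
apply: is_derive_sum => i.
have := is_deriveX 2 (is_deriveB (is_derive_coord x v i)
  (is_derive_cst (y ord0 i) x v)).
move=> dX; apply: (is_derive_eq dX).
rewrite /GRing.scale /= subr0 expr1 -[(_ - _) x]/(x ord0 i - y ord0 i); ring.
Qed.

Definition barrier_d (j : 'I_n.+1) (x : E) : R :=
  -4 * (x ord0 j - y ord0 j) - 2 * w j + 8 * K * w j * lin x.

Lemma sum_e (F : 'I_n.+1 -> R) (j : 'I_n.+1) :
  \sum_i F i * ('e_j : E) ord0 i = F j.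
Proof.
have e_ i : ('e_j : E) ord0 i = (i == j)%:R by rewrite mxE.
rewrite (bigD1 j) //= big1 ?addr0 => [|i ij]; rewrite e_.
  by rewrite eqxx mulr1.
by rewrite (negPf ij) mulr0.
Qed.

Lemma is_derive_barrier (x : E) j : is_derive x 'e_j barrier (barrier_d j x).
Proof.
have -> : barrier = (-2 *: (fun z => sqdist z y)) - (2 *: lin) + (4 * K) *: (lin ^+ 2).
  by apply/funext => z.
have dq := is_derive_sqdist x 'e_j; have dl := is_derive_lin x 'e_j.
apply: (is_derive_eq (is_deriveD (is_deriveB (is_deriveZ (-2) dq) (is_deriveZ 2 dl))
  (is_deriveZ (4 * K) (is_deriveX 2 dl)))).
rewrite !sum_e /GRing.scale /= /barrier_d; ring.
Qed.

Lemma is_derive_barrier_d (x : E) i j :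
  is_derive x 'e_i (barrier_d j) (-4 * (j == i)%:R + 8 * K * w i * w j).
Proof.
have -> : barrier_d j = (-4 *: ((fun z : E => z ord0 j) - cst (y ord0 j))) -
    cst (2 * w j) + (8 * K * w j) *: lin.
  by apply/funext => z.
apply: (is_derive_eq (is_deriveD (is_deriveB (is_deriveZ (-4)
  (is_deriveB (is_derive_coord x 'e_i j) (is_derive_cst (y ord0 j) x 'e_i)))
  (is_derive_cst (2 * w j) x 'e_i)) (is_deriveZ (8 * K * w j) (is_derive_lin x 'e_i)))).
rewrite sum_e mxE /GRing.scale /=; ring.
Qed.

Lemma derive_barrier j : (fun x => 'D_('e_j) barrier x) = barrier_d j.
Proof. by apply/funext => x; case: (is_derive_barrier x j). Qed.

Lemma derive2_barrier i j (x : E) :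
  'D_('e_i) (fun z => 'D_('e_j) barrier z) x = -4 * (j == i)%:R + 8 * K * w i * w j.
Proof. by rewrite derive_barrier; case: (is_derive_barrier_d x i j). Qed.

Lemma smooth_in_coord U (i : 'I_n.+1) : open U -> smooth_in U (fun z : E => z ord0 i).
Proof.
move=> oU [|k]; split=> //; try by move=> x _; exact: coord_continuous.
move=> j; split; first by move=> x _; case: (is_derive_coord x 'e_j i).
apply: (@Ck_ext _ _ _ _ (fun=> ('e_j : E) ord0 i)) => //; last exact: Ck_cst.
by move=> x _; case: (is_derive_coord x 'e_j i).
Qed.

Lemma smooth_in_lin U : open U -> smooth_in U lin.
Proof.
move=> oU k; apply: Ck_sum => // i; apply: CkM => //; first exact: Ck_cst.
by apply: CkD => //; [exact: smooth_in_coord|exact: Ck_cst].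
Qed.

Lemma smooth_in_barrier U : open U -> smooth_in U barrier.
Proof.
move=> oU k.
have diff i : Ck k U (fun z : E => z ord0 i - y ord0 i).
  by apply: CkD => //; [exact: smooth_in_coord|exact: Ck_cst].
have Ck2 g : Ck k U g -> Ck k U (fun z : E => g z ^+ 2).
  by move=> gk; apply: (Ck_ext oU _ (CkM oU gk gk)) => x _; rewrite expr2.
have linC : Ck k U lin by exact: smooth_in_lin.
apply: (@Ck_ext _ _ _ _ (fun x =>
    -2 * sqdist x y + -2 * lin x + 4 * K * lin x ^+ 2)) => //.
  by move=> x _; rewrite /barrier !mulNr.
apply: CkD => //; last by apply: CkM => //; [exact: Ck_cst|exact: Ck2].
apply: CkD => //; apply: CkM => //; try exact: Ck_cst.
by apply: Ck_sum => // i; exact: Ck2.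
Qed.

(** Close to y the last term of the barrier is at most half of its linear term,
    so where the barrier is nonnegative the linear term wins over the squared
    distance. *)
Lemma barrier_lt0 (x : E) : x != y -> `|4 * K * lin x| <= 1 -> 0 <= barrier x ->
  sqdist x y + 2 * lin x < 0.
Proof.
move=> xy Kl; rewrite /barrier => h0.
have q0 : 0 < sqdist x y.
  have [i xyi] : exists i, x ord0 i != y ord0 i.
    apply/existsP; apply: contraR xy => /existsPn H; apply/eqP/rowP => i.
    by apply/eqP; rewrite -[_ == _]negbK.
  rewrite /sqdist (bigD1 i) //= ltr_pwDl ?exprn_even_gt0 ?subr_eq0 //.
  by apply: sumr_ge0 => j _; exact: sqr_ge0.
move: Kl; rewrite ler_norml => /andP[Kl1 Kl2].
move: h0; rewrite expr2 mulrA; set k := 4 * K * lin x in Kl1 Kl2 *; move=> h0.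
nra.
Qed.
End Barrier.

Section StrongMaximum.
Variables (R : realType) (n : nat).
Local Notation E := 'rV[R]_n.+1.
Variables (U : set E) (u : E -> R) (c m : R).
Variables (a : 'I_n.+1 -> 'I_n.+1 -> E -> R) (b : 'I_n.+1 -> E -> R).
Hypothesis U_open : open U.
Hypothesis u_smooth : smooth_in U u.
Hypothesis a_continuous : forall i j x, U x -> {for x, continuous (a i j)}.
Hypothesis b_continuous : forall i x, U x -> {for x, continuous (b i)}.
Hypothesis a_sym : forall i j x, U x -> a i j x = a j i x.
Hypothesis a_pos : forall x, U x -> pos_def (fun i j => a i j x).
Hypothesis c_ge0 : 0 <= c.
Hypothesis m_ge0 : 0 <= m.
Hypothesis u_le : forall x, U x -> u x <= m.

Let op (f : E -> R) (x : E) : R :=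
  \sum_i \sum_j a i j x * 'D_('e_i) (fun z => 'D_('e_j) f z) x +
  \sum_k b k x * 'D_('e_k) f x - c * f x.

Hypothesis u_eq : forall x, U x -> op u x = 0.

(** At a local maximum the gradient vanishes and the Hessian is negative. *)
Lemma op_local_max (f : E -> R) x : smooth_in U f -> U x ->
  (\forall y \near x, f y <= f x) -> 0 <= f x -> op f x <= 0.
Proof.
move=> fs Ux fmax f0; rewrite /op.
have -> : \sum_k b k x * 'D_('e_k) f x = 0.
  by rewrite big1 // => k _; rewrite (local_max_gradient U_open fs Ux fmax) mulr0.
rewrite addr0 subr_le0; apply: (@le_trans _ _ 0); last exact: mulr_ge0.
apply: (trace_mul_le0 (fun i j => a_sym i j Ux) (a_pos Ux)) => w.
have := local_max_hessian U_open fs Ux fmax (\row_i w i).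
by rewrite (_ : (fun i => (\row_i w i) ord0 i) = w) //; apply/funext => i; rewrite mxE.
Qed.

Lemma opD (f g : E -> R) (e : R) x : smooth_in U f -> smooth_in U g -> U x ->
  op (fun z => f z + e * g z) x = op f x + e * op g x.
Proof.
move=> fs gs Ux.
have dD f' g' (k : 'I_n.+1) z : smooth_in U f' -> smooth_in U g' -> U z ->
    'D_('e_k) (fun z => f' z + e * g' z) z = 'D_('e_k) f' z + e * 'D_('e_k) g' z.
  move=> f's g's Uz.
  have df := derivableP (smooth_in_derivable (i := k) f's Uz).
  have dg := derivableP (smooth_in_derivable (i := k) g's Uz).
  by have [_ ->] := is_deriveD df (is_deriveZ e dg).
have d2 i j : 'D_('e_i) (fun z => 'D_('e_j) (fun z => f z + e * g z) z) x =
    'D_('e_i) (fun z => 'D_('e_j) f z) x + e * 'D_('e_i) (fun z => 'D_('e_j) g z) x.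
  rewrite -dD //; try exact: smooth_in_derive.
  apply: near_eq_derive; have nU : nbhs x U by move: U_open; rewrite openE; exact.
  by apply: filterS nU => z Uz; exact: dD.
pose A (f' : E -> R) := \sum_i \sum_j a i j x * 'D_('e_i) (fun z => 'D_('e_j) f' z) x.
pose B (f' : E -> R) := \sum_k b k x * 'D_('e_k) f' x.
have AD : A (fun z => f z + e * g z) = A f + e * A g.
  rewrite /A mulr_sumr -big_split; apply: eq_bigr => i _ /=.
  rewrite mulr_sumr -big_split; apply: eq_bigr => j _ /=.
  by rewrite d2 mulrDr (mulrCA (a i j x)).
have BD : B (fun z => f z + e * g z) = B f + e * B g.
  rewrite /B mulr_sumr -big_split; apply: eq_bigr => k _ /=.
  by rewrite dD // mulrDr (mulrCA (b k x)).
rewrite -[LHS]/(A _ + B _ - c * (f x + e * g x)) AD BD.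
rewrite -[op f x]/(A f + B f - c * f x) -[op g x]/(A g + B g - c * g x).
by move: (A f) (A g) (B f) (B g) => *; ring.
Qed.

(** The maximum value m is not attained at a point y which is on the boundary
    of a ball in which u < m: for a suitable curvature K of the barrier and a
    small e the function u + e * barrier would have an interior maximum in a
    small cube around y, where it is a strict subsolution. *)
Lemma no_touching_ball (y : E) (w : 'I_n.+1 -> R) : U y -> u y = m ->
  (exists i, w i != 0) ->
  (\forall x \near y, sqdist x y + 2 * lin y w x < 0 -> u x < m) -> False.
Proof.
move=> Uy uy w0 ball_lt.
have qw0 := a_pos Uy w0; set qw := qform _ _ in qw0.
pose T := \sum_i a i i y; pose S := \sum_k b k y * w k.
(* The curvature for which the operator has the value 1 on the barrier at y. *)
pose K := (4 * T + 2 * S + 1) / (8 * qw).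
pose h := barrier y w K.
pose Lh x := \sum_i \sum_j a i j x * (-4 * (j == i)%:R + 8 * K * w i * w j) +
  \sum_k b k x * barrier_d y w K k x - c * h x.
have opE x : op h x = Lh x.
  rewrite /op /Lh; congr (_ + _ - _).
    by apply: eq_bigr => i _; apply: eq_bigr => j _; rewrite derive2_barrier.
  by apply: eq_bigr => k _; have [_ ->] := is_derive_barrier y w K x k.
have liny : lin y w y = 0 by rewrite /lin big1 // => i _; rewrite subrr mulr0.
have sqy : sqdist y y = 0 by rewrite /sqdist big1 // => i _; rewrite subrr expr0n.
have hy : h y = 0 by rewrite /h /barrier liny sqy expr0n !mulr0 subr0 addr0.
have Lhy : Lh y = 1.
  rewrite /Lh hy mulr0 subr0.
  have -> : \sum_i \sum_j a i j y * (-4 * (j == i)%:R + 8 * K * w i * w j) =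
      -4 * T + 8 * K * qw.
    rewrite /T /qw /qform !mulr_sumr -big_split; apply: eq_bigr => i _ /=.
    rewrite mulr_sumr (bigD1 i) //= [X in _ = _ + X](bigD1 i) //= eqxx mulr1.
    rewrite mulrDr -!addrA; congr (_ + _); first by rewrite mulrC.
    congr (_ + _); first by ring.
    apply: eq_bigr => j ji; rewrite (negPf ji) mulr0 add0r; ring.
  have -> : \sum_k b k y * barrier_d y w K k y = -2 * S.
    rewrite /S mulr_sumr; apply: eq_bigr => k _.
    rewrite /barrier_d liny subrr; ring.
  have : qw != 0 by rewrite gt_eqF.
  by move=> qN0; rewrite /K; field.
have hc : continuous h.
  by move=> x; exact: (smooth_in_continuous (smooth_in_barrier y w K openT) I).
have linc : continuous (lin y w).
  by move=> x; exact: (smooth_in_continuous (smooth_in_lin y w openT) I).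
have bdc k : continuous (barrier_d y w K k).
  move=> x; rewrite -derive_barrier.
  exact: (smooth_in_continuous (smooth_in_derive k (smooth_in_barrier y w K openT)) I).
have Lhc : {for y, continuous Lh}.
  apply: continuousB; last first.
    by apply: continuousM; [exact: cst_continuous|exact: hc].
  apply: continuousD.
    apply: continuous_sum => i; apply: continuous_sum => j.
    by apply: continuousM; [exact: a_continuous|exact: cst_continuous].
  apply: continuous_sum => k.
  by apply: continuousM; [exact: b_continuous|exact: bdc].
have [e e0 good] : exists2 e, 0 < e & forall x, cube y e x ->
    [/\ U x, 0 < Lh x, `|4 * K * lin y w x| <= 1 &
        sqdist x y + 2 * lin y w x < 0 -> u x < m].
  have nU : nbhs y U by move: U_open; rewrite openE; exact.
  have nL : \forall x \near y, 0 < Lh x by move/cvgr_gt : Lhc; apply; rewrite Lhy.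
  have nK : \forall x \near y, `|4 * K * lin y w x| <= 1.
    have kc : {for y, continuous (fun x => 4 * K * lin y w x)}.
      by apply: continuousM; [exact: cst_continuous|exact: linc].
    have /cvgrPdist_le /(_ 1 ltr01) := kc; apply: filterS => x.
    by rewrite liny mulr0 sub0r normrN.
  have nall : \forall x \near y, (U x /\ 0 < Lh x) /\ (`|4 * K * lin y w x| <= 1 /\
      (sqdist x y + 2 * lin y w x < 0 -> u x < m)).
    exact: filterI (filterI nU nL) (filterI nK ball_lt).
  move: nall => /nbhs_ballP [r /= r0 rP].
  exists (r / 2) => [|x xy]; first by rewrite divr_gt0.
  have [] : (U x /\ 0 < Lh x) /\ (`|4 * K * lin y w x| <= 1 /\
      (sqdist x y + 2 * lin y w x < 0 -> u x < m)).
    apply: rP; rewrite ball_rVE; apply: le_lt_trans xy _.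
    by rewrite ltr_pdivrMr // ltr_pMr // ltr1n.
  by move=> [Ux Lx] [kx bx].
have cubeU x : cube y e x -> U x by case/good.
have uc x : cube y e x -> {for x, continuous u}.
  by move=> /cubeU; exact: smooth_in_continuous u_smooth.
pose sphere := cube y e `&` [set x | `|x - y| = e].
have sphere_compact : compact sphere.
  apply: compact_closedI; first exact: cube_compact.
  apply: (@closed_comp _ _ (fun x : E => `|x - y|) [set t | t = e]).
    by move=> x _; exact: dist_continuous.
  exact: closed_eq.
have : \forall eta \near 0^'+, sphere `<=` (fun x => u x + eta * h x < m).
  apply: ((compact_near_coveringP _).1 sphere_compact) => x [xy xe].
  have [Ux _ kx bx] := good x xy.
  have [hx|hx] := ltP (h x) 0.
    have nh : \forall z \near x, h z < 0 by move/cvgr_lt : (hc x); apply.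
    have nU : nbhs x U by move: U_open; rewrite openE; exact.
    exists ([set z | h z < 0] `&` U, [set eta | 0 < eta]) => /=.
      by split; [exact: filterI|exact: nbhs_right_gt].
    move=> [z eta] /= [[hz Uz] eta0].
    by rewrite -[ltRHS]addr0 ler_ltD ?u_le // pmulr_rlt0.
  have ux : u x < m.
    apply: bx; apply: barrier_lt0 kx hx; apply/eqP => xy'.
    by move: e0; rewrite -xe xy' subrr normr0 ltxx.
  pose m' := (u x + m) / 2; pose H := `|h x| + 1.
  have H0 : 0 < H by rewrite ltr_wpDl.
  have [um' m'm] : u x < m' /\ m' < m by rewrite /m'; split; lra.
  have nu' : \forall z \near x, u z < m'.
    by have /cvgr_lt := uc x xy; apply.
  have nh : \forall z \near x, h z < H.
    by have /cvgr_lt := hc x; apply; rewrite /H; have := ler_norm (h x); lra.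
  exists ([set z | u z < m'] `&` [set z | h z < H],
          [set eta | 0 < eta] `&` [set eta | eta < (m - m') / H]) => /=.
    split; first exact: filterI.
    by apply: filterI; [exact: nbhs_right_gt|apply: nbhs_right_lt; rewrite divr_gt0 ?subr_gt0].
  move=> [z eta] /= [[uz hz] [eta0 etaH]].
  have : eta * h z < m - m'.
    apply: (@lt_trans _ _ (eta * H)); first by rewrite ltr_pM2l.
    by rewrite -ltr_pdivlMr.
  by move: uz; lra.
move=> sphere_lt.
have [eta [eta0 {}sphere_lt]] : exists eta : R, 0 < eta /\
    sphere `<=` (fun x => u x + eta * h x < m).
  near (0 : R)^'+ => eta; exists eta; split; last by near: eta.
  by near: eta; exact: nbhs_right_gt.
pose W x := u x + eta * h x.
have Wc : {within cube y e, continuous W}.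
  apply: continuous_in_subspaceT => x; rewrite inE => /uc ucx.
  have ehc : {for x, continuous (fun z => eta * h z)}.
    by apply: continuousM; [exact: cst_continuous|exact: hc].
  exact: (continuousD ucx ehc).
have yy : cube y e y by rewrite /cube /= subrr normr0 ltW.
have [||z zy zmax] := @compact_EVT_max _ R W (cube y e) _ _ Wc.
- by exists y.
- exact: cube_compact.
have {}zy : cube y e z by move: zy; rewrite inE.
have Wz : m <= W z.
  rewrite -uy -[u y]addr0 -[X in u y + X](mulr0 eta) -{1}hy.
  by apply: zmax; rewrite inE.
have [Uz Lz _ _] := good z zy.
have zint : `|z - y| < e.
  rewrite lt_neqAle zy andbT; apply/eqP => ze.
  by have := sphere_lt z (conj zy ze); rewrite ltNge Wz.
have Wsm : smooth_in U W.
  move=> k; apply: CkD => //; apply: CkM => //; first exact: Ck_cst.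
  exact: smooth_in_barrier.
have : op W z <= 0.
  apply: op_local_max => //; last exact: le_trans Wz.
  have : nbhs z (ball y e) by apply: open_nbhs_nbhs; split; [exact: ball_open|rewrite ball_rVE].
  apply: filterS => x; rewrite ball_rVE => /ltW xy.
  by apply: zmax; rewrite inE.
rewrite opD //; last exact: smooth_in_barrier.
by rewrite u_eq // add0r opE leNgt mulr_gt0.
Unshelve. all: by end_near. Qed.

Lemma norm_le_sqdist (x z x' z' : E) : sqdist x z <= sqdist x' z' ->
  `|x - z| <= n.+1%:R * `|x' - z'|.
Proof.
move=> le_sq; rewrite rV_norm_le ?mulr_ge0 //; apply/forallP => i.
rewrite !mxE -(@ler_pXn2r _ 2) ?nnegrE ?mulr_ge0 // real_normK ?num_real //.
apply: (@le_trans _ _ (sqdist x z)).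
  by rewrite /sqdist (bigD1 i) //= lerDl; apply: sumr_ge0 => j _; exact: sqr_ge0.
apply: le_trans le_sq _; rewrite exprMn.
apply: (@le_trans _ _ (\sum_(i < n.+1) `|x' - z'| ^+ 2)).
  apply: ler_sum => j _; rewrite -[leLHS]real_normK ?num_real //.
  rewrite ler_pXn2r ?nnegrE //.
  by have := rV_norm_coord (x' - z') j; rewrite !mxE.
rewrite sumr_const card_ord -[leLHS]mulr_natl ler_wpM2r ?sqr_ge0 //.
by rewrite -natrX ler_nat expnS expn1 leq_pmulr.
Qed.

(** Hopf's strong maximum principle: if a point x0 near p had u x0 < m, then
    the largest ball around x0 in which u < m would touch the set where u = m. *)
Theorem strong_maximum p : U p -> u p = m -> \forall x \near p, u x = m.
Proof.
move=> Up up; have [r r0 rU] := open_subcube U_open Up.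
have n0 : 0 < n.+2%:R :> R by rewrite ltr0n.
apply/nbhs_ballP; exists (r / n.+2%:R) => /=; first by rewrite divr_gt0.
move=> x0; rewrite ball_rVE => px0; apply: contrapT => /eqP ux0.
(* The point y of D closest to x0 lies in the cube, since x0 is so close to p
   that the ball around x0 through p stays inside it. *)
pose D := cube p r `&` [set x | u x = m].
have uc x : cube p r x -> {for x, continuous u}.
  by move=> /rU; exact: smooth_in_continuous u_smooth.
have Dclosed : closed D.
  move=> x Dx; have px : cube p r x.
    have clC : closed (cube p r) by apply: compact_closed => //; exact: cube_compact.
    by have := closureS (@subIsetl _ _ _) Dx; rewrite -((closure_id _).1 clC).
  split=> //; apply: contrapT => /= /eqP uxm.
  have nm : \forall z \near x, u z != m.
    have : nbhs (u x) [set t | t != m].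
      by apply: open_nbhs_nbhs; split=> //; exact: open_neq.
    exact: uc.
  by have [z [[_ /= uz]]] := Dx _ nm; rewrite uz eqxx.
have Dcompact : compact D.
  apply: (subclosed_compact Dclosed (@cube_compact _ _ p r)); exact: subIsetl.
have Dp : D p by split=> //; rewrite /cube /= subrr normr0 ltW.
have sqc : {within D, continuous (fun x => sqdist x x0)}.
  apply: continuous_subspaceT => x; apply: continuous_sum => i.
  apply: (@continuous_comp _ _ _ (fun x : E => x ord0 i - x0 ord0 i) (fun t => t ^+ 2)).
    by apply: continuousB; [exact: coord_continuous|exact: cst_continuous].
  exact: exprn_continuous.
have [||y Dy ymin] := @compact_EVT_min _ R (fun x => sqdist x x0) D _ _ sqc.
- by exists p.
- by [].
have {Dy}[py uy] : D y by move: Dy; rewrite inE.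
pose w i := y ord0 i - x0 ord0 i.
have sqE x : sqdist x y + 2 * lin y w x = sqdist x x0 - sqdist y x0.
  rewrite /sqdist /lin mulr_sumr -sumrB -big_split; apply: eq_bigr => i _ /=.
  rewrite /w; ring.
apply: (@no_touching_ball y w (rU _ py) uy).
  apply/existsP; apply: contraR ux0 => /existsPn w0.
  rewrite -uy; apply/eqP; congr u; apply/rowP => i; apply/esym/eqP.
  by rewrite -subr_eq0; have := w0 i; rewrite negbK.
have : nbhs y U by move: U_open; rewrite openE; apply; exact: rU.
apply: filterS => x Ux; rewrite sqE subr_lt0 => xlt.
rewrite lt_neqAle u_le // andbT; apply/eqP => uxm.
have xp : sqdist x x0 <= sqdist p x0.
  by apply: (le_trans (ltW xlt)); apply: ymin; rewrite inE.
have : D x.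
  split=> //; rewrite /cube /= -(subrK x0 x) -addrA.
  rewrite (le_trans (ler_normD _ _)) //.
  apply: (@le_trans _ _ (n.+2%:R * `|x0 - p|)).
    rewrite -[n.+2]addn1 natrD mulrDl mul1r lerD2r distrC [`|x0 - p|]distrC distrC.
    exact: norm_le_sqdist.
  by rewrite mulrC -ler_pdivlMr // ltW.
by move=> Dx; have := ymin x; rewrite inE leNgt xlt => /(_ Dx).
Qed.

End StrongMaximum.

(** * The static equation in an interior chart *)

Section InteriorCalculus.
Variables (R : realType) (n : nat).
Local Notation E := 'rV[R]_n.+1.

Lemma open_positive : open [set x : E | 0 < x ord0 ord0].
Proof.
apply: (@open_comp _ _ (fun x : E => x ord0 ord0) [set t | 0 < t]).
  by move=> x _; exact: coord_continuous.
exact: open_gt.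
Qed.

Lemma pd_derive i (f : E -> R) (x : E) : 0 < x ord0 ord0 -> pd i f x = 'D_('e_i) f x.
Proof.
move=> x0; rewrite /pd /derive.
have nH : \forall h \near (0 : R)^', halfspace (x + h *: 'e_i).
  have nP : nbhs x [set z : E | 0 < z ord0 ord0].
    by apply: open_nbhs_nbhs; split=> //; exact: open_positive.
  have lc : {for 0, continuous (fun h : R => x + h *: ('e_i : E))}.
    apply: continuousD; first exact: cst_continuous.
    exact: (@continuousZr_tmp _ _ _ (fun t : R => t) ('e_i : E) 0 (@cvg_id _ _)).
  apply: nbhs_dnbhs; have := lc; rewrite /prop_for /continuous_at scale0r addr0.
  by move=> /(_ _ nP); apply: filterS => h /=; exact: ltW.
have -> : within [set h : R | halfspace (x + h *: 'e_i)] (0 : R)^' = (0 : R)^'.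
  apply/seteqP; split => P PH; last exact: (@filterS _ (0 : R)^' _ P _ _ PH).
  by apply: (@filterS2 _ (0 : R)^' _ _ _ P _ nH PH) => h hH; exact.
have -> // : (fun h : R => h^-1 * (f (x + h *: 'e_i) - f x)) =
    (fun h => h^-1 *: ((f \o shift x) (h *: 'e_i) - f x)).
by apply/funext => h; rewrite /= [h *: _ + x]addrC.
Qed.

Variable U : set E.
Hypothesis U_open : open U.
Hypothesis U_pos : U `<=` [set x | 0 < x ord0 ord0].

Lemma pd_in i (f : E -> R) x : U x -> pd i f x = 'D_('e_i) f x.
Proof. by move=> /U_pos; exact: pd_derive. Qed.

Lemma pd2_in i j (f : E -> R) x : U x ->
  pd i (pd j f) x = 'D_('e_i) (fun z => 'D_('e_j) f z) x.
Proof.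
move=> Ux; transitivity ('D_('e_i) (pd j f) x); first exact: pd_in.
apply: near_eq_derive.
have nU : nbhs x U by move: U_open; rewrite openE; exact.
by apply: filterS nU => z Uz; exact: pd_in.
Qed.

Lemma smooth_in_ext (f f' : E -> R) : (forall x, U x -> f x = f' x) ->
  smooth_in U f -> smooth_in U f'.
Proof. by move=> ff' fs k; exact: Ck_ext (fs k). Qed.

Lemma smooth_in_pd i (f : E -> R) : smooth_in U f -> smooth_in U (pd i f).
Proof.
move=> fs; apply: smooth_in_ext (smooth_in_derive i fs) => x Ux.
by rewrite pd_in.
Qed.

Variable G : E -> 'M[R]_n.+1.
Hypothesis G_smooth : forall i j, smooth_in U (fun x => G x i j).
Hypothesis G_sym : forall x, U x -> (G x)^T = G x.
Hypothesis G_pos : forall x, U x -> forall v : 'rV[R]_n.+1, v != 0 ->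
  0 < (v *m G x *m v^T) ord0 ord0.

Lemma G_unit x : U x -> G x \in unitmx.
Proof.
move=> Ux; rewrite -row_free_unit -kermx_eq0; apply/eqP/row_matrixP => i.
rewrite row0; apply/eqP; apply: contraT => vN0.
have := G_pos Ux vN0; set v := row i _ in vN0 *.
have -> : v *m G x = 0.
  by apply/sub_kermxP; exact: row_sub.
by rewrite mul0mx mxE ltxx.
Qed.

Lemma ginv_smooth i j : smooth_in U (fun x => ginv G x i j).
Proof.
move=> k; apply: Ck_invmx => //; first exact: G_unit.
by move=> a b; exact: G_smooth.
Qed.

Lemma ginv_sym i j x : U x -> ginv G x i j = ginv G x j i.
Proof.
by move=> Ux; rewrite /ginv -{1}(G_sym Ux) -trmx_inv mxE.
Qed.

Lemma mulmx_qform (A : 'M[R]_n.+1) (v : 'rV[R]_n.+1) :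
  (v *m A *m v^T) ord0 ord0 = qform (fun i j => A i j) (fun i => v ord0 i).
Proof.
rewrite /qform exchange_big mxE; apply: eq_bigr => j _ /=.
rewrite !mxE mulr_suml; apply: eq_bigr => i _; ring.
Qed.

Lemma ginv_pos x : U x -> pos_def (fun i j => ginv G x i j).
Proof.
move=> Ux w [k wk]; pose v := \row_i w i.
have -> : qform (fun i j => ginv G x i j) w = (v *m ginv G x *m v^T) ord0 ord0.
  by rewrite mulmx_qform; apply: eq_bigr => i _; apply: eq_bigr => j _; rewrite !mxE.
have v0 : v *m ginv G x != 0.
  apply/eqP => /(congr1 (mulmx^~ (G x))); rewrite mul0mx mulmxKV ?G_unit //.
  by move=> /rowP /(_ k); rewrite !mxE => /eqP; rewrite (negPf wk).
have := G_pos Ux v0.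
by rewrite trmx_mul mulmxA mulmxKV ?G_unit // trmx_inv G_sym.
Qed.

Lemma christoffel_smooth k i j : smooth_in U (christoffel G k i j).
Proof.
move=> m; apply: CkM => //; first exact: Ck_cst.
apply: Ck_sum => // l; apply: CkM => //; first exact: ginv_smooth.
apply: (@Ck_ext _ _ _ _ (fun x => pd i (fun y => G y j l) x +
  pd j (fun y => G y i l) x + -1 * pd l (fun y => G y i j) x)) => //.
  by move=> x _; rewrite mulN1r.
apply: CkD => //; first by apply: CkD => //; exact: smooth_in_pd.
by apply: CkM => //; [exact: Ck_cst|exact: smooth_in_pd].
Qed.

Lemma ricci_smooth i j : smooth_in U (fun x => ricci G x i j).
Proof.
move=> m.
apply: (@Ck_ext _ _ _ _ (fun x => \sum_k
  (pd k (christoffel G k j i) x + -1 * pd j (christoffel G k k i) x +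
   \sum_m (christoffel G k k m x * christoffel G m j i x +
           -1 * (christoffel G k j m x * christoffel G m k i x))))) => //.
  move=> x _; rewrite mxE; apply: eq_bigr => k _.
  rewrite /riemann mulN1r; congr (_ + _); apply: eq_bigr => l _.
  by rewrite mulN1r.
have chr k' i' j' : Ck m U (christoffel G k' i' j') by exact: christoffel_smooth.
have pchr l k' i' j' : Ck m U (pd l (christoffel G k' i' j')).
  exact: (smooth_in_pd _ (christoffel_smooth _ _ _)).
have N1 f : Ck m U f -> Ck m U (fun x => -1 * f x).
  by move=> fk; apply: CkM => //; exact: Ck_cst.
apply: Ck_sum => // k; apply: CkD => //; first by apply: CkD => //; exact: N1.
apply: Ck_sum => // l; apply: CkD => //; first exact: CkM.
by apply: N1; exact: CkM.
Qed.

Variables (v : E -> R) (Lambda : R).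
Hypothesis n_gt0 : (0 < n)%N.
Hypothesis v_static : forall x, U x ->
  hess G v x - laplacian G v x *: G x - v x *: ricci G x = 0.
Hypothesis scal_cst : forall x, U x -> scal G x = (n.+1%:R - 1) * Lambda.

Lemma static_hess x i j : U x ->
  hess G v x i j = laplacian G v x * G x i j + v x * ricci G x i j.
Proof.
move=> /v_static /matrixP /(_ i j); rewrite !mxE => /eqP.
by rewrite -addrA -opprD subr_eq0 => /eqP.
Qed.

(** The trace of the static equation, with the scalar curvature replaced by its
    constant value. *)
Lemma static_laplacian x : U x -> laplacian G v x = - Lambda * v x.
Proof.
move=> Ux; set L := laplacian G v x.
have trG : \sum_i \sum_j ginv G x i j * G x i j = n.+1%:R.
  transitivity (\tr (ginv G x *m G x)).
    rewrite /mxtrace; apply: eq_bigr => i _; rewrite mxE; apply: eq_bigr => j _.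
    by rewrite -[in LHS](G_sym Ux) mxE.
  by rewrite mulVmx ?G_unit // mxtrace1.
have : L = L * n.+1%:R + v x * ((n.+1%:R - 1) * Lambda).
  rewrite -(scal_cst Ux) -trG /scal /trace_g !mulr_sumr -big_split /=.
  rewrite {1}/L /laplacian /trace_g; apply: eq_bigr => i _.
  rewrite !mulr_sumr -big_split; apply: eq_bigr => j _ /=.
  by rewrite static_hess // -/L; ring.
have n0 : n.+1%:R - 1 != 0 :> R by rewrite -natr1 addrK pnatr_eq0 -lt0n.
move=> Leq; apply: (mulfI n0); lra.
Qed.

(** The static equation gives all second derivatives of the potential: this is
    what makes unique continuation a matter of ordinary differential equations. *)
Lemma static_second_derivative x i j : U x ->
  'D_('e_i) (fun y => 'D_('e_j) v y) x =
  \sum_k christoffel G k i j x * 'D_('e_k) v x +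
  v x * (ricci G x i j - Lambda * G x i j).
Proof.
move=> Ux; have := static_hess i j Ux; rewrite mxE pd2_in // static_laplacian //.
under eq_bigr => k _ do rewrite pd_in //.
by move=> /eqP; rewrite subr_eq => /eqP ->; ring.
Qed.

Lemma static_trace x : U x ->
  \sum_i \sum_j ginv G x i j * 'D_('e_i) (fun y => 'D_('e_j) v y) x +
  \sum_k (- \sum_i \sum_j ginv G x i j * christoffel G k i j x) * 'D_('e_k) v x
  - (- Lambda) * v x = 0.
Proof.
move=> Ux; rewrite -static_laplacian // /laplacian /trace_g.
apply/eqP; rewrite subr_eq0; apply/eqP.
have -> : \sum_k (- \sum_i \sum_j ginv G x i j * christoffel G k i j x) * 'D_('e_k) v x =
    \sum_i \sum_j \sum_k - (ginv G x i j * christoffel G k i j x * 'D_('e_k) v x).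
  under [RHS]eq_bigr => i _ do rewrite exchange_big /=.
  rewrite [RHS]exchange_big /=; apply: eq_bigr => k _.
  rewrite mulNr mulr_suml -sumrN; apply: eq_bigr => i _.
  by rewrite mulr_suml -sumrN.
rewrite -big_split; apply: eq_bigr => i _ /=; rewrite -big_split.
apply: eq_bigr => j _ /=; rewrite mxE pd2_in // mulrBr; congr (_ + _).
rewrite mulr_sumr -sumrN; apply: eq_bigr => k _; rewrite pd_in //; ring.
Qed.

End InteriorCalculus.

(** * From charts to the manifold *)

Section InteriorRegions.
Variables (R : realType) (n : nat) (M : topologicalType) (X : bmanifold R n M).
Implicit Types (a : chart_index X) (p q : M) (V : M -> R).

(** An open set, on which the partial derivatives relative to the half-space are
    the usual ones. *)
Definition interior_region a : set 'rV[R]_n.+1 :=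
  (phi a @` dom a) `&` [set x | 0 < x ord0 ord0].

Lemma phiK a p : dom a p -> psi a (phi a p) = p.
Proof. by have [_ [W _ [fP _ _ _]]] := chartP a => /fP[]. Qed.

Lemma dom_open a : open (dom a). Proof. by case: (chartP a). Qed.

Lemma phi_continuous a p : dom a p -> {for p, continuous (phi a)}.
Proof.
have [oU [W _ hom]] := chartP a.
exact: homeo_between_continuous hom oU.
Qed.

Lemma interior_region_homeo a : exists2 W : set 'rV[R]_n.+1, open W &
  homeo_between (dom a `&` phi a @^-1` [set x | 0 < x ord0 ord0]) W (phi a) (psi a) /\
  interior_region a = W.
Proof.
have [oU [W oW hom]] := chartP a; have [fP hP _ _] := hom.
pose W' : set 'rV[R]_n.+1 := W `&` [set x | 0 < x ord0 ord0].
exists W'; first by apply: openI => //; exact: open_positive.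
split.
  apply: homeo_between_sub hom _ _ _; first by move=> x [].
    by move=> x dx; have [[_ Wx] _] := fP x dx; split => -[].
  by move=> x [Wx x0]; split=> //; exact: ltW.
apply/seteqP; split => x.
  by move=> [[p dp <-] x0]; have [[_ Wx] _] := fP p dp; split.
move=> [Wx x0]; have [dx fx] := hP x (conj (ltW x0) Wx).
by split=> //; exists (psi a x).
Qed.

Lemma interior_region_open a : open (interior_region a).
Proof. by have [W oW [_ ->]] := interior_region_homeo a. Qed.

Lemma interior_regionP a x : interior_region a x ->
  [/\ dom a (psi a x), phi a (psi a x) = x & {for x, continuous (psi a)}].
Proof.
have [W oW [hom ->]] := interior_region_homeo a.
move=> Wx; have [_ hP fc hc] := hom; have [[dx _] fx] := hP x Wx.
split=> //.
suff hom' : homeo_between W (dom a `&` phi a @^-1` [set x | 0 < x ord0 ord0])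
    (psi a) (phi a) by exact: homeo_between_continuous hom' oW Wx.
by case: hom => *; split.
Qed.

Lemma minterior_region a p : minterior X p -> dom a p -> interior_region a (phi a p).
Proof.
move=> pint dp; split; first by exists p.
have [_ [W _ [fP _ _ _]]] := chartP a; have [[Hp _] _] := fP p dp.
rewrite /= lt_def; apply/andP; split; last exact: Hp.
by apply/eqP => p0; apply: pint; exists a.
Qed.

Lemma near_region a p (P : M -> Prop) : minterior X p -> dom a p ->
  (\forall q \near p, P q) -> \forall x \near phi a p, P (psi a x).
Proof.
move=> pint dp nP; have [_ _ hc] := interior_regionP (minterior_region pint dp).
by move: hc; rewrite /prop_for /continuous_at phiK // => /(_ _ nP).
Qed.

Lemma near_manifold a p (P : M -> Prop) : dom a p ->
  (\forall x \near phi a p, P (psi a x)) -> \forall q \near p, P q.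
Proof.
move=> dp nP; have nd : nbhs p (dom a) by apply: open_nbhs_nbhs; split=> //; exact: dom_open.
have nP' : nbhs p (phi a @^-1` [set x | P (psi a x)]) := phi_continuous dp nP.
by apply: filterS2 nd nP' => q dq /=; rewrite phiK.
Qed.

Lemma smooth_on_region a (f : 'rV[R]_n.+1 -> R) :
  smooth_on (phi a @` dom a) f -> smooth_in (interior_region a) f.
Proof.
move=> fs k; apply: Ck_local => x [dx x0].
have [U [F [oU Ux Fk Ff]]] := fs x dx.
exists (U `&` interior_region a), F; split.
- by apply: openI => //; exact: interior_region_open.
- by split.
- by apply: Ck_sub (Fk k) => z [].
- by move=> z [Uz [dz _]]; apply: Ff; split.
Qed.

Variables (g : riemannian_metric X) (Lambda : R).

(** The coefficients of the first order part of the Laplacian. *)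
Definition laplace_drift a k x : R :=
  - \sum_i \sum_j ginv (gmx g a) x i j * christoffel (gmx g a) k i j x.

(** The equation Delta V + Lambda V = 0 at the interior points, in the
    coordinates of each chart. *)
Definition laplace_eq V := forall a,
  smooth_in (interior_region a) (V \o psi a) /\
  forall x, interior_region a x ->
    \sum_i \sum_j ginv (gmx g a) x i j *
       'D_('e_i) (fun y => 'D_('e_j) (V \o psi a) y) x +
    \sum_k laplace_drift a k x * 'D_('e_k) (V \o psi a) x
    - (- Lambda) * (V \o psi a) x = 0.

Lemma gmx_region_smooth a i j : smooth_in (interior_region a) (fun x => gmx g a x i j).
Proof. exact/smooth_on_region/gmx_smooth. Qed.

Lemma gmx_region_sym a x : interior_region a x -> (gmx g a x)^T = gmx g a x.
Proof. by move=> [[p dp <-] _]; exact: gmx_sym. Qed.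

Lemma gmx_region_pos a x : interior_region a x -> forall v : 'rV[R]_n.+1, v != 0 ->
  0 < (v *m gmx g a x *m v^T) ord0 ord0.
Proof. by move=> [[p dp <-] _]; exact: gmx_pos. Qed.

Lemma region_pos a : interior_region a `<=` [set x | 0 < x ord0 ord0].
Proof. by move=> x []. Qed.

Lemma laplace_eqN V : laplace_eq V -> laplace_eq (fun p => - V p).
Proof.
move=> VL a; have [Vs Veq] := VL a.
pose v := V \o psi a.
have vs' : smooth_in (interior_region a) (fun x => - v x).
  move=> k; apply: (@Ck_ext _ _ _ _ (fun x => -1 * v x)).
  - exact: interior_region_open.
  - by move=> x _; rewrite mulN1r.
  - by apply: CkM; [exact: interior_region_open|exact: Ck_cst|exact: Vs].
split=> // x Ux.
have dN (f : 'rV[R]_n.+1 -> R) i z : smooth_in (interior_region a) f ->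
    interior_region a z -> 'D_('e_i) (fun z => - f z) z = - 'D_('e_i) f z.
  by move=> fs Uz; rewrite -deriveN //; exact: smooth_in_derivable fs Uz.
have d2 i j : 'D_('e_i) (fun y => 'D_('e_j) (fun z => - v z) y) x =
    - 'D_('e_i) (fun y => 'D_('e_j) v y) x.
  rewrite -(dN _ _ _ (smooth_in_derive j Vs) Ux); apply: near_eq_derive.
  have nU : nbhs x (interior_region a).
    by apply: open_nbhs_nbhs; split=> //; exact: interior_region_open.
  by apply: filterS nU => z Uz; exact: dN.
apply: oppr_inj; rewrite oppr0 -[RHS](Veq x Ux) !opprD; congr (_ + _ + _).
- rewrite -sumrN; apply: eq_bigr => i _; rewrite -sumrN; apply: eq_bigr => j _.
  by rewrite d2 mulrN opprK.
- rewrite -sumrN; apply: eq_bigr => k _.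
  by rewrite (dN _ _ _ Vs Ux) mulrN opprK.
- by rewrite opprK /= mulrN.
Qed.

(** The strong maximum principle, read in a chart. *)
Lemma locally_maximal W (A : set M) (m : R) p : laplace_eq W -> Lambda <= 0 ->
  0 <= m -> open A -> (forall q, A q -> W q <= m) -> A p -> minterior X p ->
  W p = m -> \forall q \near p, W q = m.
Proof.
move=> WL L0 m0 oA Wm Ap pint Wp; have [a dp] := dom_cover X p.
have [Ws Weq] := WL a; have rp := minterior_region pint dp.
pose U := interior_region a `&` psi a @^-1` A.
have oU : open U.
  apply: open_preimage_in => //; first exact: interior_region_open.
  by move=> x /interior_regionP[].
have Usub : U `<=` interior_region a by move=> x [].
have Up : U (phi a p) by split=> //=; rewrite phiK.
apply: (near_manifold dp).
have oI := @interior_region_open a.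
apply: (@strong_maximum R n U (W \o psi a) (- Lambda) m
  (fun i j x => ginv (gmx g a) x i j) (laplace_drift a)) => //.
- by move=> k; apply: Ck_sub Usub (Ws k).
- move=> i j x /Usub; apply: smooth_in_continuous.
  by apply: ginv_smooth => //; [exact: gmx_region_smooth|exact: gmx_region_pos].
- move=> k x /Usub rx; apply: continuousN; apply: continuous_sum => i.
  apply: continuous_sum => j; apply: continuousM; apply: smooth_in_continuous rx.
    by apply: ginv_smooth => //; [exact: gmx_region_smooth|exact: gmx_region_pos].
  apply: christoffel_smooth => //; [exact: region_pos|exact: gmx_region_smooth|].
  exact: gmx_region_pos.
- move=> i j x /Usub rx; apply: (@ginv_sym _ _ (interior_region a)) => //.
  exact: gmx_region_sym.
- move=> x /Usub rx; apply: (@ginv_pos _ _ (interior_region a)) => //.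
    exact: gmx_region_sym.
  exact: gmx_region_pos.
- by rewrite oppr_ge0.
- by move=> x [_ Ax]; exact: Wm.
- by move=> x /Usub; exact: Weq.
- by rewrite /= phiK.
Qed.

End InteriorRegions.

(** * Sign regions of a static potential *)

Section StaticPotential.
Variables (R : realType) (n : nat) (M : topologicalType) (X : bmanifold R n M).
Variables (g : riemannian_metric X) (Lambda : R).
Hypothesis n_gt0 : (0 < n)%N.
Hypothesis M_connected : connected [set: M].
Hypothesis M_compact : compact [set: M].
Hypothesis LambdaP : cosmological_constant g Lambda.

Lemma clopen_setT (A : set M) : open A -> closed A -> A !=set0 -> A = setT.
Proof.
move=> oA cA A0; apply: M_connected => //; exists A => //; by rewrite setTI.
Qed.

Lemma smooth_fun_continuous (V : M -> R) : smooth_fun X V -> continuous V.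
Proof.
move=> Vs p; have [a dp] := dom_cover X p.
have px : (phi a @` dom a) (phi a p) by exists p.
have [U [F [oU Ux Fk FV]]] := Vs a (phi a p) px.
apply: (@continuous_near_eq _ _ (F \o phi a)).
  have nd : nbhs p (dom a) by apply: open_nbhs_nbhs; split=> //; exact: dom_open.
  have nU : nbhs p (phi a @^-1` U).
    by apply: (phi_continuous dp); apply: open_nbhs_nbhs.
  apply: filterS2 nd nU => q dq Uq /=; rewrite FV /= ?phiK //.
  by split=> //; exists q.
exact: (continuous_comp (phi_continuous dp) (Ck_continuous (Fk 0%N) Ux)).
Qed.

Section Potential.
Variable V : M -> R.
Hypothesis V_smooth : smooth_fun X V.
Hypothesis V_static : static_interior_eq g V.
Hypothesis V_nontrivial : exists p, V p <> 0.
Hypothesis Sigma_int : V @^-1` [set 0] `<=` minterior X.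

Let V_continuous := smooth_fun_continuous V_smooth.

Let v_smooth (a : chart_index X) : smooth_in (interior_region a) (V \o psi a).
Proof. exact/smooth_on_region/V_smooth. Qed.

Let region_static (a : chart_index X) x : interior_region a x ->
  hess (gmx g a) (V \o psi a) x - laplacian (gmx g a) (V \o psi a) x *: gmx g a x -
  (V \o psi a) x *: ricci (gmx g a) x = 0.
Proof. by move=> [[p dp <-] _]; exact: V_static. Qed.

Let region_scal (a : chart_index X) x : interior_region a x ->
  scal (gmx g a) x = (n.+1%:R - 1) * Lambda.
Proof. by move=> [[p dp <-] _]; exact: LambdaP. Qed.

Let oI := @interior_region_open R n M X.
Let posI := @region_pos R n M X.
Let Gs := @gmx_region_smooth R n M X g.
Let Gsym := @gmx_region_sym R n M X g.
Let Gpos := @gmx_region_pos R n M X g.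

Lemma static_laplace_eq : laplace_eq g Lambda V.
Proof.
move=> a; split=> // x rx.
rewrite /laplace_drift; apply: (@static_trace _ _ (interior_region a)) => //.
- exact: Gsym.
- exact: Gpos.
- exact: region_static.
- exact: region_scal.
Qed.

(** The second derivatives of V are linear in V and its first derivatives, so
    that zero initial values propagate along segments. *)
Lemma zero_near_critical (a : chart_index X) p : dom a p -> minterior X p -> V p = 0 ->
  (forall i, 'D_('e_i) (V \o psi a) (phi a p) = 0) -> \forall q \near p, V q = 0.
Proof.
move=> dp pint Vp dV; have rp := minterior_region pint dp.
apply: (near_manifold dp).
apply: (@zero_near R n.+1 (interior_region a) (V \o psi a)
  (fun k i j => christoffel (gmx g a) k i j)
  (fun i j x => ricci (gmx g a) x i j - Lambda * gmx g a x i j)) => //.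
- move=> k i j x; apply: smooth_in_continuous.
  by apply: christoffel_smooth => //; exact: Gpos.
- move=> i j x rx; apply: continuousB.
    apply: smooth_in_continuous rx.
    by apply: ricci_smooth => //; exact: Gpos.
  apply: continuousM; first exact: cst_continuous.
  by apply: smooth_in_continuous rx; exact: Gs.
- move=> i j x rx.
  apply: (@static_second_derivative _ _ (interior_region a)) => //.
  + exact: Gsym.
  + exact: Gpos.
  + exact: region_static.
  + exact: region_scal.
- by rewrite /= phiK.
Qed.

(** Otherwise the interior of the zero set would be nonempty. It is open, and
    closed because V and its differential vanish on its closure; the manifold
    being connected, V would be zero. *)
Lemma zero_not_critical (a : chart_index X) p : dom a p -> V p = 0 ->
  exists i, 'D_('e_i) (V \o psi a) (phi a p) != 0.
Proof.
move=> dp Vp; apply: contrapT => nodV.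
have dV i : 'D_('e_i) (V \o psi a) (phi a p) = 0.
  by apply: contrapT => /eqP dVi; apply: nodV; exists i.
pose Z : set M := (V @^-1` [set 0])°.
have ZV q : Z q -> V q = 0 by move=> /nbhs_singleton.
have oZ : open Z by exact: open_interior.
have cZ : closed Z.
  move=> q Zq.
  have Vq : V q = 0.
    have clV : closed (V @^-1` [set 0]).
      by apply: closed_comp => [r _|]; [exact: V_continuous|exact: closed_eq].
    have := closureS (fun r Zr => ZV r Zr) Zq.
    by rewrite -((closure_id (V @^-1` [set 0])).1 clV).
  have qint : minterior X q by exact: Sigma_int.
  have [b dq] := dom_cover X q.
  apply: (zero_near_critical dq) => // i; apply: contrapT => /eqP dq0.
  have rq := minterior_region qint dq.
  have dc := smooth_in_continuous (smooth_in_derive i (v_smooth b)) rq.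
  have : \forall r \near q, dom b r /\ 'D_('e_i) (V \o psi b) (phi b r) != 0.
    apply: filterI; first by apply: open_nbhs_nbhs; split=> //; exact: dom_open.
    have nn : nbhs ('D_('e_i) (V \o psi b) (phi b q)) [set t | t != 0].
      by apply: open_nbhs_nbhs; split=> //; exact: open_neq.
    exact: (continuous_comp (phi_continuous dq) dc nn).
  move=> /Zq [r [Zr [dr /eqP]]]; apply.
  have rint : minterior X r by apply: Sigma_int; exact: ZV.
  have near0 : \forall x \near phi b r, (V \o psi b) x = 0.
    exact: (@near_region R n M X b r (fun q => V q = 0) rint dr Zr).
  rewrite (@near_eq_derive _ _ _ _ (fun=> 0) _ _ near0); exact: derive_cst.
have pint : minterior X p by exact: Sigma_int.
have ZT := clopen_setT oZ cZ (ex_intro _ p (zero_near_critical dp pint Vp dV)).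
have [q] := V_nontrivial; apply; apply: ZV; by rewrite ZT.
Qed.

(** A zero that is not a limit of positive values is a local maximum, hence
    critical. *)
Lemma zero_in_closure_pos p : V p = 0 -> closure [set q | 0 < V q] p.
Proof.
move=> Vp; have [a dp] := dom_cover X p.
have pint : minterior X p by exact: Sigma_int.
apply: contrapT => /existsNP [B /not_implyP [nB /set0P/negP]]; rewrite negbK => /eqP BV.
have Vle : \forall q \near p, V q <= 0.
  apply: filterS nB => q Bq; rewrite leNgt; apply/negP => Vq.
  by have : ([set q | 0 < V q] `&` B) q by []; rewrite BV.
have [i] := zero_not_critical dp Vp.
rewrite (local_max_gradient (@oI a) (v_smooth a) (minterior_region pint dp)) ?eqxx //.
by rewrite /= phiK // Vp; exact: (near_region pint dp Vle).
Qed.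

Lemma zero_in_closure_neg p : V p = 0 -> closure [set q | V q < 0] p.
Proof.
move=> Vp; have [a dp] := dom_cover X p.
have pint : minterior X p by exact: Sigma_int.
apply: contrapT => /existsNP [B /not_implyP [nB /set0P/negP]]; rewrite negbK => /eqP BV.
have Vge : \forall q \near p, 0 <= V q.
  apply: filterS nB => q Bq; rewrite leNgt; apply/negP => Vq.
  by have : ([set q | V q < 0] `&` B) q by []; rewrite BV.
have [NVs _] := laplace_eqN static_laplace_eq a.
have [i /eqP] := zero_not_critical dp Vp; apply.
have rp := minterior_region pint dp.
have := @local_max_gradient _ _ _ (fun x => - (V \o psi a) x) _ (@oI a) NVs rp _ i.
rewrite deriveN; last exact: smooth_in_derivable (v_smooth a) rp.
move=> /(_ _)/eqP; rewrite oppr_eq0 => NV; apply/eqP/NV.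
rewrite /= phiK // Vp oppr0.
apply: (near_region pint dp (P := fun q => - V q <= 0)).
by apply: filterS Vge => q; rewrite oppr_le0.
Qed.

End Potential.

Section PositiveRegion.
Variable W : M -> R.
Hypothesis W_continuous : continuous W.
Hypothesis W_eq : laplace_eq g Lambda W.
Hypothesis Lambda_le0 : Lambda <= 0.
Hypothesis W_zero : exists p, W p = 0.

(** By the maximum principle W cannot have a maximum on an open and closed
    part of its positive region that avoids the boundary. *)
Lemma positive_part_meets_boundary (A : set M) : open A -> A !=set0 ->
  A `<=` [set p | 0 < W p] ->
  (forall p, closure A p -> 0 < W p -> A p) -> exists2 q, A q & mboundary X q.
Proof.
move=> oA [p0 Ap0] Apos clA; apply: contrapT => noA.
have Aint q : A q -> minterior X q by move=> Aq bq; apply: noA; exists q.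
have cA : compact (closure A).
  exact: (subclosed_compact (@closed_closure _ A) M_compact (@subsetT _ _)).
have cA0 : closure A !=set0 by exists p0; exact: subset_closure.
have [q clq qmax] := compact_EVT_max cA0 cA (continuous_subspaceT W_continuous).
have {}clq : closure A q by exact: set_mem clq.
have Wmax p : A p -> W p <= W q.
  by move=> Ap; apply/qmax/mem_set; exact: subset_closure.
have Wq0 : 0 < W q by apply: lt_le_trans (Apos _ Ap0) (Wmax _ Ap0).
pose D := A `&` W @^-1` [set W q].
have oD : open D.
  rewrite openE => p [Ap Wp]; apply: filterI; first by move: oA; rewrite openE; exact.
  apply: (locally_maximal W_eq Lambda_le0 (ltW Wq0) oA Wmax Ap _ Wp).
  exact: Aint.
have cD : closed D.
  have -> : D = closure A `&` W @^-1` [set W q].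
    apply/seteqP; split => p [Ap Wp]; split=> //; first exact: subset_closure.
    by apply: clA => //; rewrite Wp.
  apply: closedI; first exact: closed_closure.
  by apply: closed_comp => [p _|]; [exact: W_continuous|exact: closed_eq].
have DT : D = setT by apply: clopen_setT oD cD _; exists q; split=> //; exact: clA.
have [p Wp] := W_zero; have : D p by rewrite DT.
by move=> [_ /= WpE]; move: Wq0; rewrite -WpE Wp ltxx.
Qed.

(** If the positive region split, both pieces would reach the boundary, hence the
    slice s, and would split it. *)
Lemma positive_connected (N : topologicalType) (s : N -> M) :
  connected [set: N] -> continuous s -> (forall x, 0 < W (s x)) ->
  (forall q, mboundary X q -> 0 < W q -> exists x, q = s x) ->
  connected [set p | 0 < W p].
Proof.
move=> cN sc spos bs B B0 [C1 oC1 BC1] [C2 cC2 BC2].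
apply: contrapT => BW.
have oP : open [set p | 0 < W p].
  apply: (@open_comp _ _ W [set t | 0 < t]) => [p _|]; [exact: W_continuous|].
  exact: open_gt.
pose B' := [set p | 0 < W p] `&` ~` C2.
have oB : open B by rewrite BC1; exact: openI.
have oB' : open B' by apply: openI => //; exact: closed_openC.
have B'0 : B' !=set0.
  apply: contrapT => no; apply: BW; apply/seteqP; split => p; first by rewrite BC1 => -[].
  move=> Wp; rewrite BC2; split=> //; apply: contrapT => C2p; apply: no.
  by exists p.
have B'E : B' `<=` ~` C1.
  move=> p [Wp C2p] C1p; apply: C2p; have Bp : B p by rewrite BC1.
  by move: Bp; rewrite BC2 => -[].
have [q Bq bq] : exists2 q, B q & mboundary X q.
  apply: positive_part_meets_boundary => //; first by rewrite BC1 => p [].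
  move=> p Bp Wp; rewrite BC2; split=> //.
  have : closure C2 p by apply: closureS Bp; rewrite BC2 => r [].
  by rewrite -((closure_id _).1 cC2).
have [q' B'q bq'] : exists2 q, B' q & mboundary X q.
  apply: positive_part_meets_boundary => //; first by move=> p [].
  move=> p B'p Wp; split=> // C2p.
  have : closure (~` C1) p by exact: closureS B'p.
  rewrite -((closure_id _).1 (open_closedC oC1)); apply.
  have Bp : B p by rewrite BC2.
  by move: Bp; rewrite BC1 => -[].
have [x qx] : exists x, q = s x by apply: bs => //; move: Bq; rewrite BC1 => -[].
have [x' qx'] : exists x, q' = s x by apply: bs => //; case: B'q.
have : s @^-1` B = setT.
  apply: cN; first by exists x; rewrite /= -qx.
    exists (s @^-1` B); last by rewrite setTI.
    by apply: open_comp => // y _; exact: sc.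
  exists (s @^-1` C2).
    by apply: closed_comp => // y _; exact: sc.
  rewrite setTI; apply/seteqP; split => y /=; first by rewrite BC2 => -[].
  by move=> C2y; rewrite BC2; split=> //; exact: spos.
move=> /seteqP[_ /(_ x' I)] /=; rewrite -qx' BC2 => -[_ C2q'].
by case: B'q.
Qed.

End PositiveRegion.
End StaticPotential.

Lemma slice_sign (R : realType) (M N : topologicalType) (W : M -> R) (s : N -> M) :
  connected [set: N] -> [set: N] !=set0 -> continuous s -> continuous W ->
  (forall x, W (s x) <> 0) ->
  (forall x, 0 < W (s x)) \/ (forall x, W (s x) < 0).
Proof.
move=> cN [x0 _] sc Wc W0.
have Wsc : continuous (W \o s) by move=> x; exact: (continuous_comp (sc x) (Wc _)).
have itv : is_interval ((W \o s) @` [set: N]).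
  apply/connected_intervalP/connected_continuous_connected => //.
  exact: continuous_subspaceT.
have pt x : ((W \o s) @` [set: N]) (W (s x)) by exists x.
have no0 : ~ ((W \o s) @` [set: N]) 0 by move=> [x _ /= /W0].
have [neg|pos|] := ltgtP (W (s x0)) 0; last by move/W0.
- right => x; rewrite ltNge; apply/negP => Wx; apply: no0.
  by apply: (itv _ _ (pt x0) (pt x)); rewrite Wx ltW.
- left => x; rewrite ltNge; apply/negP => Wx; apply: no0.
  by apply: (itv _ _ (pt x) (pt x0)); rewrite Wx ltW.
Qed.

(** * The two ends and the conclusion *)

Section SlicedZeroSet.
Variables (R : realType) (n : nat) (M : topologicalType) (X : bmanifold R n M).
Variables (g : riemannian_metric X) (Lambda : R).
Hypothesis M_connected : connected [set: M].
Hypothesis M_compact : compact [set: M].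
Hypothesis Lambda_le0 : Lambda <= 0.
Variables (N : topologicalType) (f : M -> N * R) (h : N * R -> M).
Hypothesis N_connected : connected [set: N].
Hypothesis fh : homeo_between [set: M] [set y : N * R | 0 <= y.2 <= 1] f h.
Hypothesis boundaryP : forall p, mboundary X p <-> (f p).2 = 0 \/ (f p).2 = 1.

Lemma slice_continuous t : 0 <= t <= 1 -> continuous (fun x => h (x, t)).
Proof.
move=> t01 x.
have -> : (fun x => h (x, t)) = (fun x => hclamp h (x, t)).
  by apply/funext => z; rewrite /hclamp clamp_id.
have pc : {for x, continuous (fun z : N => (z, t))}.
  by apply: continuous_pair; [exact: cvg_id|exact: cst_continuous].
exact: (continuous_comp pc (@hclamp_continuous _ _ _ _ _ fh (x, t))).
Qed.

Lemma boundary_slice q : mboundary X q ->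
  q = h ((f q).1, 0) \/ q = h ((f q).1, 1).
Proof.
have hfq := cylinder_hf fh q.
by move/boundaryP => [] E; [left|right]; rewrite -E -surjective_pairing hfq.
Qed.

(** Each sign region only sees one end of the cylinder, so both are connected and
    [zero_set_connected] applies. *)
Lemma connected_zero_of_ends (W : M -> R) : continuous W ->
  laplace_eq g Lambda W -> (exists p, W p = 0) ->
  (forall p, W p = 0 -> closure [set q | 0 < W q] p) ->
  (forall p, W p = 0 -> closure [set q | W q < 0] p) ->
  (forall x, 0 < W (h (x, 0))) -> (forall x, W (h (x, 1)) < 0) ->
  connected (W @^-1` [set 0]).
Proof.
move=> Wc WL W0 clp cln s0 s1.
have t0 : 0 <= (0 : R) <= 1 by rewrite lexx ler01.
have t1 : 0 <= (1 : R) <= 1 by rewrite lexx ler01.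
apply: (zero_set_connected fh M_compact (bman_hausdorff X) Wc _ _ clp cln s0).
  apply: (positive_connected M_connected M_compact Wc WL Lambda_le0 W0 N_connected
    (slice_continuous t0) s0) => q bq Wq.
  have [->|qE] := boundary_slice bq; first by exists (f q).1.
  by move: Wq; rewrite qE ltNge ltW.
have -> : [set p | W p < 0] = [set p | 0 < - W p].
  by apply/seteqP; split => p /=; rewrite oppr_gt0.
have NWc : continuous (fun p => - W p) by move=> p; apply: continuousN; exact: Wc.
have NW0 : exists p, - W p = 0 by have [p Wp] := W0; exists p; rewrite Wp oppr0.
apply: (positive_connected M_connected M_compact NWc (laplace_eqN WL) Lambda_le0 NW0
  N_connected (slice_continuous t1)) => [x|q bq]; first by rewrite oppr_gt0.
rewrite oppr_gt0 => Wq; have [qE|->] := boundary_slice bq; last by exists (f q).1.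
by move: Wq; rewrite qE ltNge ltW.
Qed.

End SlicedZeroSet.


Theorem theorem1p4 (R : realType) (n : nat) (M : topologicalType)
    (X : bmanifold R n M) (g : riemannian_metric X) (V : M -> R) (Lambda : R)
    (dim_ge2 : (2 <= n.+1)%N)
    (M_connected : connected [set: M])
    (M_orientable : orientable X)
    (M_compact : compact [set: M])
    (M_static : static_manifold_with_boundary g V)
    (LambdaP : cosmological_constant g Lambda)
    (Lambda_le0 : Lambda <= 0)
    (M_cylinder : topological_cylinder R M)
    (Sigma_int : V @^-1` [set 0] `<=` minterior X) :
  connected (V @^-1` [set 0]).
Proof.
have n_gt0 : (0 < n)%N by rewrite -ltnS.
have [V_smooth V_nontrivial V_static _] := M_static.
have [->|/set0P [p0 Vp0]] := eqVneq (V @^-1` [set 0]) set0.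
  exact: connected0.
have [N [NP [f [h fh]]]] := M_cylinder.
have [_ _ _ N_connected _] := NP.
have boundaryP := mboundary_cylinder X NP fh.
have Vc := smooth_fun_continuous V_smooth.
have VL := static_laplace_eq n_gt0 LambdaP V_smooth V_static.
have clp := zero_in_closure_pos n_gt0 M_connected LambdaP V_smooth V_static
  V_nontrivial Sigma_int.
have cln := zero_in_closure_neg n_gt0 M_connected LambdaP V_smooth V_static
  V_nontrivial Sigma_int.
have V0 : exists p, V p = 0 by exists p0.
have N0 : [set: N] !=set0 by exists (f p0).1.
have t0 : 0 <= (0 : R) <= 1 by rewrite lexx ler01.
have t1 : 0 <= (1 : R) <= 1 by rewrite lexx ler01.
have end_neq0 t x : 0 <= t <= 1 -> t = 0 \/ t = 1 -> V (h (x, t)) <> 0.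
  by move=> t01 tE /Sigma_int; apply; apply/boundaryP; rewrite (cylinder_fh fh).
have sign0 := slice_sign N_connected N0 (slice_continuous fh t0) Vc
  (fun x => end_neq0 0 x t0 (or_introl erefl)).
have sign1 := slice_sign N_connected N0 (slice_continuous fh t1) Vc
  (fun x => end_neq0 1 x t1 (or_intror erefl)).
(* The two ends have opposite signs: a sign region that misses both of them would
   miss the boundary. *)
have meets (W : M -> R) : continuous W -> laplace_eq g Lambda W ->
    (exists p, W p = 0) -> (forall p, W p = 0 -> closure [set q | 0 < W q] p) ->
    (forall x, W (h (x, 0)) < 0) -> (forall x, W (h (x, 1)) < 0) -> False.
  move=> Wc WL W0 Wcl s0 s1; have [p Wp] := W0.
  have [q Wq bq] : exists2 q, 0 < W q & mboundary X q.
    apply: (positive_part_meets_boundary M_connected M_compact Wc WL Lambda_le0 W0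
      (A := [set p | 0 < W p])) => //.
      apply: (@open_comp _ _ W [set t | 0 < t]) => [r _|]; [exact: Wc|exact: open_gt].
    by have [r [Wr _]] := Wcl p Wp _ filterT; exists r.
  by have [qE|qE] := boundary_slice fh boundaryP bq; move: Wq; rewrite qE ltNge ltW.
have NVc : continuous (fun p => - V p) by move=> p; apply: continuousN; exact: Vc.
have NV0 : exists p, - V p = 0 by exists p0; rewrite Vp0 oppr0.
have NVL := laplace_eqN VL.
have NVp p : - V p = 0 -> closure [set q | 0 < - V q] p.
  have -> : [set q | 0 < - V q] = [set q | V q < 0].
    by apply/seteqP; split => q /=; rewrite oppr_gt0.
  by move=> /eqP; rewrite oppr_eq0 => /eqP; exact: cln.
have NVn p : - V p = 0 -> closure [set q | - V q < 0] p.
  have -> : [set q | - V q < 0] = [set q | 0 < V q].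
    by apply/seteqP; split => q /=; rewrite oppr_lt0.
  by move=> /eqP; rewrite oppr_eq0 => /eqP; exact: clp.
case: sign0 => s0; case: sign1 => s1.
- by case: (meets _ NVc NVL NV0 NVp) => x; rewrite oppr_lt0.
- exact: (connected_zero_of_ends M_connected M_compact Lambda_le0 N_connected fh
    boundaryP Vc VL V0 clp cln s0 s1).
- have -> : V @^-1` [set 0] = (fun p => - V p) @^-1` [set 0].
    by apply/seteqP; split => p /= /eqP; [|rewrite oppr_eq0] => /eqP; [move->; rewrite oppr0|].
  apply: (connected_zero_of_ends M_connected M_compact Lambda_le0 N_connected fh
    boundaryP NVc NVL NV0 NVp NVn) => x; [rewrite oppr_gt0|rewrite oppr_lt0]; [exact: s0|exact: s1].
- by case: (meets _ Vc VL V0 clp s0 s1).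
Qed.
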